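(* The algebra $\widehat{\operatorname{TL}}(W)$ is a cellular algebra in the sense of Graham and Lehrer, with cell datum $(\Lambda,M,C,* )$ where $\Lambda=\{0,1,\dots,n\}$ with the usual total order; $M(\lambda)$ is the set of even dotted $(\lambda,n)$-tangles; $C^\lambda_{\alpha,\beta}$ (for $\alpha,\beta\in M(\lambda)$) is the diagram obtained by putting $\alpha$ on top of $\beta^*$ and concatenating; and $*:\widehat{\operatorname{TL}}(W)\to\widehat{\operatorname{TL}}(W)$ is the anti-automorphism obtained by reflecting tangle diagrams in a horizontal line.
   Context: Let $n\ge 4$, $\mathcal L=\mathbb Z[q,q^{-1}]$. A decorated $(m,k)$-tangle is a collection of non-intersecting arcs and closed loops in a rectangle joining in pairs $m$ marked points on the bottom face and $k$ on the top face, up to isotopy, carrying finitely many dots on its components, each dot reachable from the left face by a path not meeting the tangle; arcs joining two top points are cups, two bottom points caps, a top and a bottom point edges. $e_i$ ($1\le i\le n-1$) is the $(n,n)$-tangle with a cup joining top points $i,i+1$, a cap joining bottom points $i,i+1$, vertical edges elsewhere; $e_0$ is $e_1$ with one dot on its cup and one on its cap. $\mathbb T_n$ is the free $\mathcal L$-algebra on decorated $(n,n)$-tangles with product given by vertical concatenation (placing one tangle on top of the other and gluing the matching points), and $\mathbb{DT}_n$ its subalgebra generated by $e_0,\dots,e_{n-1}$. $\widehat{\operatorname{TL}}(W)$ is the quotient of $\mathbb{DT}_n$ by the local relations: an undotted closed loop equals $q+q^{-1}$; two dots on the same component cancel; a closed loop with exactly one dot equals $0$; and, if $n$ is even, additionally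 by the subspace spanned by all diagrams with no edges and an odd number of undotted cups. An even dotted $(\lambda,n)$-tangle is a decorated $(\lambda,n)$-tangle without closed loops, with at most one dot on each component, in which every bottom point is joined to a top point, and such that the number of dotted edges plus the number of undotted cups is even. For a tangle $T$, $T^*$ is its reflection in a horizontal line. A cell datum $(\Lambda,M,C,* )$ means: $\Lambda$ a poset, $M(\lambda)$ finite sets, $C:\bigsqcup_\lambda M(\lambda)\times M(\lambda)\to H$ injective with image a basis, $*$ an algebra anti-automorphism with $(C^\lambda_{\alpha,\beta})^*=C^\lambda_{\beta,\alpha}$, and for all $x\in H$, $xC^\mu_{\gamma,\delta}\equiv\sum_{\gamma'\in M(\mu)}r_x(\gamma',\gamma)C^\mu_{\gamma',\delta}$ modulo the span of $\{C^\nu_{\gamma'',\delta''}\mid \nu<\mu\}$, with $r_x(\gamma',\gamma)$ independent of $\delta$. *)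

(* Defs.v *)
From HB Require Import structures.
From mathcomp Require Import all_boot all_order all_algebra.
From mathcomp Require Import fraction boolp.
From mathcomp Require Import ring.
From mathcomp Require Import finmap.
From mathcomp.multinomials Require Import monalg.
Set Implicit Arguments. Unset Strict Implicit. Unset Printing Implicit Defensive.
Import GRing.Theory.
Local Open Scope ring_scope.

(* The coefficient ring  L = Z[q, q^-1]  of Laurent polynomials, realised  *)
(* as the subring of the field of rational functions Frac(Z[X]) consisting *)
(* of the fractions p / X^k (p in Z[X], k in N); q is the class of X.      *)

Definition RatF := {fraction {poly int}}.
Definition Xf : RatF := (tofrac 'X).
Lemma Xf_neq0 : Xf != 0.
Proof. by rewrite /Xf tofrac_eq0 polyX_eq0. Qed.

Definition laurent_pred : pred RatF :=
  fun x => `[< exists (p : {poly int}) (k : nat), x = tofrac p / Xf ^+ k >].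

Lemma laurent_auxB (F : fieldType) (a b x : F) (k l : nat) : x != 0 ->
  a / x ^+ k - b / x ^+ l = (a * x ^+ l - b * x ^+ k) / x ^+ (k + l).
Proof. by move=> hx; rewrite exprD; field; rewrite ?expf_neq0. Qed.
Lemma laurent_auxM (F : fieldType) (a b x : F) (k l : nat) : x != 0 ->
  (a / x ^+ k) * (b / x ^+ l) = (a * b) / x ^+ (k + l).
Proof. by move=> hx; rewrite exprD; field; rewrite ?expf_neq0. Qed.

Lemma laurent_subring : subring_closed laurent_pred.
Proof.
split.
- apply/asboolP; exists 1, 0%N; by rewrite expr0 divr1 tofrac1.
- move=> x y /asboolP[p [k ->]] /asboolP[r [l ->]]; apply/asboolP.
  exists (p * 'X^l - r * 'X^k), (k + l)%N.
  by rewrite (laurent_auxB _ _ _ _ Xf_neq0) tofracB !tofracM !rmorphXn.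
- move=> x y /asboolP[p [k ->]] /asboolP[r [l ->]]; apply/asboolP.
  exists (p * r), (k + l)%N.
  by rewrite (laurent_auxM _ _ _ _ Xf_neq0) tofracM.
Qed.

HB.instance Definition _ := GRing.isSubringClosed.Build RatF laurent_pred laurent_subring.
Record L := Laurent { lval : RatF; _ : lval \in laurent_pred }.
HB.instance Definition _ := [isSub for lval].
HB.instance Definition _ := [Choice of L by <:].
HB.instance Definition _ := [SubChoice_isSubComNzRing of L by <:].
Lemma Xf_laurent : Xf \in laurent_pred.
Proof. apply/asboolP; exists 'X, 0%N; by rewrite expr0 divr1. Qed.
Lemma Xfinv_laurent : Xf^-1 \in laurent_pred.
Proof. apply/asboolP; exists 1, 1%N; by rewrite expr1 tofrac1 div1r. Qed.
Definition q : L := Laurent Xf_laurent.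
Definition qinv : L := Laurent Xfinv_laurent.

Definition delta : L := q + qinv.

(* Generic notion: a cellular algebra (Graham--Lehrer) given by           *)
(* representatives.  The algebra is  H = A / (A n I)  where  V  is an     *)
(* ambient R-module with a bilinear product  mul, A : V -> Prop is the    *)
(* subalgebra (submodule) of representatives and I : V -> Prop the        *)
(* submodule of relations; "x = y in H" means  I (x - y).                 *)
(* The poset Lambda is {0,...,N} with the usual order of nat.             *)

Definition span_of (R : nzRingType) (V : lmodType R) (S : V -> Prop) (x : V) :
  Prop :=
  exists s : seq (R * V), (forall p, p \in s -> S p.2) /\
                          x = \sum_(p <- s) p.1 *: p.2.

Section Cellular.
Variables (R : comNzRingType) (V : lmodType R).
Variables (A I : V -> Prop) (mul : V -> V -> V) (one : V) (star : V -> V).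
Variables (K : choiceType) (N : nat) (M : nat -> K -> Prop)
          (C : nat -> K -> K -> V).

Definition cidx (i : nat * K * K) : Prop :=
  [/\ (i.1.1 <= N)%N, M i.1.1 i.1.2 & M i.1.1 i.2].
Definition Cof (i : nat * K * K) : V := C i.1.1 i.1.2 i.2.

Record is_cellular : Prop := {
  cell_A_span : forall x, span_of A x -> A x;
  cell_A_one  : A one;
  cell_A_mul  : forall x y, A x -> A y -> A (mul x y);
  cell_I_span : forall x, span_of I x -> I x;
  cell_ideal  : forall x y, A x -> A y -> I y -> I (mul x y) /\ I (mul y x);
  cell_M_fin  : forall lam, (lam <= N)%N ->
                  exists s : seq K, forall a, M lam a <-> a \in s;
  cell_C_in   : forall i, cidx i -> A (Cof i);
  cell_C_inj  : forall i j, cidx i -> cidx j -> I (Cof i - Cof j) -> i = j;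
  cell_C_span : forall x, A x ->
                  exists s : seq (R * (nat * K * K)),
                    (forall p, p \in s -> cidx p.2) /\
                    I (x - \sum_(p <- s) p.1 *: Cof p.2);
  cell_C_free : forall s : seq (R * (nat * K * K)),
                  uniq (map snd s) -> (forall p, p \in s -> cidx p.2) ->
                  I (\sum_(p <- s) p.1 *: Cof p.2) ->
                  forall p, p \in s -> p.1 = 0;
  cell_star_lin  : forall (a : R) x y, star (a *: x + y) = a *: star x + star y;
  cell_star_A    : forall x, A x -> A (star x);
  cell_star_I    : forall x, A x -> I x -> I (star x);
  cell_star_anti : forall x y, A x -> A y ->
                     I (star (mul x y) - mul (star y) (star x));
  cell_star_invol : forall x, A x -> I (star (star x) - x);
  cell_star_C : forall lam a b, cidx (lam, a, b) ->
                  I (star (C lam a b) - C lam b a);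
  cell_mul : forall x mu g, A x -> (mu <= N)%N -> M mu g ->
     exists r : seq (R * K),
       (forall p, p \in r -> M mu p.2) /\ uniq (map snd r) /\
       forall d, M mu d ->
         exists y, span_of (fun z => exists i, [/\ cidx i, (i.1.1 < mu)%N
                                                    & z = Cof i]) y /\
           I (mul x (C mu g d) - \sum_(p <- r) p.1 *: C mu p.2 d - y)
}.
End Cellular.

(* A raw decorated (m,k)-tangle is a triple (s, d, l) of lists of nats:    *)
(*  - points 0..m-1 are the bottom points (left to right), points          *)
(*    m..m+k-1 the top points (left to right);                             *)
(*  - s is the fixed-point-free involution matching the end points of the  *)
(*    arcs;                                                                *)
(*  - d p is the number of dots on the arc through p (stored at both ends);*)
(*  - l is the sorted list of dot counts of the closed loops.              *)
(* (closed loops are recorded without their nesting)         *)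

Definition raw := (seq nat * seq nat * seq nat)%type.
Definition rm (t : raw) : seq nat := t.1.1.
Definition rd (t : raw) : seq nat := t.1.2.
Definition rl (t : raw) : seq nat := t.2.

Section RawTangle.
Variables (m k : nat) (t : raw).
Local Notation s p := (nth 0%N (rm t) p).
Local Notation d p := (nth 0%N (rd t) p).

(* position on the boundary circle, read counterclockwise from the       *)
(* bottom-left corner: bottom points left to right, then top points right *)
(* to left; the left face lies between the last and the first position.  *)
Definition bpos (p : nat) : nat := if (p < m)%N then p else ((m + m + k).-1 - p)%N.
Definition alo (p : nat) : nat := minn (bpos p) (bpos (s p)).
Definition ahi (p : nat) : nat := maxn (bpos p) (bpos (s p)).
Definition arcs_cross (p r : nat) : bool :=
  ((alo p < alo r) && (alo r < ahi p) && (ahi p < ahi r))%N.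
(* the arc through p can be reached from the left face *)
Definition exposed (p : nat) : bool :=
  ~~ has (fun r => (alo r < alo p) && (ahi p < ahi r))%N (iota 0 (m + k)).

Definition valid_tangle : bool :=
  [&& size (rm t) == (m + k)%N, size (rd t) == (m + k)%N,
      all (fun p => [&& (s p < m + k)%N, s p != p, s (s p) == p,
                        d (s p) == d p & (0 < d p)%N ==> exposed p])
          (iota 0 (m + k)),
      all (fun p => all (fun r => ~~ arcs_cross p r) (iota 0 (m + k)))
          (iota 0 (m + k))
    & sorted leq (rl t)].

Definition reduced_tangle : bool :=
  (rl t == [::]) && all (fun p => d p <= 1)%N (iota 0 (m + k)).

Definition is_edge_at (p : nat) : bool := (p < m)%N != (s p < m)%N.
Definition n_dotted_edges : nat :=
  count (fun p => (p < m)%N && (m <= s p)%N && (d p == 1%N)) (iota 0 (m + k)).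
Definition n_undotted_cups : nat :=
  count (fun p => [&& (m <= p)%N, (p < s p)%N & d p == 0%N]) (iota 0 (m + k)).

Definition even_dotted : bool :=
  [&& valid_tangle, reduced_tangle,
      all (fun p => (m <= s p)%N) (iota 0 m)
    & ~~ odd (n_dotted_edges + n_undotted_cups)].
End RawTangle.

Definition rstar (m k : nat) (t : raw) : raw :=
  let old y := if (y < k)%N then (m + y)%N else (y - k)%N in
  let nw p := if (p < m)%N then (k + p)%N else (p - m)%N in
  ([seq nw (nth 0%N (rm t) (old y)) | y <- iota 0 (k + m)],
   [seq nth 0%N (rd t) (old y) | y <- iota 0 (k + m)],
   rl t).

(* vertical concatenation: S is an (a,b)-tangle placed below the          *)
(* (b,c)-tangle T; the result is an (a,c)-tangle.                          *)
Section Concat.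
Variables (a b c : nat) (S T : raw).
Local Notation sS p := (nth 0%N (rm S) p).
Local Notation dS p := (nth 0%N (rd S) p).
Local Notation sT p := (nth 0%N (rm T) p).
Local Notation dT p := (nth 0%N (rd T) p).
Definition fuel : nat := (a + b + c).+1.

(* follow a path: side = true means we are at point p of S, false at      *)
(* point p of T; returns the result end point and the number of dots met  *)
Fixpoint cwalk (f : nat) (side : bool) (p acc : nat) : option (nat * nat) :=
  match f with
  | 0 => None
  | f'.+1 =>
    if side then
      let r := sS p in let acc' := (acc + dS p)%N in
      if (r < a)%N then Some (r, acc') else cwalk f' false (r - a) acc'
    else
      let r := sT p in let acc' := (acc + dT p)%N in
      if (b <= r)%N then Some ((a + (r - b))%N, acc')
      else cwalk f' true (a + r) acc'
  end.

Definition cstart (x : nat) : option (nat * nat) :=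
  if (x < a)%N then cwalk fuel true x 0 else cwalk fuel false (b + (x - a)) 0.

Definition on_loop (j : nat) : bool := cwalk fuel false j 0 == None.

Fixpoint ctrav (f j0 cur acc : nat) (vis : seq nat) : seq nat * nat :=
  match f with
  | 0 => (vis, acc)
  | f'.+1 =>
    let q1 := sT cur in
    let q2 := (sS (a + q1) - a)%N in
    let acc' := (acc + dT cur + dS (a + q1))%N in
    if q2 == j0 then (q1 :: vis, acc')
    else ctrav f' j0 q2 acc' (q2 :: q1 :: vis)
  end.
Definition loop_at (j : nat) := ctrav fuel j j 0 [:: j].

Definition new_loops : seq nat :=
  [seq (loop_at j).2 | j <- iota 0 b &
     on_loop j && all (fun v => j <= v)%N (loop_at j).1].

Definition concat : raw :=
  ([seq (odflt (0, 0) (cstart x)).1 | x <- iota 0 (a + c)]%N,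
   [seq (odflt (0, 0) (cstart x)).2 | x <- iota 0 (a + c)]%N,
   sort leq (rl S ++ rl T ++ new_loops)).
End Concat.

Definition id_raw (n : nat) : raw :=
  ([seq (if p < n then p + n else p - n)%N | p <- iota 0 (n + n)],
   nseq (n + n) 0%N, [::]).

(* e_i for 1 <= i <= n-1 (points numbered from 1 in the paper) *)
Definition e_match (n i : nat) (p : nat) : nat :=
  if p == i.-1 then i else if p == i then i.-1
  else if p == (n + i.-1)%N then (n + i)%N else if p == (n + i)%N then (n + i.-1)%N
  else if (p < n)%N then (p + n)%N else (p - n)%N.

Definition e_raw (n i : nat) : raw :=
  if i == 0%N then
    ([seq e_match n 1 p | p <- iota 0 (n + n)],
     [seq (if p \in [:: 0; 1; n; n.+1] then 1 else 0)%N | p <- iota 0 (n + n)],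
     [::])
  else ([seq e_match n i p | p <- iota 0 (n + n)], nseq (n + n) 0%N, [::]).

Definition Tn := {malg L[raw]}.
Definition tb (t : raw) : Tn := << t >>.

(* product: x * y is x placed on top of y *)
Definition tmul (n : nat) (x y : Tn) : Tn :=
  \sum_(u <- msupp x) \sum_(v <- msupp y)
     (x@_u * y@_v) *: tb (concat n n n v u).
Definition tone (n : nat) : Tn := tb (id_raw n).
Definition tstar (n : nat) (x : Tn) : Tn :=
  \sum_(u <- msupp x) x@_u *: tb (rstar n n u).

Definition egen (n : nat) (i : 'I_n) : Tn := tb (e_raw n i).
Definition DT (n : nat) (x : Tn) : Prop :=
  span_of (fun y => exists w : seq 'I_n,
              y = foldr (tmul n) (tone n) [seq egen i | i <- w]) x.

Definition set_dots (t : raw) (p v : nat) : raw :=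
  (rm t, set_nth 0%N (set_nth 0%N (rd t) p v) (nth 0%N (rm t) p) v, rl t).

Definition loc_rel_gen (n : nat) (x : Tn) : Prop :=
  exists t : raw, valid_tangle n n t /\
  [\/
      ((0%N \in rl t) /\ x = tb t - delta *: tb (rm t, rd t, rem 0%N (rl t))),
      (exists p, [/\ (p < n + n)%N, (2 <= nth 0%N (rd t) p)%N &
                    x = tb t - tb (set_dots t p (nth 0%N (rd t) p - 2)%N)]),
      (exists v, [/\ v \in rl t, (2 <= v)%N &
          x = tb t - tb (rm t, rd t, sort leq ((v - 2)%N :: rem v (rl t)))])
    |
      ((1%N \in rl t) /\ x = tb t)].

Definition even_rel_gen (n : nat) (x : Tn) : Prop :=
  exists t : raw, [/\ ~~ odd n, valid_tangle n n t, reduced_tangle n n t,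
    all (fun p => ~~ is_edge_at n t p) (iota 0 (n + n)) /\
      odd (n_undotted_cups n n t) & x = tb t].

Definition rel_gen (n : nat) (x : Tn) : Prop :=
  loc_rel_gen n x \/ even_rel_gen n x.

Definition TLrel (n : nat) (x : Tn) : Prop := span_of (rel_gen n) x.

Definition Mset (n : nat) (lam : nat) (t : raw) : Prop := even_dotted lam n t.
Definition Cbasis (n : nat) (lam : nat) (al be : raw) : Tn :=
  tb (concat n lam n (rstar lam n be) al).

(* Main.v *)
Require Import Defs.
From HB Require Import structures.
From mathcomp Require Import all_boot all_order all_algebra.
From mathcomp Require Import zify finmap.
From mathcomp.multinomials Require Import monalg.
Set Implicit Arguments. Unset Strict Implicit. Unset Printing Implicit Defensive.

(**
Adding the cup and cap of e_i on top of a tangle t amounts to fusing the two arcs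
of t which end at the top points i, i+1 and creating a new arc between these
points (splice). This operation commutes with concatenation, so that words in the
e_i act on tangles, concatenation is associative on them, and everything can be
computed pointwise.

Modulo the local relations every tangle reduces to its normal form: the parities
of its dots, a power of q + q^-1 for its undotted loops, and 0 if there is an odd
loop or if the tangle lies in the extra subspace for even n. The normal form
respects the relations, hence two reduced diagrams outside that subspace are
linearly independent modulo the relations. Since the total number of dots of a
word in the e_i is even, a reduced word splits in exactly one way into two half
tangles with the same number lambda of edges, the dot of the leftmost edge being
distributed so as to make both halves even.

Conversely each half tangle is obtained from a canonical one by letting the e_i
act: undotted small cups are slid to the right, dotted arcs are fused in pairs,
and a leftover dot is moved to the left. Therefore each C(alpha, beta) is itself
a word in the e_i, without loops. Finally e_i C(alpha, beta) = C(e_i alpha, beta)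
unless e_i joins two edges of alpha, and then the number of edges drops.
*)

(** Evenness is expressed throughout as divisibility by 4. The dots of an arc are stored at both of
    its ends; hence, for a tangle without caps and with at most one dot per component, the number of
    end points of cups plus the sum of the stored dots is modulo 4 twice the number of undotted cups
    and dotted edges. In this additive form the condition on half tangles, the parity of the dots of
    a word and the extra subspace for even [n] are all controlled by one kind of sum, to which a
    splice adds a multiple of 4 as soon as the dots on closed loops are counted twice.

    The relations are a mere span, imposed on whole diagrams, and not closed under multiplication by
    definition. That they form an ideal among the words is read off from the normal form: its linear
    extension vanishes on a combination of words exactly when that combination is a relation, and
    the normal form of e_i t depends only, and linearly, on that of t. Reflection exchanges left and
    right. *)

Definition mate (t : raw) (p : nat) : nat := nth 0 (rm t) p.
Definition dots (t : raw) (p : nat) : nat := nth 0 (rd t) p.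

Definition tabulate (N : nat) (f g : nat -> nat) (l : seq nat) : raw :=
  (map f (iota 0 N), map g (iota 0 N), l).

Lemma mate_tabulate N f g l p : p < N -> mate (tabulate N f g l) p = f p.
Proof. by move=> pN; rewrite /mate /= (nth_map 0) ?size_iota // nth_iota. Qed.

Lemma dots_tabulate N f g l p : p < N -> dots (tabulate N f g l) p = g p.
Proof. by move=> pN; rewrite /dots /= (nth_map 0) ?size_iota // nth_iota. Qed.

(** The part of validity that does not see the boundary order. Concatenation and splicing are
    analysed on this level; planarity and exposure are added by [valid_tangleP]. *)
Record matching (N : nat) (t : raw) : Prop := Matching {
  size_rm : size (rm t) = N;
  size_rd : size (rd t) = N;
  mate_lt : forall p, p < N -> mate t p < N;
  mate_neq : forall p, p < N -> mate t p <> p;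
  mateK : forall p, p < N -> mate t (mate t p) = p;
  dots_mate : forall p, p < N -> dots t (mate t p) = dots t p;
  sorted_rl : sorted leq (rl t) }.

Lemma raw_ext N (t t' : raw) :
  size (rm t) = N -> size (rd t) = N -> size (rm t') = N -> size (rd t') = N ->
  (forall p, p < N -> mate t p = mate t' p) ->
  (forall p, p < N -> dots t p = dots t' p) -> rl t = rl t' -> t = t'.
Proof.
case: t t' => [[s d] l] [[s' d'] l'] /= s1 s2 s3 s4 es ed ->.
congr (_, _, _); apply: (@eq_from_nth _ 0); rewrite /= ?s1 ?s2 ?s3 ?s4 //.
Qed.

Lemma tabulate_ext N f g l f' g' l' :
  (forall p, p < N -> f p = f' p) -> (forall p, p < N -> g p = g' p) -> l = l' ->
  tabulate N f g l = tabulate N f' g' l'.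
Proof.
move=> ef eg ->; rewrite /tabulate; congr (_, _, _); apply/eq_in_map => p;
  rewrite mem_iota add0n => /andP[_ pN]; auto.
Qed.

Lemma sort_leq_eq (l l' : seq nat) : perm_eq l l' -> sort leq l = sort leq l'.
Proof. by move/(perm_sortP leq_total leq_trans anti_leq). Qed.

Lemma sort_leq_id (l : seq nat) : sorted leq l -> sort leq l = l.
Proof. exact: (sorted_sort leq_trans). Qed.

Lemma sort_leq_sorted (l : seq nat) : sorted leq (sort leq l).
Proof. exact: (sort_sorted leq_total). Qed.

#[global] Hint Resolve sort_leq_sorted : core.

(* The cup and cap e_i on top of t: the arcs ending at x and y are fused and
   x - y becomes an arc carrying e dots. *)
Definition splice (N x y e : nat) (t : raw) : raw :=
  tabulate N
    (fun p => if p == x then y else if p == y then x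
              else if mate t p == x then mate t y
              else if mate t p == y then mate t x else mate t p)
    (fun p => if (p == x) || (p == y) then e
              else if (mate t p == x) || (mate t p == y) then dots t x + dots t y + e
              else dots t p)
    (if mate t x == y then sort leq (dots t x + e :: rl t) else rl t).

(** The diagram to which [t] reduces up to a scalar. Loops are dropped here and accounted for by
    [loop_weight]. *)
Definition parity (t : raw) : raw := (rm t, [seq nat_of_bool (odd k) | k <- rd t], [::]).

Lemma mate_parity t p : mate (parity t) p = mate t p.
Proof. by []. Qed.

Lemma dots_parity t p : dots (parity t) p = odd (dots t p).
Proof.
rewrite /dots /=; case: (ltnP p (size (rd t))) => h; first by rewrite (nth_map 0).
by rewrite !nth_default ?size_map.
Qed.

Lemma matching_parity N t : matching N t -> matching N (parity t).
Proof.
move=> H; split=> //=; rewrite ?size_map ?(size_rm H) ?(size_rd H) //.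
- exact: mate_lt H.
- exact: mate_neq H.
- exact: mateK H.
- by move=> p pN; rewrite !dots_parity mate_parity (dots_mate H).
Qed.

(** Innermost tests are split at each stage, and impossible coincidences are discarded by
    congruence; this is why the proofs below first put the involution laws of all points concerned
    into the context. *)
Ltac split_eqs := do ! match goal with
  | |- context [?a == ?b] =>
     lazymatch a with context [if _ then _ else _] => fail | _ =>
     lazymatch b with context [if _ then _ else _] => fail | _ =>
       case: (a =P b) => ? /=; try congruence end end end.

Ltac split_ifs := do ? match goal with
  | |- context [if ?b then _ else _] =>
     lazymatch b with context [if _ then _ else _] => fail | _ => case: (boolP b) => ? end end.

(** * The combinatorics of splicing *)

Section Splice.
Variables (N : nat).
Implicit Types (t : raw) (x y e p : nat).

Lemma mate_splice x y e t p : p < N -> mate (splice N x y e t) p =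
  if p == x then y else if p == y then x
              else if mate t p == x then mate t y
              else if mate t p == y then mate t x else mate t p.
Proof. exact: mate_tabulate. Qed.

Lemma dots_splice x y e t p : p < N -> dots (splice N x y e t) p =
  if (p == x) || (p == y) then e
              else if (mate t p == x) || (mate t p == y) then dots t x + dots t y + e
              else dots t p.
Proof. exact: dots_tabulate. Qed.

Lemma matching_splice x y e t : matching N t -> x < N -> y < N -> x <> y ->
  matching N (splice N x y e t).
Proof.
move=> H xN yN xy.
have Kx := mateK H xN; have Ky := mateK H yN.
have nx := mate_neq H xN; have ny := mate_neq H yN.
split=> //; try by rewrite size_map size_iota.
- move=> p pN; rewrite mate_splice //.
  by do ![case: eqP => //= ?]; apply: (mate_lt H).
- move=> p pN; rewrite mate_splice //.
  have Kp := mateK H pN; have np := mate_neq H pN.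
  by do ![case: eqP => ?; try congruence].
- move=> p pN.
  have Kp := mateK H pN; have np := mate_neq H pN.
  have hx := mate_lt H xN; have hy := mate_lt H yN; have hp := mate_lt H pN.
  rewrite (@mate_splice _ _ _ _ p) //.
  by do ![case: (p =P _) => ?; try congruence];
     do ?[case: (mate t p =P _) => ?; try congruence];
     rewrite mate_splice //; do ![case: eqP => ?; try congruence].
- move=> p pN.
  have Kp := mateK H pN; have np := mate_neq H pN; have Dp := dots_mate H pN.
  have Dx := dots_mate H xN; have Dy := dots_mate H yN.
  have hx := mate_lt H xN; have hy := mate_lt H yN; have hp := mate_lt H pN.
  rewrite (@mate_splice _ _ _ _ p) // (@dots_splice _ _ _ _ p) //.
  by do ![case: (p =P _) => ? /=; try congruence];
     do ?[case: (mate t p =P _) => ? /=; try congruence];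
     rewrite dots_splice //; do ![case: eqP => ? /=; try congruence].
- by rewrite /rl /=; case: ifP => // _; exact: sorted_rl H.
Qed.

Lemma splice_sym x y e t : matching N t -> x < N -> y < N -> x <> y ->
  splice N x y e t = splice N y x e t.
Proof.
move=> H xN yN xy.
have Kx := mateK H xN; have Ky := mateK H yN.
have Dx := dots_mate H xN; have Dy := dots_mate H yN.
apply: tabulate_ext => [p pN|p pN|].
- by have Kp := mateK H pN; do ![case: eqP => ?; try congruence].
- by do ![case: eqP => ? //=]; rewrite [dots t x + _]addnC.
- by do ![case: eqP => ?; try congruence].
Qed.

(** Two splices on disjoint pairs may still meet the same arcs; in either order the same strands are
    fused and the same loop closes. It is applied to one pair at the top and one at the bottom,
    where it says that left and right multiplication commute. *)
Lemma splice_comm x y e x' y' e' t : matching N t ->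
  x < N -> y < N -> x' < N -> y' < N -> uniq [:: x; y; x'; y'] ->
  splice N x y e (splice N x' y' e' t) = splice N x' y' e' (splice N x y e t).
Proof.
move=> H xN yN xN' yN'; rewrite /= !inE !negb_or -!andbA.
case/and5P=> /eqP xy /eqP xx /eqP xy' /eqP yx /andP[/eqP yy /andP[/eqP xy'' _]].
have Kx := mateK H xN; have Ky := mateK H yN.
have Kx' := mateK H xN'; have Ky' := mateK H yN'.
have Dx := dots_mate H xN; have Dy := dots_mate H yN.
have Dx' := dots_mate H xN'; have Dy' := dots_mate H yN'.
apply: tabulate_ext => [p pN|p pN|].
- have Kp := mateK H pN.
  by rewrite !mate_splice //; split_eqs.
- have Kp := mateK H pN; have Dp := dots_mate H pN.
  rewrite !mate_splice // !dots_splice //.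
  { split_eqs.
  all: try (have -> : dots t x' = dots t x by congruence);
    try (have -> : dots t x' = dots t y by congruence);
    try (have -> : dots t y' = dots t x by congruence);
    try (have -> : dots t y' = dots t y by congruence).
  all: by clear; lia. }
- rewrite !mate_splice // !dots_splice // /splice /rl /=.
  split_eqs.
  1,2: congr (sort leq (_ :: _)).
  1,2: try (have -> : dots t x' = dots t x by congruence);
    try (have -> : dots t x' = dots t y by congruence);
    try (have -> : dots t y' = dots t x by congruence);
    try (have -> : dots t y' = dots t y by congruence).
  1,2: by clear; lia.
  apply: sort_leq_eq.
  have h a l : perm_eq (a :: sort leq l) (a :: l) by rewrite perm_cons perm_sort.
  apply: perm_trans (h _ _) _; rewrite perm_sym; apply: perm_trans (h _ _) _.
  by apply/permP => a /=; rewrite addnCA.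
Qed.

Lemma parity_splice_parity x y e t : matching N t -> x < N -> y < N ->
  parity (splice N x y e (parity t)) = parity (splice N x y e t).
Proof.
move=> H xN yN; apply: (@raw_ext N) => //=; rewrite ?size_map ?size_iota //.
move=> p pN; rewrite !dots_parity !dots_splice // !dots_parity !mate_parity.
by split_eqs; rewrite ?oddD ?oddb.
Qed.

(* The zigzag relation e_i e_j e_i = e_i, up to the parity of the dots. *)
Lemma splice_zigzag p r e e' t : matching N t -> parity t = t -> p < N -> r < N ->
  r <> p -> r <> mate t p -> e = dots t p ->
  odd (dots t p + dots t r + e') + odd e' + e = dots t r ->
  splice N p (mate t p) e (parity (splice N (mate t p) r e' t)) = t.
Proof.
move=> H Pt pN rN rp rq ee eqd.
have Kp := mateK H pN; have np := mate_neq H pN; have nr := mate_neq H rN.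
have Kr := mateK H rN; have qN := mate_lt H pN; have Dp := dots_mate H pN.
have Dr := dots_mate H rN.
have rl0 : rl t = [::] by rewrite -Pt.
apply: (@raw_ext N); rewrite ?(size_rm H) ?(size_rd H) /= ?size_map ?size_iota //.
- move=> k kN; have Kk := mateK H kN; have nk := mate_neq H kN.
  by rewrite !mate_splice // !mate_parity !mate_splice //; split_eqs.
- move=> k kN; have Kk := mateK H kN; have nk := mate_neq H kN; have Dk := dots_mate H kN.
  rewrite !dots_splice // !mate_parity !dots_parity !mate_splice // !dots_splice //.
  have pk : odd (dots t k) = dots t k :> nat by rewrite -dots_parity Pt.
  by split_eqs; rewrite ?Dp ?eqd; congruence.
- rewrite !mate_parity !mate_splice //; split_eqs.
Qed.

Lemma sum_iota_delta (P : pred nat) (a c : nat) : a < N -> P a ->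
  \sum_(k <- iota 0 N | P k) (k == a) * c = c.
Proof.
move=> aN Pa; rewrite big_mkcond (bigD1_seq a) ?iota_uniq ?mem_iota //= Pa eqxx mul1n.
by rewrite big1 ?addn0 // => k /negPf ->; case: (P k).
Qed.

(* Splicing adds e to the arc x - y and e to the arc or loop which absorbs the
   old ends x and y; loops count twice because dots on arcs are stored at both ends. *)
Lemma sum_dots_splice (P : pred nat) x y e t : matching N t -> x < N -> y < N ->
  x <> y -> P x -> P y -> P (mate t x) -> P (mate t y) ->
  \sum_(k <- iota 0 N | P k) dots (splice N x y e t) k + 2 * sumn (rl (splice N x y e t))
  = \sum_(k <- iota 0 N | P k) dots t k + 2 * sumn (rl t) + 4 * e.
Proof.
move=> H xN yN xy Px Py Pmx Pmy.
have Kx := mateK H xN; have Ky := mateK H yN.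
have nx := mate_neq H xN; have ny := mate_neq H yN.
have mxN := mate_lt H xN; have myN := mate_lt H yN.
have dmx := dots_mate H xN; have dmy := dots_mate H yN.
rewrite [X in sumn X]/rl /=; case: eqP => exy.
- have -> : sumn (sort leq (dots t x + e :: rl t)) = dots t x + e + sumn (rl t).
    by rewrite (perm_sumn (permEl (perm_sort _ _))).
  (* The lost and gained dots are written as indicator terms on either side, so that the two sums
     agree term by term. *)
  suff : \sum_(k <- iota 0 N | P k) (dots (splice N x y e t) k + (k == x) * dots t x + (k == y) * dots t x)
       = \sum_(k <- iota 0 N | P k) (dots t k + (k == x) * e + (k == y) * e).
    by rewrite !big_split /= !sum_iota_delta //; lia.
  rewrite big_seq_cond [RHS]big_seq_cond; apply: eq_bigr => k.
  rewrite mem_iota add0n => /andP[/andP[_ kN] _]; rewrite dots_splice //.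
  have Kk := mateK H kN; have Dk := dots_mate H kN.
  { split_eqs.
  all: try (have -> : dots t k = dots t x by congruence).
  all: by clear; lia. }
- suff : \sum_(k <- iota 0 N | P k) (dots (splice N x y e t) k + (k == x) * dots t x + (k == y) * dots t y
            + (k == mate t x) * dots t x + (k == mate t y) * dots t y)
       = \sum_(k <- iota 0 N | P k) (dots t k + (k == x) * e + (k == y) * e
            + (k == mate t x) * (dots t x + dots t y + e)
            + (k == mate t y) * (dots t x + dots t y + e)).
    by rewrite !big_split /= !sum_iota_delta //; lia.
  rewrite big_seq_cond [RHS]big_seq_cond; apply: eq_bigr => k.
  rewrite mem_iota add0n => /andP[/andP[_ kN] _]; rewrite dots_splice //.
  have Kk := mateK H kN; have Dk := dots_mate H kN.
  split_eqs.
  all: try (have -> : dots t k = dots t x by congruence).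
  all: try (have -> : dots t k = dots t y by congruence).
  all: by clear; lia.
Qed.
End Splice.

(** * Planarity and the left face *)

Section Valid.
Variables (m k : nat).
Implicit Types (t : raw) (p r : nat).
Local Notation B := (bpos m k).

Lemma bpos_bot p : p < m -> B p = p.
Proof. by rewrite /bpos => ->. Qed.

Lemma bpos_top p : m <= p -> B p = (m + m + k).-1 - p.
Proof. by rewrite /bpos ltnNge => ->. Qed.

Lemma bpos_lt_top p r : m <= p -> m <= r -> p < m + k -> r < m + k -> (B p < B r) = (r < p).
Proof. by move=> mp mr pN rN; rewrite !bpos_top //; lia. Qed.

Lemma bpos_inj p r : p < m + k -> r < m + k -> B p = B r -> p = r.
Proof. by move=> pN rN; rewrite /bpos; case: (ltnP p m); case: (ltnP r m); lia. Qed.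

(** As [p] and [r] range over all end points, each arc is met in both orientations. No minimum or
    maximum is then needed, and planarity becomes a family of linear inequalities. The same device
    is used for [dots_exposed]. *)
Definition noncrossing t := forall p r, p < m + k -> r < m + k ->
  ~~ [&& B p < B r, B r < B (mate t p) & B (mate t p) < B (mate t r)].

Definition dots_exposed t := forall p r, p < m + k -> r < m + k -> 0 < dots t p ->
  ~~ [&& B r < B p, B r < B (mate t p), B p < B (mate t r) & B (mate t p) < B (mate t r)].

Lemma valid_tangleP t : valid_tangle m k t <->
  [/\ matching (m + k) t, noncrossing t & dots_exposed t].
Proof.
split.
- case/and5P => /eqP sm /eqP sd /allP h1 /allP h2 sl.
  have {}h1 p : p < m + k -> [&& mate t p < m + k, mate t p != p, mate t (mate t p) == p,
     dots t (mate t p) == dots t p & (0 < dots t p) ==> exposed m k t p].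
    by move=> pN; apply: h1; rewrite mem_iota.
  have {}h2 p r : p < m + k -> r < m + k -> ~~ arcs_cross m k t p r.
    move=> pN rN; have := h2 p; rewrite mem_iota => /(_ pN) /allP /(_ r).
    by rewrite mem_iota => /(_ rN).
  have Kt p : p < m + k -> mate t (mate t p) = p.
    by move=> /h1 /and5P[_ _ /eqP].
  have Lt p : p < m + k -> mate t p < m + k by move=> /h1 /and5P[].
  split.
  + by split=> // p pN; have /and5P[a /eqP b /eqP c /eqP d _] := h1 p pN.
  + move=> p r pN rN; have := h2 p r pN rN.
    rewrite /arcs_cross /alo /ahi -/(mate t p) -/(mate t r); lia.
  + move=> p r pN rN d0; have /and5P[_ _ _ _] := h1 p pN.
    rewrite d0 /= => /negP ex; apply/negP => h; apply: ex; apply/hasP; exists r; first by rewrite mem_iota.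
    rewrite /alo /ahi -/(mate t p) -/(mate t r); lia.
- move=> [H nc ex]; apply/and5P; split; rewrite ?(size_rm H) ?(size_rd H) ?(sorted_rl H) //.
  + apply/allP => p; rewrite mem_iota => /andP[_]; rewrite add0n => pN.
    rewrite -/(mate t p) -/(mate t (mate t p)) -/(dots t p) -/(dots t (mate t p)).
    rewrite (mate_lt H) // (mateK H) // (dots_mate H) // !eqxx /=.
    rewrite (introN eqP (mate_neq H pN)) /=; apply/implyP => d0.
    apply/negP => /hasP[r]; rewrite mem_iota => /andP[_]; rewrite add0n => rN.
    rewrite /alo /ahi -/(mate t p) -/(mate t r) => h.
    have := ex p r pN rN d0; have := ex p (mate t r) pN (mate_lt H rN) d0.
    rewrite (mateK H) //; move: h; set a := B p; set b := B _; set c := B r; set d := B _.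
    by clearbody a b c d; clear; lia.
  + apply/allP => p; rewrite mem_iota => /andP[_]; rewrite add0n => pN.
    apply/allP => r; rewrite mem_iota => /andP[_]; rewrite add0n => rN.
    have := nc p r pN rN; have := nc (mate t p) r (mate_lt H pN) rN.
    have := nc p (mate t r) pN (mate_lt H rN).
    have := nc (mate t p) (mate t r) (mate_lt H pN) (mate_lt H rN).
    rewrite /arcs_cross /alo /ahi -/(mate t p) -/(mate t r) !(mateK H) //.
    set a := B p; set b := B _; set c := B r; set d := B _ => h1 h2 h3 h4.
    by clearbody a b c d; clear -h1 h2 h3 h4; lia.
Qed.

Lemma valid_matching t : valid_tangle m k t -> matching (m + k) t.
Proof. by case/valid_tangleP. Qed.

Lemma valid_parity t : valid_tangle m k t -> valid_tangle m k (parity t).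
Proof.
move=> /valid_tangleP[H nc ex]; apply/valid_tangleP; split=> //.
- exact: matching_parity.
- move=> p r pN rN; rewrite dots_parity => d0; apply: (ex p r) => //.
  by move: d0; case: (dots t p).
Qed.

(** The new arc joins neighbours on the boundary, so nothing can separate its ends. Whatever crosses
    or hides the fused arc would have to cross or hide one of the two old arcs, or pass between the
    neighbours. New dots occur only at the top left corner, next to the left face. *)
Lemma splice_valid x e t : m <= x -> x.+1 < m + k -> (0 < e -> x = m) ->
  valid_tangle m k t -> valid_tangle m k (splice (m + k) x x.+1 e t).
Proof.
move=> mx xN e0 /valid_tangleP[H nc ex].
have xN' : x < m + k by lia.
have Bxy : B x = (B x.+1).+1 by rewrite !bpos_top; lia.
(* The point [m] is the top left corner, the last one in the boundary order. *)
have Bm : 0 < e -> forall p, p < m + k -> B p <= B x.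
  by move=> /e0 xm p pN; rewrite (bpos_top mx) /bpos; case: (ltnP p m); lia.
set y := x.+1 in xN Bxy *.
have xy : x <> y by rewrite /y; lia.
apply/valid_tangleP; split; first exact: matching_splice.
all: clearbody y; have Kx := mateK H xN'; have Ky := mateK H xN;
  have nx := mate_neq H xN'; have ny := mate_neq H xN;
  have mxN := mate_lt H xN'; have myN := mate_lt H xN.
- move=> p r pN rN.
  have Kp := mateK H pN; have Kr := mateK H rN.
  have mpN := mate_lt H pN; have mrN := mate_lt H rN.
  rewrite !mate_splice //.
  have e1 u : u < m + k -> u <> x -> B u <> B x by move=> uN ux /bpos_inj; auto.
  have e2 u : u < m + k -> u <> y -> B u <> B y by move=> uN ux /bpos_inj; auto.
  (* All planarity constraints between the two arcs to be fused and an arbitrary other arc are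
     collected, so that each case below is linear arithmetic. *)
  have nc1 := nc p r pN rN.
  have f1 := conj (nc (mate t x) r mxN rN) (nc (mate t y) r myN rN).
  have f2 := conj (nc x r xN' rN) (nc y r xN rN).
  have f3 := conj (nc r (mate t x) rN mxN) (nc r (mate t y) rN myN).
  have f4 := conj (nc r x rN xN') (nc r y rN xN).
  have f5 := conj (nc (mate t x) (mate t r) mxN mrN) (nc (mate t y) (mate t r) myN mrN).
  have f6 := conj (nc x (mate t r) xN' mrN) (nc y (mate t r) xN mrN).
  have g1 := conj (nc (mate t x) p mxN pN) (nc (mate t y) p myN pN).
  have g2 := conj (nc x p xN' pN) (nc y p xN pN).
  have g3 := conj (nc p (mate t x) pN mxN) (nc p (mate t y) pN myN).
  have g4 := conj (nc p x pN xN') (nc p y pN xN).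
  have g5 := conj (nc (mate t x) (mate t p) mxN mpN) (nc (mate t y) (mate t p) myN mpN).
  have g6 := conj (nc x (mate t p) xN' mpN) (nc y (mate t p) xN mpN).
  case: (p =P x) => px /=; [subst p; clear -Bxy; lia|].
  case: (p =P y) => py /=; [subst p; clear -Bxy; lia|].
  case: (r =P x) => rx /=; [subst r; clear -Bxy; lia|].
  case: (r =P y) => ry /=; [subst r; clear -Bxy; lia|].
  have := e1 _ pN px; have := e2 _ pN py; have := e1 _ rN rx; have := e2 _ rN ry.
  case: (mate t p =P x) => mpx /=.
    have -> : p = mate t x by congruence.
    have := e1 _ mxN nx.
    case: (mate t r =P x) => mrx /=; [clear; lia|].
    case: (mate t r =P y) => mry /=; [clear; lia|].
    have := e1 _ mrN mrx; have := e2 _ mrN mry.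
    clear -f1 f2 f3 f4 f5 f6 Bxy Kx Ky Kr; rewrite ?Kx ?Ky ?Kr in f1 f2 f3 f4 f5 f6 *.
    lia.
  case: (mate t p =P y) => mpy /=.
    have -> : p = mate t y by congruence.
    have := e2 _ myN ny.
    case: (mate t r =P x) => mrx /=; [clear; lia|].
    case: (mate t r =P y) => mry /=; [clear; lia|].
    have := e1 _ mrN mrx; have := e2 _ mrN mry.
    clear -f1 f2 f3 f4 f5 f6 Bxy Kx Ky Kr; rewrite ?Kx ?Ky ?Kr in f1 f2 f3 f4 f5 f6 *.
    lia.
  have := e1 _ mpN mpx; have := e2 _ mpN mpy.
  case: (mate t r =P x) => mrx /=.
    have -> : r = mate t x by congruence.
    clear -g1 g2 g3 g4 g5 g6 Bxy Kx Ky Kp; rewrite ?Kx ?Ky ?Kp in g1 g2 g3 g4 g5 g6 *.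
    lia.
  case: (mate t r =P y) => mry /=.
    have -> : r = mate t y by congruence.
    clear -g1 g2 g3 g4 g5 g6 Bxy Kx Ky Kp; rewrite ?Kx ?Ky ?Kp in g1 g2 g3 g4 g5 g6 *.
    lia.
  by move=> *; exact: nc1.
- move=> p r pN rN.
  have Kp := mateK H pN; have Kr := mateK H rN.
  have mpN := mate_lt H pN; have mrN := mate_lt H rN.
  rewrite dots_splice // !mate_splice //.
  have e1 u : u < m + k -> u <> x -> B u <> B x by move=> uN ux /bpos_inj; auto.
  have e2 u : u < m + k -> u <> y -> B u <> B y by move=> uN ux /bpos_inj; auto.
  have dx := dots_mate H xN'; have dy := dots_mate H xN.
  have ex1 := ex p r pN rN.
  have ex2 := conj (ex x r xN' rN) (ex y r xN rN).
  have ex3 := conj (ex x (mate t r) xN' mrN) (ex y (mate t r) xN mrN).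
  have nc1 := conj (nc (mate t x) (mate t r) mxN mrN) (nc (mate t y) (mate t r) myN mrN).
  have nc2 := conj (nc (mate t x) r mxN rN) (nc (mate t y) r myN rN).
  have nc3 := conj (nc r (mate t x) rN mxN) (nc r (mate t y) rN myN).
  have nc4 := conj (nc r x rN xN') (nc r y rN xN).
  have nc5 := conj (nc x r xN' rN) (nc y r xN rN).
  have g1 := conj (ex p (mate t x) pN mxN) (ex p (mate t y) pN myN).
  have g2 := conj (ex p x pN xN') (ex p y pN xN).
  have h1 := conj (nc (mate t x) p mxN pN) (nc (mate t y) p myN pN).
  have h2 := conj (nc x p xN' pN) (nc y p xN pN).
  have h3 := conj (nc p (mate t x) pN mxN) (nc p (mate t y) pN myN).
  have h4 := conj (nc p x pN xN') (nc p y pN xN).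
  have h5 := conj (nc (mate t x) (mate t p) mxN mpN) (nc (mate t y) (mate t p) myN mpN).
  have h6 := conj (nc x (mate t p) xN' mpN) (nc y (mate t p) xN mpN).
  have Bmr : 0 < e -> B r <= B x /\ B (mate t r) <= B x.
    by move=> e1'; split; apply: Bm.
  have Bmx : 0 < e -> B (mate t x) <= B x /\ B (mate t y) <= B x.
    by move=> e1'; split; apply: Bm.
  case: (r =P x) => rx /=; [subst r; clear -Bxy; split_eqs; lia|].
  case: (r =P y) => ry /=; [subst r; clear -Bxy; split_eqs; lia|].
  case: (p =P x) => px /=; [subst p|].
    by clear -Bxy Bmx Bmr; case: eqP => _; [|case: eqP => _]; lia.
  case: (p =P y) => py /=; [subst p|].
    by clear -Bxy Bmx Bmr; case: eqP => _; [|case: eqP => _]; lia.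
  have := e1 _ pN px; have := e2 _ pN py; have := e1 _ rN rx; have := e2 _ rN ry.
  case: (mate t p =P x) => mpx /=.
    have -> : p = mate t x by congruence.
    have := e1 _ mxN nx.
    case: (mate t r =P x) => mrx /=; [have -> : r = mate t x by congruence|].
      by clear; lia.
    case: (mate t r =P y) => mry /=; [have -> : r = mate t y by congruence|].
      by clear; lia.
    have := e1 _ mrN mrx; have := e2 _ mrN mry.
    clear -ex2 ex3 nc1 nc2 nc3 nc4 nc5 Bmr Bmx Bxy Kx Ky Kr dx dy.
    rewrite ?Kx ?Ky ?Kr ?dx ?dy in ex2 ex3 nc1 nc2 nc3 nc4 nc5 *.
    lia.
  case: (mate t p =P y) => mpy /=.
    have -> : p = mate t y by congruence.
    have := e2 _ myN ny.
    case: (mate t r =P x) => mrx /=; [have -> : r = mate t x by congruence|].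
      by clear; lia.
    case: (mate t r =P y) => mry /=; [have -> : r = mate t y by congruence|].
      by clear; lia.
    have := e1 _ mrN mrx; have := e2 _ mrN mry.
    clear -ex2 ex3 nc1 nc2 nc3 nc4 nc5 Bmr Bmx Bxy Kx Ky Kr dx dy.
    rewrite ?Kx ?Ky ?Kr ?dx ?dy in ex2 ex3 nc1 nc2 nc3 nc4 nc5 *.
    lia.
  have := e1 _ mpN mpx; have := e2 _ mpN mpy.
  case: (mate t r =P x) => mrx /=.
    have -> : r = mate t x by congruence.
    clear -g1 g2 h1 h2 h3 h4 h5 h6 Bxy Kx Ky Kp.
    rewrite ?Kx ?Ky ?Kp in g1 g2 h1 h2 h3 h4 h5 h6 *.
    lia.
  case: (mate t r =P y) => mry /=.
    have -> : r = mate t y by congruence.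
    clear -g1 g2 h1 h2 h3 h4 h5 h6 Bxy Kx Ky Kp.
    rewrite ?Kx ?Ky ?Kp in g1 g2 h1 h2 h3 h4 h5 h6 *.
    lia.
  by move=> *; exact: ex1.
Qed.
End Valid.

(** * Paths in a concatenation *)

Section Walk.
Variables (a b c : nat) (S T : raw).
Hypotheses (HS : matching (a + b) S) (HT : matching (b + c) T) (bac : b <= a + c).
Local Notation walk := (cwalk a b S T).
Implicit Types (st : bool * nat) (f g p j w acc : nat).

(** A state is a point together with the tangle whose arc is followed next, [true] standing for [S].
    Walking becomes the iteration of a partial map which is injective, so that orbit arguments
    apply. *)
Definition next_state st : option (bool * nat) :=
  if st.1 then (if mate S st.2 < a then None else Some (false, mate S st.2 - a))
  else (if b <= mate T st.2 then None else Some (true, a + mate T st.2)).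

(** Inner states lie on the interface of the two tangles; there are 2b of them, and the starting
    state of a path from the outside is never one. *)
Definition inner_state st := if st.1 then a <= st.2 < a + b else st.2 < b.
Definition any_state st := if st.1 then st.2 < a + b else st.2 < b + c.
Definition outer_state (x : nat) := if x < a then (true, x) else (false, b + (x - a)).
Local Notation run k st := (iter k (obind next_state) (Some st)).

Lemma walk_true f p acc : walk f.+1 true p acc =
  if mate S p < a then Some (mate S p, acc + dots S p)
  else walk f false (mate S p - a) (acc + dots S p).
Proof. by []. Qed.

Lemma walk_false f p acc : walk f.+1 false p acc =
  if b <= mate T p then Some (a + (mate T p - b), acc + dots T p)
  else walk f true (a + mate T p) (acc + dots T p).
Proof. by []. Qed.

Lemma cstartE x : cstart a b c S T x =
  walk (a + b + c).+1 (outer_state x).1 (outer_state x).2 0.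
Proof. by rewrite /cstart /outer_state; case: ifP. Qed.

Lemma walk_acc f side p acc k :
  walk f side p (acc + k) = omap (fun r => (r.1, r.2 + k)) (walk f side p acc).
Proof.
elim: f side p acc => [|f IH] [] p acc //.
- by rewrite !walk_true addnAC; case: ifP => //= _; rewrite IH.
- by rewrite !walk_false addnAC; case: ifP => //= _; rewrite IH.
Qed.

Lemma walk_none_acc f side p acc acc' :
  walk f side p acc = None -> walk f side p acc' = None.
Proof.
by rewrite -[acc]add0n -[acc']add0n !walk_acc; case: (walk _ _ _ _).
Qed.

Lemma walk_mono f f' side p acc r : walk f side p acc = Some r -> f <= f' ->
  walk f' side p acc = Some r.
Proof.
elim: f f' side p acc => [|f IH] [|f'] [] p acc //.
- by rewrite !walk_true ltnS; case: ifP => // _; apply: IH.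
- by rewrite !walk_false ltnS; case: ifP => // _; apply: IH.
Qed.

Lemma inner_any st : inner_state st -> any_state st.
Proof. by rewrite /inner_state /any_state; case: st => -[] p /=; lia. Qed.

Lemma next_inner st st' : any_state st -> next_state st = Some st' -> inner_state st'.
Proof.
rewrite /any_state /next_state /inner_state; case: st => -[] p /= pN.
- by have h2 := mate_lt HS pN; case: (ltnP (mate S p) a) => // h1 [<-] /=; lia.
- by case: (leqP b (mate T p)) => // h1 [<-] /=; lia.
Qed.

Lemma next_inj st st' u : any_state st -> any_state st' ->
  next_state st = Some u -> next_state st' = Some u -> st = st'.
Proof.
rewrite /any_state /next_state; case: st st' => -[] p [] [] p' /= pN pN'.
- case: (ltnP (mate S p) a) => // h1 [<-]; case: (ltnP (mate S p') a) => // h2 [e].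
  have {}e : mate S p = mate S p' by lia.
  by rewrite -(mateK HS pN) e (mateK HS pN').
- by case: (ltnP (mate S p) a) => // h1 [<-]; case: (leqP b (mate T p')).
- by case: (leqP b (mate T p)) => // h1 [<-]; case: (ltnP (mate S p') a).
- case: (leqP b (mate T p)) => // h1 [<-]; case: (leqP b (mate T p')) => // h2 [e].
  have {}e : mate T p = mate T p' by lia.
  by rewrite -(mateK HT pN) e (mateK HT pN').
Qed.

Lemma run_none k : iter k (obind next_state) None = None.
Proof. by elim: k => //= k ->. Qed.

Lemma walk_none f st acc : (walk f st.1 st.2 acc == None) = (run f st != None).
Proof.
elim: f st acc => // f IH st acc; rewrite iterSr [obind _ _]/=.
case: st => -[] p; rewrite /next_state ?walk_true ?walk_false /=;
  case: ifP => _; rewrite ?run_none //; first by rewrite (IH (false, _)).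
by rewrite (IH (true, _)).
Qed.

Lemma run_inner k st u : inner_state st -> run k st = Some u -> inner_state u.
Proof.
elim: k u => [|k IH] u sti /=; first by case=> <-.
case E: (run k st) => [v|] //= /next_inner; apply.
exact: inner_any (IH _ sti E).
Qed.

Lemma run_cat k l st st' : run k st = Some st' -> run (l + k) st = run l st'.
Proof. by rewrite iterD => ->. Qed.

Lemma run_some k l st : k <= l -> run l st != None -> run k st != None.
Proof.
move=> kl; rewrite -(subnK kl) iterD; case: (run k st) => [u|] //.
by elim: (l - k) => //= m IH h; apply: IH; case: (iter m _ None) h.
Qed.

(** Injectivity of [next_state] allows a coincidence in the orbit to be pulled back to its first
    term. *)
Lemma run_backwards i m st : inner_state st -> run i st != None ->
  run (i + m) st = run i st -> run m st = Some st.
Proof.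
move=> sti; elim: i => [|i IH]; first by rewrite add0n.
move=> h e; apply: IH; first exact: run_some h.
move: h e; rewrite addSn /=.
case E: (run i st) => [u|] //=; case E': (run (i + m) st) => [v|] //=.
- move=> h e; case E2: (next_state u) h e => [z|] // _ e; congr Some.
  apply: (next_inj _ _ e E2); apply: inner_any; apply: run_inner.
  + exact: sti. + exact: E'. + exact: sti. + exact: E.
- by move=> h e; rewrite -e in h.
Qed.

(* Pigeonhole on the 2b inner states. *)
Lemma run_cycle st : inner_state st -> run (2 * b) st != None ->
  exists2 k, 0 < k & run k st = Some st.
Proof.
move=> sti h.
pose code (u : bool * nat) := if u.1 then b + (u.2 - a) else u.2.
have code_lt u : inner_state u -> code u < 2 * b.
  by rewrite /inner_state /code; case: u => -[] p /=; lia.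
have b2 : 0 < 2 * b by have := code_lt _ sti; lia.
pose F (k : 'I_(2 * b).+1) : 'I_(2 * b) := insubd (Ordinal b2) (code (odflt st (run k st))).
have hk (k : 'I_(2 * b).+1) : exists2 u, run k st = Some u & F k = code u :> nat.
  have := @run_some k (2 * b) st; rewrite -ltnS ltn_ord => /(_ isT h).
  case E: (run k st) => [u|] // _; exists u => //.
  by rewrite /F E val_insubd /= code_lt //; apply: run_inner E.
have code_inj u v : inner_state u -> inner_state v -> code u = code v -> u = v.
  rewrite /inner_state /code; case: u v => -[] p [] [] r /= h1 h2 e.
  1-4: by [congr (_, _); lia | lia].
have : ~~ injectiveb F.
  by apply/injectiveP => /leq_card; rewrite !card_ord ltnn.
have key (i j : 'I_(2 * b).+1) : i < j -> F i = F j ->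
    exists2 k, 0 < k & run k st = Some st.
  move=> ij e; exists (j - i); first by rewrite subn_gt0.
  have [u eu fu] := hk i; have [v ev fv] := hk j.
  apply: (@run_backwards i); rewrite ?eu // subnKC 1?ltnW // ev; congr Some.
  apply: code_inj; rewrite -?fu -?fv ?e //.
  - exact: run_inner ev. - exact: run_inner eu.
case/injectivePn => i [j ij e].
have [lt_ij|lt_ji|/val_inj E] := ltngtP i j.
- exact: key lt_ij e.
- exact: key lt_ji (esym e).
by rewrite E eqxx in ij.
Qed.

(** [on_loop] only says that one walk runs out of fuel. By the pigeonhole principle such a walk is
    periodic, hence it never ends, whatever the fuel. *)
Lemma on_loopP j : j < b -> reflect (forall f acc, walk f false j acc = None) (on_loop a b c S T j).
Proof.
move=> jb; apply: (iffP eqP) => [h f acc|->//].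
have {}h : run (a + b + c).+1 (false, j) != None by rewrite -(walk_none _ _ 0) h.
(* The assumption that b is at most a + c makes the fuel a + b + c + 1 exceed the number 2b of inner
   states. *)
have [|k k0 E] := @run_cycle (false, j) jb; first by apply: run_some h; lia.
have per m : run (m * k) (false, j) = Some (false, j).
  by elim: m => // m IH; rewrite mulSn (run_cat _ IH).
apply/eqP; rewrite (walk_none _ (false, j)).
by apply: (@run_some _ (f * k)); rewrite ?per // leq_pmulr.
Qed.

(** If a path from the outside were trapped in a cycle, injectivity would put its starting state on
    that cycle, although it is not an inner state. Hence the default value in [concat] is never
    taken. *)
Lemma cstart_total x : x < a + c -> exists r, cstart a b c S T x = Some r.
Proof.
move=> xN; rewrite cstartE; case E: (cwalk _ _ _ _ _ _ _ _) => [r|]; first by exists r.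
exfalso; move/eqP: E; rewrite walk_none iterSr /=.
have any : any_state (outer_state x) by rewrite /outer_state; case: (ltnP x a) => ?; rewrite /any_state /=; lia.
case En: (next_state _) => [st|]; last by rewrite run_none.
move=> h; have sti := next_inner any En.
have [|[|k] k0 /= E] := run_cycle sti => //; first by apply: run_some h; lia.
case Ek: (run k st) E => [u|] //= E.
have eu := next_inj (inner_any (run_inner sti Ek)) any E En.
have := run_inner sti Ek; rewrite eu /outer_state; case: (ltnP x a) => ?; rewrite /inner_state /=; lia.
Qed.

(** The continuation of a walk in the opposite direction: it has just come along the arc of its own
    tangle to [p] and now either leaves the diagram or crosses the interface. *)
Definition arrive (side : bool) p f acc : option (nat * nat) :=
  if side then (if p < a then Some (p, acc) else walk f false (p - a) acc)
  else (if b <= p then Some (a + (p - b), acc) else walk f true (a + p) acc).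

(** A path can be followed from its far end, with the same dots. The lower bound [g] on the
    remaining fuel is needed to go on beyond the point where the original walk began. *)
Lemma walk_reverse f side p acc e w : any_state (side, p) ->
  walk f side p acc = Some (e, acc + w) ->
  e < a + c /\ forall g acc', exists2 h, g <= h &
    walk (f + g) (outer_state e).1 (outer_state e).2 acc' = arrive side p h (acc' + w).
Proof.
have subacc f' side' p' k acc0 w0 : walk f' side' p' (acc0 + k) = Some (e, acc0 + w0) ->
    exists2 w1, w0 = w1 + k & walk f' side' p' (acc0 + k) = Some (e, acc0 + k + w1).
  move=> E; have := E; rewrite -[acc0 + k]add0n walk_acc.
  case E1: (walk f' side' p' 0) => [[e1 w1]|] //= [e1e e2].
  exists w1; first by lia.
  by congr (Some (_, _)); lia.
elim: f side p acc w => [|f IH] [] p acc w pN //; rewrite /any_state /= in pN.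
- have mN := mate_lt HS pN.
  rewrite walk_true; case: (ltnP (mate S p) a) => h.
    case=> <- /addnI <-; split; first by lia.
    move=> g acc'; exists (f + g); first by lia.
    by rewrite /outer_state h addSn walk_true /arrive (mateK HS pN) (dots_mate HS pN).
  case/subacc=> w1 -> /IH[]; first by rewrite /any_state /=; lia.
  move=> eN IHe; split=> // g acc'; have [h' gh E] := IHe g.+1 acc'.
  case: h' gh E => // h' gh E; exists h' => //.
  rewrite addSnnS E /arrive leqNgt ifN; last by lia.
  by rewrite subnKC // walk_true (mateK HS pN) (dots_mate HS pN) addnA.
- have mN := mate_lt HT pN.
  rewrite walk_false; case: (leqP b (mate T p)) => h.
    case=> <- /addnI <-; split; first by lia.
    move=> g acc'; exists (f + g); first by lia.
    rewrite /outer_state ifN; last by lia.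
    have -> : b + (a + (mate T p - b) - a) = mate T p by lia.
    by rewrite addSn walk_false /arrive (mateK HT pN) (dots_mate HT pN).
  case/subacc=> w1 -> /IH[]; first by rewrite /any_state /=; lia.
  move=> eN IHe; split=> // g acc'; have [h' gh E] := IHe g.+1 acc'.
  case: h' gh E => // h' gh E; exists h' => //.
  rewrite addSnnS E /arrive ifN; last by lia.
  have -> : a + mate T p - a = mate T p by lia.
  by rewrite walk_false (mateK HT pN) (dots_mate HT pN) addnA.
Qed.

(** If the walk from the mate left the diagram, the reversed walk would be a path from the outside,
    which ends; but it continues along the walk from [j], which does not. *)
Lemma on_loop_mateT j : j < b -> on_loop a b c S T j ->
  mate T j < b /\ on_loop a b c S T (mate T j).
Proof.
move=> jb lj; have nj := elimT (on_loopP jb) lj.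
have jN : j < b + c by lia.
have mN := mate_lt HT jN.
have mb : mate T j < b.
  by have := nj 1 0; rewrite walk_false; case: (leqP b (mate T j)).
split=> //; apply/(on_loopP mb) => f acc.
case E: (walk f false (mate T j) acc) => [[e w]|] //; exfalso.
have [w' Ew] : exists w', w = acc + w'.
  move: E; rewrite -[acc]add0n walk_acc; case: (walk _ _ _ _) => [[e1 w1]|] //= [_ <-].
  by exists w1; rewrite add0n addnC.
subst w; have any : any_state (false, mate T j) by [].
have [eN /(_ (a + b + c).+1 0)[h _]] := walk_reverse any E.
have [r] := cstart_total eN; rewrite cstartE => /walk_mono -> //; last by lia.
move=> {}E; have {E} : arrive false (mate T j) h (0 + w') != None by rewrite -E.
rewrite /arrive ifN -?ltnNge //; apply/negP; rewrite negbK; apply/eqP.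
have := nj h.+1 0; rewrite walk_false leqNgt mb /=.
exact: walk_none_acc.
Qed.

Lemma on_loop_mateS j : j < b -> on_loop a b c S T j ->
  [/\ a <= mate S (a + j), mate S (a + j) - a < b & on_loop a b c S T (mate S (a + j) - a)].
Proof.
move=> jb lj; have [mb lm] := on_loop_mateT jb lj.
have nj := elimT (on_loopP mb) lm.
have jN : j < b + c by lia.
have aN : a + j < a + b by lia.
have h2 := mate_lt HS aN.
have h : a <= mate S (a + j).
  have := nj 2 0; rewrite walk_false (mateK HT jN) leqNgt jb /= ltnNge.
  by case: (leqP a (mate S (a + j))).
split=> //; first by lia.
apply/on_loopP; first by lia.
move=> f acc; have := nj f.+2 0; rewrite walk_false (mateK HT jN) ifN -?ltnNge //.
rewrite walk_true ifN -?leqNgt //; exact: walk_none_acc.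
Qed.
End Walk.

(** * Closed loops of a concatenation *)

Section Loops.
Variables (a b c : nat) (S T : raw).
Hypotheses (HS : matching (a + b) S) (HT : matching (b + c) T) (bac : b <= a + c).
Local Notation turn j := (mate S (a + j) - a).
Local Notation onl j := (on_loop a b c S T j).
Local Notation loop j := (loop_at a b c S T j).
Implicit Types (f j cur acc v : nat) (vis : seq nat).

Lemma turnK j : j < b -> a <= mate S (a + j) -> turn (turn j) = j.
Proof.
move=> jb h; rewrite subnKC // (mateK HS) ?addKn //; lia.
Qed.

Lemma ctravS f j0 cur acc vis : ctrav a S T f.+1 j0 cur acc vis =
  if turn (mate T cur) == j0
  then (mate T cur :: vis, acc + dots T cur + dots S (a + mate T cur))
  else ctrav a S T f j0 (turn (mate T cur)) (acc + dots T cur + dots S (a + mate T cur))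
         (turn (mate T cur) :: mate T cur :: vis).
Proof. by []. Qed.

(** The invariant of the traversal: the visited points are closed under both matchings except at the
    two open ends, [cur] for [T] and [j0] for [S]. Dots of completed arcs are seen at both ends,
    whence the factor 2 and the two extra terms. The visited points are distinct and below b, which
    bounds the fuel. *)
Lemma ctravP f j0 cur acc vis :
  {in vis, forall v, v < b /\ onl v} -> cur \in vis -> j0 \in vis -> uniq vis ->
  {in vis, forall v, v <> cur -> mate T v \in vis /\ mate T v <> cur} ->
  {in vis, forall v, v <> j0 -> turn v \in vis /\ turn v <> j0} ->
  \sum_(v <- vis) (dots T v + dots S (a + v)) = 2 * acc + dots T cur + dots S (a + j0) ->
  b < f + size vis ->
  let r := ctrav a S T f j0 cur acc vis in
  [/\ uniq r.1, {in r.1, forall v, v < b /\ onl v},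
      {in r.1, forall v, mate T v \in r.1 /\ turn v \in r.1}, {subset vis <= r.1}
    & \sum_(v <- r.1) (dots T v + dots S (a + v)) = 2 * r.2].
Proof.
elim: f cur acc vis => [|f IH] cur acc vis hl cv jv uv hT hS hsum.
  rewrite add0n ltnNge => /negP[].
  have : {subset vis <= iota 0 b} by move=> v /hl[vb _]; rewrite mem_iota.
  by move/(uniq_leq_size uv); rewrite size_iota.
move=> hf; rewrite ctravS.
have [cb cl] := hl _ cv.
have cN : cur < b + c by lia.
have [q1b q1l] := on_loop_mateT HS HT bac cb cl.
set q1 := mate T cur in q1b q1l *.
have [h2 q2b q2l] := on_loop_mateS HS HT bac q1b q1l.
have aq1 : a + q1 < a + b by lia.
have q1c : q1 <> cur by exact: (mate_neq HT cN).
have Kq1 : mate T q1 = cur by exact: (mateK HT cN).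
have Kq2 : turn (turn q1) = q1 by exact: turnK.
have q2q1 : turn q1 <> q1 by have := mate_neq HS aq1; lia.
have q1v : q1 \notin vis.
  by apply/negP => /hT /(_ q1c)[_]; rewrite Kq1.
have DT1 : dots T q1 = dots T cur by exact: (dots_mate HT cN).
have DS1 : dots S (a + turn q1) = dots S (a + q1) by rewrite subnKC // (dots_mate HS).
have q1j : q1 <> j0 by move=> E; rewrite E jv in q1v.
case: eqP => [e|ne].
  split=> //=.
  - by rewrite q1v.
  - by move=> v; rewrite inE => /orP[/eqP->|/hl].
  - move=> v; rewrite !inE => /orP[/eqP->|vv].
      by rewrite Kq1 e cv jv !orbT.
    split.
      have [->|/eqP/(hT _ vv)[-> _]] := eqVneq v cur; last by rewrite orbT.
      by rewrite eqxx.
    have [->|/eqP/(hS _ vv)[-> _]] := eqVneq v j0; last by rewrite orbT.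
    by rewrite -e Kq2 eqxx.
  - by move=> v vv; rewrite inE vv orbT.
  - by rewrite big_cons hsum -e DS1 DT1; lia.
have q2v : turn q1 \notin vis.
  by apply/negP => /hS /(_ ne)[]; rewrite Kq2 (negPf q1v).
have sub : {subset vis <= turn q1 :: q1 :: vis}.
  by move=> v vv; rewrite !inE vv !orbT.
set q2 := turn q1 in h2 q2b q2l Kq2 q2q1 DS1 ne q2v sub *.
have [] := IH q2 (acc + dots T cur + dots S (a + q1)) (q2 :: q1 :: vis).
- by move=> v; rewrite !inE => /or3P[/eqP->|/eqP->|/hl].
- by rewrite inE eqxx.
- exact: sub.
- by rewrite /= inE negb_or (introN eqP q2q1) q2v q1v.
- move=> v; rewrite !inE => /or3P[/eqP->|/eqP->|vv] // vq2.
    by rewrite Kq1 cv !orbT; split=> // E; rewrite -E cv in q2v.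
  have [->|/eqP/(hT _ vv)[h _]] := eqVneq v cur.
    by rewrite -/q1 eqxx orbT; split=> //; apply: nesym.
  by rewrite h !orbT; split=> // E; rewrite -E h in q2v.
- move=> v; rewrite !inE => /or3P[/eqP->|/eqP->|vv] // vj.
  + by rewrite Kq2 eqxx orbT.
  + by rewrite -/q2 eqxx.
  + by have [-> ?] := hS _ vv vj; rewrite !orbT.
- by rewrite !big_cons hsum DS1 DT1; lia.
- by rewrite /=; lia.
by move=> *; split=> // v /sub; auto.
Qed.

Lemma loopP j : j < b -> onl j ->
  [/\ uniq (loop j).1, {in (loop j).1, forall v, v < b /\ onl v},
      {in (loop j).1, forall v, mate T v \in (loop j).1 /\ turn v \in (loop j).1}, j \in (loop j).1
    & \sum_(v <- (loop j).1) (dots T v + dots S (a + v)) = 2 * (loop j).2].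
Proof.
move=> jb jl; have [] := @ctravP (fuel a b c) j j 0 [:: j].
- by move=> v; rewrite inE => /eqP->.
- by rewrite inE.
- by rewrite inE.
- by [].
- by move=> v; rewrite inE => /eqP->.
- by move=> v; rewrite inE => /eqP->.
- by rewrite big_seq1; lia.
- by rewrite /fuel /=; lia.
by move=> h1 h2 h3 h4 h5; split=> //; apply: h4; rewrite inE.
Qed.

(** A loop is generated from one point by the two matchings. Applied to membership in a second loop,
    this shows that loops with a common point coincide. *)
Lemma loop_invariant (Q : pred nat) j :
  (forall u, u < b -> mate T u < b -> Q (mate T u) = Q u) ->
  (forall u, u < b -> a <= mate S (a + u) -> Q (turn u) = Q u) ->
  j < b -> onl j -> {in (loop j).1, forall v, Q v = Q j}.
Proof.
move=> QT QS jb jl.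
suff gen f cur acc vis : cur < b -> onl cur -> cur \in vis ->
    {in vis, forall v, Q v = Q j} -> {in (ctrav a S T f j cur acc vis).1, forall v, Q v = Q j}.
  by apply: gen; rewrite ?inE // => v; rewrite inE => /eqP->.
elim: f cur acc vis => // f IH cur acc vis cb cl cv hv; rewrite ctravS.
have [q1b q1l] := on_loop_mateT HS HT bac cb cl.
have [h2 q2b q2l] := on_loop_mateS HS HT bac q1b q1l.
have E1 : Q (mate T cur) = Q j by rewrite QT // hv.
case: eqP => _ /=.
  by move=> v; rewrite inE => /orP[/eqP->|/hv].
apply: IH => //; first by rewrite inE eqxx.
by move=> v; rewrite !inE => /or3P[/eqP->|/eqP->|/hv] //; rewrite QS.
Qed.

Lemma closed_invariant (s : seq nat) :
  {in s, forall v, mate T v \in s /\ turn v \in s} ->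
  (forall u, u < b -> mate T u < b -> (mate T u \in s) = (u \in s)) /\
  (forall u, u < b -> a <= mate S (a + u) -> (turn u \in s) = (u \in s)).
Proof.
move=> cl; split=> u ub h; apply/idP/idP.
- by move/cl=> [+ _]; rewrite (mateK HT) //; lia.
- by case/cl.
- by move/cl=> [_]; rewrite turnK.
- by case/cl.
Qed.

(** Membership in either loop is invariant along the other one, so both have the same points, and
    the number of dots is half of a sum over these points. *)
Lemma loop_class j v : j < b -> onl j -> v \in (loop j).1 ->
  perm_eq (loop v).1 (loop j).1 /\ (loop v).2 = (loop j).2.
Proof.
move=> jb jl vj; have [u1 l1 c1 m1 s1] := loopP jb jl.
have [vb vl] := l1 _ vj; have [u2 l2 c2 m2 s2] := loopP vb vl.
have [i1 i2] := closed_invariant c2.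
have jv : j \in (loop v).1.
  by have : (v \in _) = (j \in _) := loop_invariant i1 i2 jb jl vj; rewrite m2 => <-.
have P : perm_eq (loop v).1 (loop j).1.
  apply: uniq_perm => // u; apply/idP/idP => h.
  - have [i3 i4] := closed_invariant c1.
    by have -> : (u \in _) = (v \in _) := loop_invariant i3 i4 vb vl h.
  - by have -> : (u \in _) = (j \in _) := loop_invariant i1 i2 jb jl h.
split=> //; have := s1; rewrite -(perm_big _ P) s2; lia.
Qed.
End Loops.

Lemma perm_filter_insert (s : seq nat) (P P' : pred nat) (m : nat) :
  uniq s -> m \in s -> ~~ P m -> {in s, forall j, P' j = P j || (j == m)} ->
  perm_eq (filter P' s) (m :: filter P s).
Proof.
move=> us ms Pm h; apply: uniq_perm; rewrite /= ?filter_uniq ?mem_filter ?(negPf Pm) //.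
move=> j; rewrite inE !mem_filter; case js: (j \in s); last first.
  by rewrite !andbF orbF; apply/esym/eqP => e; rewrite e ms in js.
by rewrite !andbT h // orbC.
Qed.

(** * Concatenation and splicing *)

Section ConcatSplice.
Variables (a b c : nat) (S T : raw) (x0 y0 e : nat).
Hypotheses (HS : matching (a + b) S) (HT : matching (b + c) T) (bac : b <= a + c).
Hypotheses (x0c : x0 < c) (y0c : y0 < c) (xy0 : x0 <> y0).
Local Notation C := (concat a b c S T).
(** In the applications this is known for an initial product, with the identity or between half
    tangles, and propagates along words because splicing preserves matchings. *)
Hypothesis (HC : matching (a + c) C).
Local Notation x := (b + x0).
Local Notation y := (b + y0).
Local Notation X := (a + x0).
Local Notation Y := (a + y0).
Local Notation T' := (splice (b + c) x y e T).
Local Notation walk := (cwalk a b S T).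
Local Notation walk' := (cwalk a b S T').
Local Notation turn j := (mate S (a + j) - a).
Implicit Types (f g p j w acc v E : nat).

Let xN : x < b + c. Proof. lia. Qed.
Let yN : y < b + c. Proof. lia. Qed.
Let xy : x <> y. Proof. lia. Qed.
Let HT' : matching (b + c) T'. Proof. exact: matching_splice. Qed.

Lemma cstart_concat p : p < a + c -> cstart a b c S T p = Some (mate C p, dots C p).
Proof.
move=> pN; have [[u w] E] := cstart_total HS HT bac pN.
by rewrite mate_tabulate // dots_tabulate // E.
Qed.

Definition off_splice (side : bool) p := side \/ (p <> x /\ p <> y).

Lemma mate_inner p : p < b -> mate T p < b -> (mate T' p = mate T p) * (dots T' p = dots T p).
Proof.
move=> pb mb; split;
by rewrite ?mate_splice ?dots_splice; try lia; do ![case: eqP => //= ?]; lia.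
Qed.

(** An arc of [T] ending at [x] or [y] can be entered from the interface only as the last one of a
    path to [X] or [Y]; every other path runs along unchanged arcs. *)
Lemma walk_splice f side p acc E w : any_state a b c (side, p) -> off_splice side p ->
  walk f side p acc = Some (E, w) -> E <> X -> E <> Y -> walk' f side p acc = Some (E, w).
Proof.
move=> + + + EX EY; elim: f side p acc => [|f IH] [] p acc pN off //;
  rewrite /any_state /= in pN.
- have mN := mate_lt HS pN.
  rewrite !walk_true; case: (ltnP (mate S p) a) => // h; apply: IH; last by right; lia.
  by rewrite /any_state /=; lia.
- have [//|[px py]] := off.
  have mN := mate_lt HT pN.
  rewrite !walk_false; case: (leqP b (mate T p)) => h.
    case=> EE Ew; rewrite mate_splice // dots_splice //.
    by do ![case: eqP => //= ?]; try lia; rewrite h EE Ew.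
  have h1 : mate T p <> x by lia.
  have h2 : mate T p <> y by lia.
  rewrite mate_splice // dots_splice // (introF eqP px) (introF eqP py).
  rewrite (introF eqP h1) (introF eqP h2) /= leqNgt h /=; apply: IH; last by left.
  by rewrite /any_state /=; lia.
Qed.

(* Just before a walk reaches the top point z0, it is at the mate of b + z0. *)
Lemma walk_splice_end f side p acc z0 w : any_state a b c (side, p) -> off_splice side p ->
  b + z0 = x \/ b + z0 = y -> walk f side p acc = Some (a + z0, w) ->
  exists f' acc', [/\ f' < f, w = acc' + dots T (b + z0), off_splice false (mate T (b + z0)),
    mate T (b + z0) < b \/ (side, p) = (false, mate T (b + z0)) &
    forall h, walk' (f' + h) side p acc = walk' h false (mate T (b + z0)) acc'].
Proof.
move=> pN off zxy; have zN : b + z0 < b + c by lia.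
elim: f side p acc pN off => [|f IH] [] p acc pN off //;
  rewrite /any_state /= in pN.
- have mN := mate_lt HS pN.
  rewrite walk_true; case: (ltnP (mate S p) a) => [? [] | h]; first by lia.
  case/IH => [||f' [acc' [h1 h2 h3 h4 h5]]]; [by rewrite /any_state /=; lia|by right; lia|].
  exists f'.+1, acc'; split=> //; first by left; case: h4 => [|[]]; lia.
  by move=> k; rewrite addSn walk_true ltnNge h /= h5.
- have [//|[px py]] := off.
  have mN := mate_lt HT pN.
  rewrite walk_false; case: (leqP b (mate T p)) => h.
    case=> EE Ew; have Ez : mate T p = b + z0 by lia.
    have Ep : p = mate T (b + z0) by rewrite -Ez (mateK HT).
    by exists 0, acc; rewrite -Ep -Ez (dots_mate HT) //; split; auto; lia.
  have h1 : mate T p <> x by lia.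
  have h2 : mate T p <> y by lia.
  case/IH => [||f' [acc' [g1 g2 g3 g4 g5]]]; [by rewrite /any_state /=; lia|by left|].
  exists f'.+1, acc'; split=> //; first by left; case: g4.
  move=> k; rewrite addSn walk_false mate_splice // dots_splice // (introF eqP px) (introF eqP py).
  by rewrite (introF eqP h1) (introF eqP h2) /= leqNgt h /= g5.
Qed.

Lemma walk_unique (f g : nat) side p acc r r' : 
  walk' f side p acc = Some r -> walk' g side p acc = Some r' -> r = r'.
Proof.
move=> h1 h2; have := walk_mono h1 (leq_addr g f); rewrite (walk_mono h2 (leq_addl f g)).
by case.
Qed.

(* Where a walk which would have reached z0 goes instead: on from the other end z0'. *)
Lemma walk_splice_through f side p acc z0 z0' w : any_state a b c (side, p) -> off_splice side p ->
  (b + z0 = x /\ b + z0' = y) \/ (b + z0 = y /\ b + z0' = x) ->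
  mate C (a + z0) <> a + z0' ->
  walk f side p acc = Some (a + z0, w) ->
  exists g, walk' g side p acc = Some (mate C (a + z0'), w + dots C (a + z0') + e).
Proof.
move=> pN off zz ne W.
have zN : b + z0 < b + c by lia.
have zN' : b + z0' < b + c by lia.
have z'C : a + z0' < a + c by lia.
have zC : a + z0 < a + c by lia.
have zxy : b + z0 = x \/ b + z0 = y by tauto.
have [f' [acc' [_ ew [//|offz] _ Wz]]] := walk_splice_end pN off zxy W.
have mT' : mate T' (mate T (b + z0)) = mate T (b + z0') /\
           dots T' (mate T (b + z0)) = dots T (b + z0) + dots T (b + z0') + e.
  have mN := mate_lt HT zN; have Kz := mateK HT zN; have nz := mate_neq HT zN.
  rewrite mate_splice // dots_splice // Kz.
  rewrite !(introF eqP offz.1) !(introF eqP offz.2) /=.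
  by case: zz => -[-> ->]; split; split_eqs; lia.
(* After the fused arc the walk stands at the old mate of [z0'] and from there on copies the old
   path which starts at [z0']. *)
have := cstart_concat z'C; rewrite cstartE /outer_state ifN; last by lia.
have -> : b + (a + z0' - a) = b + z0' by lia.
rewrite walk_false => W'.
have ne1 : mate C (a + z0') <> a + z0' by apply: (mate_neq HC).
have ne2 : mate C (a + z0') <> a + z0.
  by move=> E; apply: ne; rewrite -E (mateK HC).
have neX : mate C (a + z0') <> X /\ mate C (a + z0') <> Y.
  by case: zz => -[z1 z2]; split=> E; [apply: ne2|apply: ne1|apply: ne1|apply: ne2]; lia.
exists (f' + (a + b + c).+1); rewrite Wz walk_false mT'.1 mT'.2.
have mN' := mate_lt HT zN'.
case: (leqP b (mate T (b + z0'))) W' => h; first by case=> <- <-; congr Some; congr pair; lia.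
have -> : acc' + (dots T (b + z0) + dots T (b + z0') + e) =
  (0 + dots T (b + z0')) + (w + e) by lia.
move=> W'; rewrite walk_acc (walk_splice _ _ W' neX.1 neX.2) /=; last by left.
  by congr Some; congr pair; lia.
by rewrite /any_state /=; lia.
Qed.

Lemma walk_splice_through_walk side p acc z0 z0' w f : any_state a b c (side, p) ->
  off_splice side p -> (z0 = x0 /\ z0' = y0) \/ (z0 = y0 /\ z0' = x0) ->
  mate C X <> Y -> walk f side p acc = Some (a + z0, w) ->
  exists g, walk' g side p acc = Some (mate C (a + z0'), w + dots C (a + z0') + e).
Proof.
move=> pN off zz ne; apply: walk_splice_through => //; first by case: zz; lia.
have XC : X < a + c by lia.
by case: zz => -[-> ->] // E; apply: ne; rewrite -E (mateK HC); lia.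
Qed.

Lemma joined_concat : mate T x = y -> mate C X = Y /\ dots C X = dots T x.
Proof.
move=> E; have XC : X < a + c by lia.
have := cstart_concat XC; rewrite cstartE /outer_state ifN; last by lia.
have -> : b + (X - a) = x by lia.
by rewrite walk_false E leq_addr; case=> <- <-; split=> //; lia.
Qed.

Lemma joined_avoid f side p acc E w : any_state a b c (side, p) -> off_splice side p ->
  mate T x = y -> walk f side p acc = Some (E, w) -> E <> X /\ E <> Y.
Proof.
move=> + + jo; have joy : mate T y = x by rewrite -jo (mateK HT).
elim: f side p acc => [|f IH] [] p acc pN off //; rewrite /any_state /= in pN.
- have mN := mate_lt HS pN.
  rewrite walk_true; case: (ltnP (mate S p) a) => [? [] | h]; first by lia.
  by apply: IH; [rewrite /any_state /=; lia | right; lia].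
- have [//|[px py]] := off.
  have mN := mate_lt HT pN; have Kp := mateK HT pN.
  rewrite walk_false; case: (leqP b (mate T p)) => h; last first.
    by apply: IH; [rewrite /any_state /=; lia | left].
  case=> EE _; split=> EX.
  + have Ex : mate T p = x by lia.
    by apply: py; rewrite -Kp Ex.
  + have Ey : mate T p = y by lia.
    by apply: px; rewrite -Kp Ey.
Qed.

Lemma off_outer p : p < a + c -> p <> X -> p <> Y ->
  off_splice (outer_state a b p).1 (outer_state a b p).2.
Proof. by rewrite /outer_state; case: (ltnP p a) => /= h *; [left | right; lia]. Qed.

Lemma any_outer p : p < a + c -> any_state a b c ((outer_state a b p).1, (outer_state a b p).2).
Proof. by rewrite /outer_state; case: (ltnP p a) => /= *; rewrite /any_state /=; lia. Qed.

Lemma cstart_splice p : p < a + c -> cstart a b c S T' p =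
  Some (mate (splice (a + c) X Y e C) p, dots (splice (a + c) X Y e C) p).
Proof.
move=> pN; have XC : X < a + c by lia.
have YC : Y < a + c by lia.
have KX := mateK HC XC; have KY := mateK HC YC; have Kp := mateK HC pN.
have DX := dots_mate HC XC; have DY := dots_mate HC YC.
rewrite mate_splice // dots_splice //.
have [->|pX] := eqVneq p X.
  rewrite cstartE /outer_state ifN; last by lia.
  have -> : b + (X - a) = x by lia.
  rewrite walk_false mate_splice // dots_splice // eqxx leq_addr.
  by congr (Some (_, _)); lia.
have [->|pY] := eqVneq p Y.
  rewrite cstartE /outer_state ifN; last by lia.
  have -> : b + (Y - a) = y by lia.
  rewrite walk_false mate_splice // dots_splice // eqxx (introF eqP (nesym xy)) leq_addr.
  by congr (Some (_, _)); lia.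
move: pX pY => /eqP pX /eqP pY.
have any := any_outer pN; have off := off_outer pN pX pY.
have := cstart_concat pN; rewrite cstartE => W.
have [r] := cstart_total HS HT' bac pN; rewrite cstartE => W'; rewrite W'.
have [mX|/eqP mX] := eqVneq (mate C p) X; last have [mY|/eqP mY] := eqVneq (mate C p) Y.
- rewrite mX in W.
  have nj : mate C X <> Y by rewrite -mX Kp.
  have zz : (x0 = x0 /\ y0 = y0) \/ (x0 = y0 /\ y0 = x0) by left.
  have [g W2] := walk_splice_through_walk any off zz nj W.
  rewrite (walk_unique W' W2); congr (Some (_, _)).
  by rewrite -mX (dots_mate HC).
- rewrite mY in W.
  have nj : mate C X <> Y by move=> E; apply: pX; rewrite -KX E -mY Kp.
  have zz : (y0 = x0 /\ x0 = y0) \/ (y0 = y0 /\ x0 = x0) by right.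
  have [g W2] := walk_splice_through_walk any off zz nj W.
  rewrite (walk_unique W' W2); congr (Some (_, _)).
  by rewrite -mY (dots_mate HC) //; lia.
- by rewrite (walk_unique W' (walk_splice any off W mX mY)).
Qed.

Local Notation onl j := (on_loop a b c S T j).
Local Notation onl' j := (on_loop a b c S T' j).
Local Notation loop j := (loop_at a b c S T j).
Local Notation loop' j := (loop_at a b c S T' j).

Lemma inner_off j : j < b -> any_state a b c (false, j) /\ off_splice false j.
Proof. by move=> jb; split; [rewrite /any_state /=; lia | right; lia]. Qed.

Lemma on_loop_splice j : j < b -> onl j -> onl' j.
Proof.
move=> jb jl; apply/(on_loopP HS HT' bac jb) => f acc.
have [k] := ubnP f; elim: k => // k IH in f j acc jb jl *.
case: f => // f; rewrite ltnS => fk.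
have [mb ml] := on_loop_mateT HS HT bac jb jl.
have [h1 h2 h3] := on_loop_mateS HS HT bac mb ml.
rewrite walk_false !(mate_inner jb mb) leqNgt mb /=.
case: f fk => // f fk; rewrite walk_true ltnNge h1 /=; apply: IH => //; lia.
Qed.

Lemma loop_at_splice j : j < b -> onl j -> loop' j = loop j.
Proof.
move=> jb jl; rewrite /loop_at.
suff gen f cur acc vis : cur < b -> onl cur ->
  ctrav a S T' f j cur acc vis = ctrav a S T f j cur acc vis by apply: gen.
elim: f cur acc vis => // f IH cur acc vis cb cl.
have [mb ml] := on_loop_mateT HS HT bac cb cl.
have [h1 h2 h3] := on_loop_mateS HS HT bac mb ml.
by rewrite !ctravS !(mate_inner cb mb) IH.
Qed.

Lemma not_on_loopP j : j < b -> ~~ onl j ->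
  exists f E w, [/\ walk f false j 0 = Some (E, w), E < a + c &
     E <> X -> E <> Y -> ~~ onl' j].
Proof.
move=> jb; rewrite /on_loop; case W: (cwalk _ _ _ _ _ _ _ _) => [[E w]|] // _.
have [any off] := inner_off jb.
exists (fuel a b c), E, w; split=> //; first by case: (walk_reverse HS HT bac (w := w) any W).
by move=> EX EY; rewrite (walk_splice any off W EX EY).
Qed.

(** A path through the interface turns into a loop only if it runs from [X] to [Y]. If [x] and [y]
    are already joined inside [T], the loop closes within the spliced tangle, away from the
    interface; otherwise paths ending at [X] or [Y] are merely continued. *)
Lemma on_loop_splice_same j : j < b -> (mate T x = y \/ mate C X <> Y) -> onl' j = onl j.
Proof.
move=> jb jo; case jl: (onl j); first exact: on_loop_splice.
have [any off] := inner_off jb.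
have [f [E [w [W EN h]]]] := not_on_loopP jb (negbT jl).
have [EX|/eqP EX] := eqVneq E X; last have [EY|/eqP EY] := eqVneq E Y.
- case: jo => [jo|ne]; first by case: (joined_avoid any off jo W).
  rewrite EX in W; have zz : (x0 = x0 /\ y0 = y0) \/ (x0 = y0 /\ y0 = x0) by left.
  have [g W2] := walk_splice_through_walk any off zz ne W.
  by apply/negP => /(on_loopP HS HT' bac jb) /(_ g 0); rewrite W2.
- case: jo => [jo|ne]; first by case: (joined_avoid any off jo W).
  rewrite EY in W; have zz : (y0 = x0 /\ x0 = y0) \/ (y0 = y0 /\ x0 = x0) by right.
  have [g W2] := walk_splice_through_walk any off zz ne W.
  by apply/negP => /(on_loopP HS HT' bac jb) /(_ g 0); rewrite W2.
- exact/negbTE/h.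
Qed.

Lemma new_loops_same : (mate T x = y \/ mate C X <> Y) ->
  new_loops a b c S T' = new_loops a b c S T.
Proof.
move=> jo; rewrite /new_loops.
have E : {in iota 0 b, forall j, (onl' j && all (leq j) (loop' j).1) =
     (onl j && all (leq j) (loop j).1)}.
  move=> j; rewrite mem_iota => /andP[_ jb]; rewrite on_loop_splice_same //.
  by case jl: (onl j) => //=; rewrite loop_at_splice.
rewrite (eq_in_filter E); apply/eq_in_map => j.
by rewrite mem_filter mem_iota => /andP[/andP[jl _] /andP[_ jb]]; rewrite loop_at_splice.
Qed.

(** * The loop which closes when both spliced ends belong to one path through the interface *)

Section NewLoop.
Hypotheses (nj : mate T x <> y) (CXY : mate C X = Y).
Local Notation r := (mate T y).
Local Notation s := (mate T x).

Let sy : s <> y := nj.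
Let rx : r <> x. Proof. by move=> E; apply: nj; rewrite -E (mateK HT). Qed.

Let CYX : mate C Y = X.
Proof. by rewrite -CXY (mateK HC) //; lia. Qed.

(** The path from [X] to [Y] is not a single arc of [T], so from either end it reaches the interface
    with its first arc. *)
Lemma first_step z0 z0' : (z0 = x0 /\ z0' = y0) \/ (z0 = y0 /\ z0' = x0) ->
  mate T (b + z0) < b /\
  cwalk a b S T (a + b + c) true (a + mate T (b + z0)) (dots T (b + z0)) =
    Some (a + z0', dots C X).
Proof.
move=> zz; have zC : a + z0 < a + c by lia.
have XC : X < a + c by lia.
have dC : dots C (a + z0) = dots C X.
  by case: zz => -[-> _] //; rewrite -(dots_mate HC XC) CXY.
have mC : mate C (a + z0) = a + z0' by case: zz => -[-> ->].
have := cstart_concat zC; rewrite cstartE /outer_state ifN; last by lia.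
have -> : b + (a + z0 - a) = b + z0 by lia.
rewrite walk_false mC dC; case: (leqP b (mate T (b + z0))) => h // -[E _].
by exfalso; case: zz => -[z1 z2]; [apply: sy|apply: rx]; move: E h; rewrite z1 z2; lia.
Qed.

Let sb : s < b. Proof. by have [] := @first_step x0 y0 (or_introl (conj erefl erefl)). Qed.
Let rb : r < b. Proof. by have [] := @first_step y0 x0 (or_intror (conj erefl erefl)). Qed.

Lemma mate_splice_ends : [/\ mate T' r = s, mate T' s = r &
  dots T' r = dots T x + dots T y + e].
Proof.
have Kx := mateK HT xN; have Ky := mateK HT yN.
have nx := mate_neq HT xN; have ny := mate_neq HT yN.
rewrite !mate_splice ?dots_splice; try lia.
rewrite Kx Ky; split; split_eqs; lia.
Qed.

(** From [r] the fused arc leads to [s], and from there the old path towards [Y] returns to [r] just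
    before its last arc. Each round uses up fuel, so the walk never ends. *)
Lemma on_loop_new : onl' r.
Proof.
have [Er Es Dr] := mate_splice_ends.
apply/(on_loopP HS HT' bac rb).
have [_ W] := @first_step x0 y0 (or_introl (conj erefl erefl)).
have any : any_state a b c (true, a + s) by rewrite /any_state /=; lia.
have off : off_splice true (a + s) by left.
have [f' [acc' [_ _ _ _ Wy]]] := walk_splice_end any off (or_intror erefl) W.
move=> f acc; have [k] := ubnP f; elim: k => // k IH in f acc *.
case: f => // f; rewrite ltnS => fk.
rewrite walk_false Er leqNgt sb /=.
apply: (@walk_none_acc _ _ _ _ _ _ _ (dots T x)).
case W2: (walk' f true _ _) => [u|] //.
have := walk_mono W2 (leq_addl f' f); rewrite Wy IH //.
Qed.

(** The walk ends with the arc from [r] to [y], whose dots the traversal has already counted in the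
    fused arc at its start; this explains the terms [dots T y] and [e]. One step of the traversal
    corresponds to two steps of the walk. *)
Lemma ctrav_walk k f f' cur acc vis w : f <= k -> f <= f' -> cur < b -> cur <> r ->
  walk f false cur acc = Some (Y, w) ->
  (ctrav a S T' f' r cur (acc + (dots T y + e)) vis).2 + dots T y = w + (dots T y + e).
Proof.
elim: k f f' cur acc vis => [|k IH] [|f] f' cur acc vis //.
rewrite !ltnS => fk; case: f' => // f'; rewrite ltnS => ff' cb cr.
have cN : cur < b + c by lia.
have Kc := mateK HT cN.
rewrite walk_false; case: (leqP b (mate T cur)) => h.
  case=> E _; exfalso; apply: cr; have Ey : mate T cur = y.
    by have := mate_lt HT cN; lia.
  by rewrite -Kc Ey.
case: f fk ff' => // f fk ff'.
have mN : a + mate T cur < a + b by lia.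
have mN' := mate_lt HS mN.
rewrite walk_true; case: (ltnP (mate S _) a) => h2; first by case; lia.
rewrite ctravS !(mate_inner cb h).
set q2 := turn _; set acc1 := _ + dots S _.
case: eqP => [E|ne] W.
  case: f {fk ff'} W => // f; rewrite walk_false E (mateK HT) // leq_addr.
  by rewrite (dots_mate HT) //= /acc1; case=> _ <-; lia.
rewrite -(IH _ f' _ _ (q2 :: mate T cur :: vis) _ _ _ _ W) //; try by [rewrite /q2; lia|lia].
by congr ((ctrav _ _ _ _ _ _ _ _).2 + _); rewrite /acc1; lia.
Qed.

Lemma new_loop_dots : (loop' r).2 = dots C X + e.
Proof.
have [Er Es Dr] := mate_splice_ends.
have [_] := @first_step x0 y0 (or_introl (conj erefl erefl)).
have mN : a + s < a + b by lia.
have mN' := mate_lt HS mN.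
rewrite /loop_at /fuel; case: (a + b + c) => // f.
rewrite walk_true; case: (ltnP (mate S _) a) => h2; first by case; lia.
move=> W; rewrite ctravS Er Dr add0n.
case: eqP => [E|ne].
  case: f W => // f; rewrite walk_false E (mateK HT) // leq_addr (dots_mate HT) //=.
  by case=> _ <-; lia.
apply: (@addIn (dots T y)).
have -> : dots C X + e + dots T y = dots C X + (dots T y + e) by lia.
rewrite -(@ctrav_walk f f f.+1 _ _ [:: turn s; s; r] _ _ _ _ _ W) //; last by lia.
by congr ((ctrav _ _ _ _ _ _ _ _).2 + _); lia.
Qed.

Lemma walk_closed (Q : pred nat) f side p acc z0 w :
  (forall u, u < b -> mate T' u < b -> Q (mate T' u) = Q u) ->
  (forall u, u < b -> a <= mate S (a + u) -> Q (turn u) = Q u) ->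
  (if side then a <= p < a + b else p < b) -> b + z0 = x \/ b + z0 = y ->
  walk f side p acc = Some (a + z0, w) ->
  Q (if side then p - a else p) = Q (mate T (b + z0)).
Proof.
move=> QT QS + zz; elim: f side p acc => [|f IH] [] p acc pN //.
- have pN' : p < a + b by lia.
  have mN' := mate_lt HS pN'.
  rewrite walk_true; case: (ltnP (mate S p) a) => h; first by case=> *; lia.
  have Ep : p = a + (p - a) by lia.
  move=> W; rewrite -(IH false (mate S p - a) _ _ W); last by lia.
  by rewrite {2}Ep QS //; [lia | rewrite -Ep].
- have pN' : p < b + c by move: pN => /=; lia.
  have mN' := mate_lt HT pN'; have Kp := mateK HT pN'.
  rewrite walk_false; case: (leqP b (mate T p)) => h.
    by case=> E _; have <- : mate T p = b + z0 by [lia]; rewrite Kp.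
  move=> W; rewrite -(IH true (a + mate T p) _ _ W); last by lia.
  by rewrite addKn -(mate_inner pN h).1 QT // (mate_inner pN h).1.
Qed.

(** A point which was not on a loop lies on a path. If that path avoids [X] and [Y] it is unchanged
    and still leaves the diagram; otherwise it is the path from [X] to [Y], which becomes the new
    loop. *)
Lemma mem_new_loop j : j < b -> (j \in (loop' r).1) = onl' j && ~~ onl j.
Proof.
move=> jb; have [u l cl m _] := loopP HS HT' bac rb on_loop_new.
have [Er Es Dr] := mate_splice_ends.
apply/idP/andP => [jr|[jl' jl]].
  have [_ jl'] := l _ jr; split=> //; apply/negP => jl.
  have [P _] := loop_class HS HT' bac rb on_loop_new jr.
  have := perm_mem P r; rewrite m loop_at_splice // => rj.
  have [_ /(_ _ rj)[_ rl _]] := loopP HS HT bac jb jl.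
  have := on_loop_mateT HS HT bac rb rl; rewrite (mateK HT) //; lia.
have [f [E [w [W EN h]]]] := not_on_loopP jb jl.
have [QT QS] := closed_invariant HS HT' bac cl.
have rs : s \in (loop' r).1 by have [] := cl _ m; rewrite Er.
have [EX|/eqP EX] := eqVneq E X; last have [EY|/eqP EY] := eqVneq E Y.
- rewrite EX in W.
  have : (j \in _) = (s \in _) := walk_closed (side := false) QT QS jb (or_introl erefl) W.
  by rewrite rs => ->.
- rewrite EY in W.
  have : (j \in _) = (r \in _) := walk_closed (side := false) QT QS jb (or_intror erefl) W.
  by rewrite m => ->.
- by have := h EX EY; rewrite jl'.
Qed.

(** Each loop is listed at its least interface point. Old loops keep theirs, and the least point of
    the new loop is the only index that is added. *)
Lemma new_loops_insert :
  perm_eq (new_loops a b c S T') (dots C X + e :: new_loops a b c S T).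
Proof.
have [u l cl m _] := loopP HS HT' bac rb on_loop_new.
have [mn mnr mnle] : exists2 mn, mn \in (loop' r).1 & {in (loop' r).1, forall v, mn <= v}.
  have ex : exists v, v \in (loop' r).1 by exists r.
  by case: (ex_minnP ex) => mn h1 h2; exists mn.
have mnb : mn < b by have [] := l _ mnr.
pose P j := onl j && all (leq j) (loop j).1.
pose P' j := onl' j && all (leq j) (loop' j).1.
have E : {in iota 0 b, forall j, P' j = P j || (j == mn)}.
  move=> j; rewrite mem_iota => /andP[_ jb]; rewrite /P /P'.
  have := mem_new_loop jb; case jl: (onl j); rewrite ?andbT ?andbF => jr.
    have -> : (j == mn) = false by apply/eqP => e1; rewrite e1 mnr in jr.
    by rewrite orbF on_loop_splice // loop_at_splice.
  rewrite /= -jr; case jr': (j \in _); last first.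
    by apply/esym/eqP => e1; rewrite e1 mnr in jr'.
  have [pe _] := loop_class HS HT' bac rb on_loop_new jr'.
  rewrite /= (perm_all _ pe); apply/allP/eqP => [h|-> v /mnle //].
  by apply/eqP; rewrite eqn_leq mnle // andbT; apply: h.
have nP : ~~ P mn.
  by have := mem_new_loop mnb; rewrite mnr /P => /esym/andP[_ /negPf ->].
have mni : mn \in iota 0 b by rewrite mem_iota.
have := perm_map (fun j => (loop' j).2) (perm_filter_insert (iota_uniq 0 b) mni nP E).
move=> /perm_trans; apply; rewrite /= (loop_class HS HT' bac rb on_loop_new mnr).2.
rewrite new_loop_dots perm_cons.
have -> // : [seq (loop' j).2 | j <- iota 0 b & P j] = new_loops a b c S T.
apply/eq_in_map => j.
by rewrite mem_filter mem_iota => /andP[/andP[jl _] /andP[_ jb]]; rewrite loop_at_splice.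
Qed.
End NewLoop.

(* This is how products of the generators e_i are computed. *)
Lemma concat_splice : concat a b c S T' = splice (a + c) X Y e C.
Proof.
apply: (@raw_ext (a + c)); rewrite /= ?size_map ?size_iota //.
- by move=> p pN; rewrite {1}/concat mate_tabulate // cstart_splice.
- by move=> p pN; rewrite {1}/concat dots_tabulate // cstart_splice.
have p1 (u : nat) (l1 l2 l3 : seq nat) : perm_eq (l1 ++ sort leq (u :: l2) ++ l3)
    (u :: sort leq (l1 ++ l2 ++ l3)).
  apply/permP => q; rewrite /= !count_cat.
  by rewrite !(permP (permEl (perm_sort _ _))) /= !count_cat; lia.
rewrite /rl /= -/(mate T x) -/(rl T).
(* Three origins of loops: the arc from [x] to [y] lies in [T] and closes there; a path from [X] to
   [Y] through the interface closes; or two different paths are fused and no loop arises. *)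
case: (eqVneq (mate T x) y) => [jo|/eqP nj].
  have [CXY DXY] := joined_concat jo.
  rewrite new_loops_same; last by left.
  by rewrite CXY eqxx DXY; apply: sort_leq_eq; exact: p1.
case: (eqVneq (mate C X) Y) => [CXY|/eqP ne]; last first.
  by rewrite new_loops_same //; right.
apply: sort_leq_eq.
apply/permP => q; rewrite !count_cat (permP (new_loops_insert nj CXY)) /=.
by rewrite (permP (permEl (perm_sort _ _))) /= !count_cat; lia.
Qed.
End ConcatSplice.

(** * Reflection and words *)

Definition flip (m k p : nat) : nat := if p < m then k + p else p - m.

Lemma flip_lt m k p : p < m + k -> flip m k p < k + m.
Proof. by rewrite /flip; case: (ltnP p m); lia. Qed.

Lemma flipK m k p : p < m + k -> flip k m (flip m k p) = p.
Proof.
rewrite /flip; case: (ltnP p m) => h1 h2; first by rewrite ifN; lia.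
by rewrite ifT; lia.
Qed.

Lemma flip_eq m k p r : p < m + k -> r < k + m -> (flip m k p == r) = (p == flip k m r).
Proof.
move=> pN rN; apply/eqP/eqP => [<-|->]; by rewrite flipK.
Qed.

Lemma bpos_flip m k p : p < m + k -> bpos k m (flip m k p) = (m + k).-1 - bpos m k p.
Proof.
move=> pN; rewrite /flip; case: (ltnP p m) => h.
  by rewrite bpos_top ?bpos_bot; lia.
by rewrite bpos_bot ?bpos_top; lia.
Qed.

Lemma mate_rstar m k t y : y < k + m -> mate (rstar m k t) y = flip m k (mate t (flip k m y)).
Proof. by move=> yN; rewrite /mate (nth_map 0) ?size_iota // nth_iota. Qed.

Lemma dots_rstar m k t y : y < k + m -> dots (rstar m k t) y = dots t (flip k m y).
Proof. by move=> yN; rewrite /dots (nth_map 0) ?size_iota // nth_iota. Qed.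

Section Rstar.
Variables (m k : nat).
Implicit Types (t : raw) (p x y e : nat).

Lemma matching_rstar t : matching (m + k) t -> matching (k + m) (rstar m k t).
Proof.
move=> H.
have fl p : p < k + m -> mate t (flip k m p) < m + k.
  by move=> pN; apply: (mate_lt H); apply: flip_lt.
split; rewrite ?size_map ?size_iota //.
- by move=> p pN; rewrite mate_rstar //; apply: flip_lt; apply: fl.
- move=> p pN; rewrite mate_rstar // => /eqP; rewrite flip_eq ?fl // => /eqP.
  by apply: (mate_neq H); apply: flip_lt.
- move=> p pN; rewrite mate_rstar mate_rstar ?flip_lt ?fl // flipK ?fl // (mateK H) ?flip_lt //.
  by rewrite flipK.
- move=> p pN; rewrite mate_rstar // !dots_rstar ?flip_lt ?fl // flipK ?fl //.
  by rewrite (dots_mate H) // flip_lt.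
- exact: sorted_rl H.
Qed.

Lemma rstarK t : matching (m + k) t -> rstar k m (rstar m k t) = t.
Proof.
move=> H; apply: (@raw_ext (m + k)); rewrite ?size_map ?size_iota ?(size_rm H) ?(size_rd H) //.
- move=> p pN; rewrite !mate_rstar ?flip_lt // !flipK ?(mate_lt H) //.
- by move=> p pN; rewrite !dots_rstar ?flip_lt // flipK.
Qed.

Lemma parity_rstar t : parity (rstar m k t) = rstar m k (parity t).
Proof.
apply: (@raw_ext (k + m)); rewrite ?size_map ?size_iota //.
by move=> p pN; rewrite dots_parity !dots_rstar // dots_parity.
Qed.

Lemma rstar_splice x y e t : matching (m + k) t -> x < m + k -> y < m + k ->
  rstar m k (splice (m + k) x y e t) =
  splice (k + m) (flip m k x) (flip m k y) e (rstar m k t).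
Proof.
move=> H xN yN.
have fl p : p < k + m -> mate t (flip k m p) < m + k.
  by move=> pN; apply: (mate_lt H); apply: flip_lt.
have E p z : p < k + m -> z < m + k -> (p == flip m k z) = (flip k m p == z).
  by move=> pN zN; rewrite eq_sym [RHS]eq_sym; apply: flip_eq.
apply: (@raw_ext (k + m)); rewrite ?size_map ?size_iota //.
- move=> p pN; have fp := flip_lt pN; have mp := fl _ pN.
  rewrite mate_rstar // !mate_splice // !mate_rstar ?flip_lt // !E // ?flip_lt //.
  by rewrite !flipK //; do ![case: ifP].
- move=> p pN; have fp := flip_lt pN; have mp := fl _ pN.
  rewrite dots_rstar // !dots_splice // !mate_rstar // !dots_rstar ?flip_lt // !E // ?flip_lt //.
  by rewrite !flipK.
- rewrite /rstar /splice /rl /= -!/(mate _ _) -!/(dots _ _).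
  by rewrite dots_rstar ?flip_lt // mate_rstar ?flip_lt // E ?flip_lt ?(mate_lt H) ?flip_lt // !flipK // (mate_lt H).
Qed.

(** Reflection reverses the boundary order, and the left face stays between its last and its first
    position, so crossings and hidden arcs are preserved in both directions. *)
Lemma valid_rstar t : valid_tangle m k t -> valid_tangle k m (rstar m k t).
Proof.
case/valid_tangleP => H nc ex; apply/valid_tangleP.
have fl p : p < k + m -> mate t (flip k m p) < m + k.
  by move=> pN; apply: (mate_lt H); apply: flip_lt.
have bl p : p < m + k -> bpos m k p < m + k.
  by move=> pN; rewrite /bpos; case: (ltnP p m); lia.
have B p : p < k + m -> bpos k m p = (m + k).-1 - bpos m k (flip k m p).
  by move=> pN; rewrite -bpos_flip ?flip_lt // flipK.
have Bm p : p < k + m ->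
    bpos k m (mate (rstar m k t) p) = (m + k).-1 - bpos m k (mate t (flip k m p)).
  by move=> pN; rewrite mate_rstar // bpos_flip // fl.
split; first exact: matching_rstar.
- move=> p r pN rN; rewrite !Bm // !B //.
  have := nc (mate t (flip k m r)) (mate t (flip k m p)) (fl _ rN) (fl _ pN).
  rewrite !(mateK H) ?flip_lt // ?flipK ?fl //.
  have := bl _ (fl _ rN); have := bl _ (fl _ pN).
  have := bl _ (flip_lt pN); have := bl _ (flip_lt rN).
  by lia.
- move=> p r pN rN; rewrite dots_rstar // => d0; rewrite !Bm // !B //.
  have := ex (flip k m p) (mate t (flip k m r)) (flip_lt pN) (fl _ rN) d0.
  rewrite !(mateK H) ?flip_lt // ?flipK ?fl //.
  have := bl _ (fl _ rN); have := bl _ (fl _ pN).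
  have := bl _ (flip_lt pN); have := bl _ (flip_lt rN).
  by lia.
Qed.
End Rstar.

(* e_i placed on top of an (m, n)-tangle. *)
Definition act (m n i : nat) (t : raw) : raw :=
  splice (m + n) (m + i.-1) (m + i.-1).+1 (i == 0) t.

Section Act.
Variables (m n : nat).
Hypothesis n2 : 1 < n.
Implicit Types (i : nat) (t : raw) (w : seq nat).

Lemma matching_act i t : i < n -> matching (m + n) t -> matching (m + n) (act m n i t).
Proof. by move=> iN H; apply: matching_splice => //; lia. Qed.

Lemma valid_act i t : i < n -> valid_tangle m n t -> valid_tangle m n (act m n i t).
Proof. by move=> iN; apply: splice_valid; lia. Qed.

Definition actw w t := foldr (act m n) t w.

Lemma matching_actw w t : all (ltn^~ n) w -> matching (m + n) t -> matching (m + n) (actw w t).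
Proof. by move=> + H; elim: w => //= i w IH /andP[iN /IH]; apply: matching_act. Qed.

Lemma valid_actw w t : all (ltn^~ n) w -> valid_tangle m n t -> valid_tangle m n (actw w t).
Proof. by move=> + H; elim: w => //= i w IH /andP[iN /IH]; apply: valid_act. Qed.

End Act.

Section ConcatAct.
Variables (m n : nat).
Hypothesis n2 : 1 < n.
Implicit Types (i : nat) (t : raw) (w : seq nat).

Lemma concat_act a S i t : i < n -> matching (a + m) S -> matching (m + n) t -> m <= a + n ->
  matching (a + n) (concat a m n S t) ->
  concat a m n S (act m n i t) = act a n i (concat a m n S t).
Proof.
move=> iN HS Ht le HC; rewrite /act -!addnS.
by apply: concat_splice => //; lia.
Qed.

(** Words pull out of a concatenation. Together with [concat_id] this takes the place of
    associativity for arbitrary tangles. *)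
Lemma concat_actw a S w t : all (ltn^~ n) w -> matching (a + m) S -> matching (m + n) t ->
  m <= a + n -> matching (a + n) (concat a m n S t) ->
  concat a m n S (actw m n w t) = actw a n w (concat a m n S t).
Proof.
move=> + HS Ht le HC; elim: w => //= i w IH /andP[iN wN].
have E := IH wN; rewrite concat_act ?E //; exact: matching_actw.
Qed.
End ConcatAct.

Section Words.
Variables (n : nat).
Hypothesis n2 : 1 < n.
Implicit Types (i : nat) (t : raw) (u w : seq nat).

Lemma mate_id p : p < n + n -> mate (id_raw n) p = if p < n then p + n else p - n.
Proof. by move=> pN; rewrite /mate (nth_map 0) ?size_iota // nth_iota. Qed.

Lemma dots_id p : dots (id_raw n) p = 0.
Proof. by rewrite /dots nth_nseq if_same. Qed.

Lemma matching_id : matching (n + n) (id_raw n).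
Proof.
split; rewrite ?size_map ?size_iota ?size_nseq //.
- by move=> p pN; rewrite mate_id //; case: (ltnP p n); lia.
- by move=> p pN; rewrite mate_id //; case: (ltnP p n); lia.
- move=> p pN; rewrite (mate_id pN); case: (ltnP p n) => h; rewrite mate_id; try lia.
    by rewrite ifN; lia.
  by rewrite ifT; lia.
- by move=> p pN; rewrite !dots_id.
Qed.

Lemma valid_id : valid_tangle n n (id_raw n).
Proof.
have H := matching_id; apply/valid_tangleP; split=> // [p r pN rN|p r pN rN]; last by rewrite dots_id.
have B1 q : q < n -> bpos n n q = q /\ bpos n n (q + n) = (n + n).-1 - q.
  by move=> qn; rewrite bpos_bot ?bpos_top //; lia.
have B2 q : n <= q -> q < n + n -> bpos n n q = (n + n + n).-1 - q /\ bpos n n (q - n) = q - n.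
  by move=> nq qn; rewrite bpos_top ?bpos_bot //; lia.
rewrite !mate_id //; case: (ltnP p n) => h1; case: (ltnP r n) => h2.
- by have := B1 _ h1; have := B1 _ h2; lia.
- by have := B1 _ h1; have := B2 _ h2 rN; lia.
- by have := B2 _ h1 pN; have := B1 _ h2; lia.
- by have := B2 _ h1 pN; have := B2 _ h2 rN; lia.
Qed.

Lemma rstar_id : rstar n n (id_raw n) = id_raw n.
Proof.
apply: (@raw_ext (n + n)); rewrite ?size_map ?size_iota ?size_nseq //.
- move=> p pN; rewrite mate_rstar // mate_id ?flip_lt // mate_id // /flip.
  by split_ifs; lia.
- by move=> p pN; rewrite dots_rstar // !dots_id.
Qed.

Lemma concat_id a S : matching (a + n) S -> concat a n n S (id_raw n) = S.
Proof.
move=> H.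
have st p : p < a + n -> cstart a n n S (id_raw n) p = Some (mate S p, dots S p).
  move=> pN; have mN := mate_lt H pN.
  rewrite cstartE; have -> : (a + n + n).+1 = (a + n + n).-2.+3 by lia.
  rewrite /outer_state; case: (ltnP p a) => h; rewrite [_.1]/= [_.2]/=.
    rewrite walk_true; case: (ltnP (mate S p) a) => h2 //.
    have h3 : mate S p - a < n by lia.
    rewrite walk_false mate_id ?dots_id; last by lia.
    by rewrite h3 leq_addl; congr (Some (_, _)); lia.
  rewrite walk_false mate_id ?dots_id; last by lia.
  have -> : (n + (p - a) < n) = false by lia.
  rewrite ifN; last by lia.
  have -> : a + (n + (p - a) - n) = p by lia.
  rewrite walk_true; case: (ltnP (mate S p) a) => h2 //.
  have h3 : mate S p - a < n by lia.
  rewrite walk_false mate_id ?dots_id; last by lia.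
  by rewrite h3 leq_addl; congr (Some (_, _)); lia.
apply: (@raw_ext (a + n)); rewrite ?size_map ?size_iota ?(size_rm H) ?(size_rd H) //.
- by move=> p pN; rewrite mate_tabulate // st.
- by move=> p pN; rewrite dots_tabulate // st.
have nl : new_loops a n n S (id_raw n) = [::].
  rewrite /new_loops; have -> // : [seq j <- iota 0 n | on_loop a n n S (id_raw n) j &
      all (leq j) (loop_at a n n S (id_raw n) j).1] = [::].
  apply/eqP; rewrite -(negbK (_ == _)) -has_filter; apply/hasPn => j.
  rewrite mem_iota => /andP[_ jN]; rewrite /on_loop /fuel walk_false mate_id; last by lia.
  by rewrite (_ : j < n) ?leq_addl.
by rewrite /concat /= nl !cats0 sort_leq_id //; exact: sorted_rl H.
Qed.

Definition word w := actw n n w (id_raw n).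

Lemma valid_word w : all (ltn^~ n) w -> valid_tangle n n (word w).
Proof. by move=> wN; apply: valid_actw => //; exact: valid_id. Qed.

Lemma matching_word w : all (ltn^~ n) w -> matching (n + n) (word w).
Proof. by move=> wN; apply: valid_matching; apply: valid_word. Qed.

Lemma concat_word a S w : all (ltn^~ n) w -> matching (a + n) S ->
  concat a n n S (word w) = actw a n w S.
Proof.
move=> wN H; rewrite /word concat_actw ?concat_id //; [exact: matching_id | lia].
Qed.

Lemma act_id i : i < n -> act n n i (id_raw n) = e_raw n i.
Proof.
move=> iN; apply: (@raw_ext (n + n)); rewrite ?size_map ?size_iota //.
1,2: by rewrite /e_raw; case: ifP; rewrite /= ?size_map ?size_nseq ?size_iota.
- move=> p pN; rewrite mate_splice // !mate_id //; try lia.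
  have -> : mate (e_raw n i) p = e_match n (maxn i 1) p.
    rewrite /mate /e_raw; case: (eqVneq i 0) => [->|i0]; rewrite (nth_map 0) ?size_iota // nth_iota //.
    by congr e_match; lia.
  rewrite /e_match; case: (posnP i) => [->|i0]; rewrite ?max0n /=.
    by split_ifs; lia.
  have -> : maxn i 1 = i by lia.
  have -> : (n + i.-1).+1 = n + i by lia.
  by split_ifs; lia.
- move=> p pN; rewrite dots_splice // !dots_id !mate_id //; try lia.
  rewrite /e_raw /dots; case: (posnP i) => [->|i0] /=.
    rewrite (nth_map 0) ?size_iota // nth_iota // !inE.
    by split_ifs; lia.
  by rewrite nth_nseq; split_ifs; lia.
- rewrite /act /splice /rl /= ifN; first by rewrite /e_raw; case: ifP.
  by rewrite mate_id; [case: ifP; lia|lia].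
Qed.

(* e_i placed below an (n, n)-tangle. *)
Definition bact i t := splice (n + n) i.-1 i.-1.+1 (i == 0) t.

Lemma rstar_act i t : i < n -> matching (n + n) t ->
  rstar n n (act n n i t) = bact i (rstar n n t).
Proof.
move=> iN H; rewrite rstar_splice //; try lia.
by rewrite /flip !ifN; try lia; congr splice; lia.
Qed.

Lemma act_bact i j t : i < n -> j < n -> matching (n + n) t ->
  act n n i (bact j t) = bact j (act n n i t).
Proof.
by move=> iN jN H; apply: splice_comm => //; rewrite /= ?inE; lia.
Qed.

(** A generator placed below commutes with those placed above and thus moves through the word to the
    identity, where above and below agree. Words are in this way closed under reflection. *)
Lemma bact_word i w : i < n -> all (ltn^~ n) w -> bact i (word w) = word (rcons w i).
Proof.
move=> iN; elim: w => [_|j w IH /andP[jN wN]] /=.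
  rewrite -[in LHS]rstar_id -rstar_act //; last exact: matching_id.
  have e : act n n i (id_raw n) = bact i (id_raw n).
    apply: (@raw_ext (n + n)); rewrite ?size_map ?size_iota //.
    - move=> p pN; rewrite !mate_splice // !mate_id //; try lia.
      by split_ifs; lia.
    - move=> p pN; rewrite !dots_splice // !dots_id !mate_id //; try lia.
      by split_ifs; lia.
    - by rewrite /act /bact /splice /rl /= !mate_id; try lia; split_ifs => //; exfalso; lia.
  by rewrite rstar_act ?rstar_id //; exact: matching_id.
by rewrite -act_bact ?IH //; exact: matching_word.
Qed.

Lemma rstar_word w : all (ltn^~ n) w -> rstar n n (word w) = word (rev w).
Proof.
elim: w => [_|i w IH /andP[iN wN]] /=; first exact: rstar_id.
rewrite rstar_act ?IH ?rev_cons ?bact_word ?all_rev //; exact: matching_word.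
Qed.

(** The second argument of [concat] lies on top, and the head of a word is its topmost generator;
    hence the reversed order. *)
Lemma concat_words u w : all (ltn^~ n) u -> all (ltn^~ n) w ->
  concat n n n (word u) (word w) = word (w ++ u).
Proof.
move=> uN wN; rewrite concat_word //; last exact: matching_word.
by rewrite /word /actw foldr_cat.
Qed.
End Words.

(** * Counting end points, dots and undotted cups modulo 4 *)

Lemma countE (s : seq nat) (P : pred nat) : count P s = \sum_(p <- s) P p.
Proof. by rewrite -sum1_count big_mkcond; apply: eq_bigr => p _; case: (P p). Qed.

Lemma count_split N (P P1 P2 : pred nat) : (forall p, p < N -> P p = P1 p + P2 p :> nat) ->
  count P (iota 0 N) = count P1 (iota 0 N) + count P2 (iota 0 N).
Proof.
move=> e; rewrite !countE -big_split; apply: eq_big_seq => p.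
by rewrite mem_iota => /andP[_ pN]; apply: e.
Qed.

Lemma sum_count N (P : pred nat) (d : nat -> nat) : (forall p, p < N -> d p <= 1) ->
  \sum_(p <- iota 0 N | P p) d p = count (fun p => P p && (d p == 1)) (iota 0 N).
Proof.
move=> e; rewrite countE big_mkcond; apply: eq_big_seq => p.
rewrite mem_iota => /andP[_ pN]; have := e p pN; case: (P p) => //=.
by case: (d p) => [|[]].
Qed.

Lemma count_iota_lt a N : a <= N -> count (fun p => p < a) (iota 0 N) = a.
Proof.
move=> aN; rewrite -(subnKC aN) iotaD count_cat add0n.
rewrite (@eq_in_count _ _ predT) ?count_predT ?size_iota; last first.
  by move=> p; rewrite mem_iota => /andP[_ ->].
rewrite (@eq_in_count _ _ pred0) ?count_pred0 ?addn0 // => p.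
by rewrite mem_iota => /andP[h _]; rewrite ltnNge h.
Qed.

Section Counting.
Variables (N : nat) (t : raw).
Hypothesis H : matching N t.
Implicit Types (P : pred nat).

Lemma perm_map_mate : perm_eq (map (mate t) (iota 0 N)) (iota 0 N).
Proof.
apply: uniq_perm; rewrite ?iota_uniq //.
  rewrite map_inj_in_uniq ?iota_uniq // => p r; rewrite !mem_iota => /andP[_ pN] /andP[_ rN] e.
  by rewrite -(mateK H pN) e (mateK H).
move=> p; apply/mapP/idP => [[r]|]; rewrite !mem_iota => /andP[_ pN].
  by move=> ->; rewrite (mate_lt H).
by exists (mate t p); rewrite ?mem_iota ?(mate_lt H) ?(mateK H).
Qed.

Lemma count_mate P : count P (iota 0 N) = count (fun p => P (mate t p)) (iota 0 N).
Proof. by rewrite -(permP perm_map_mate) count_map. Qed.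

Lemma eq_count_iota P P' : (forall p, p < N -> P p = P' p) ->
  count P (iota 0 N) = count P' (iota 0 N).
Proof.
by move=> e; apply: eq_in_count => p; rewrite mem_iota => /andP[_ pN]; apply: e.
Qed.

Lemma count_half P : (forall p, p < N -> P (mate t p) = P p) ->
  count P (iota 0 N) = 2 * count (fun p => P p && (p < mate t p)) (iota 0 N).
Proof.
move=> cl; rewrite (@count_split _ _ (fun p => P p && (p < mate t p))
    (fun p => P p && (mate t p < p))); last first.
  by move=> p pN; have := mate_neq H pN; case: (P p) => //=; lia.
rewrite mul2n -addnn; congr addn; rewrite count_mate; apply: eq_count_iota => p pN.
by rewrite cl // (mateK H).
Qed.

(** With u undotted and d dotted arcs in the closed set [P], there are 2u + 2d end points and 2d
    stored dots, in total 2u + 4d. *)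
Lemma undotted_mod4 P : (forall p, p < N -> P (mate t p) = P p) ->
  (forall p, p < N -> dots t p <= 1) ->
  (count P (iota 0 N) + \sum_(p <- iota 0 N | P p) dots t p) %% 4 =
  (2 * count (fun p => [&& P p, p < mate t p & dots t p == 0]) (iota 0 N)) %% 4.
Proof.
move=> cl d1; rewrite sum_count //; have h0 := count_half cl.
have h1 : count P (iota 0 N) = count (fun p => P p && (dots t p == 1)) (iota 0 N)
   + count (fun p => P p && (dots t p == 0)) (iota 0 N).
  apply: count_split => p pN; have := d1 p pN.
  by case: (P p) => //=; case: (dots t p) => [|[]].
have h2 : count (fun p => P p && (dots t p == 0)) (iota 0 N) =
    2 * count (fun p => [&& P p, p < mate t p & dots t p == 0]) (iota 0 N).
  rewrite count_half; last by move=> p pN; rewrite cl // (dots_mate H).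
  congr muln; apply: eq_count_iota => p pN.
  by case: (P p) => //=; rewrite andbC.
by lia.
Qed.
End Counting.

Definition capless (m : nat) (t : raw) := forall j, j < m -> m <= mate t j.

Lemma count_iota_ge a N : a <= N -> count (fun p => a <= p) (iota 0 N) = N - a.
Proof.
move=> aN; have := count_predC (fun p => p < a) (iota 0 N).
rewrite count_iota_lt // size_iota => e.
by rewrite (@eq_count _ _ (predC (fun p => p < a))) => [|p /=]; [lia | rewrite leqNgt].
Qed.

Section EvenDotted.
Variables (m n : nat) (t : raw).
Hypothesis H : matching (m + n) t.
Hypothesis cl : capless m t.

Lemma count_capless :
  count (fun p => (m <= p) && (m <= mate t p)) (iota 0 (m + n)) + m = n.
Proof.
have e1 : count (fun p => m <= p) (iota 0 (m + n)) =
    count (fun p => (m <= p) && (m <= mate t p)) (iota 0 (m + n)) +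
    count (fun p => (m <= p) && (mate t p < m)) (iota 0 (m + n)).
  by apply: count_split => p pN; case: (m <= p) => //=; rewrite ltnNge; case: (_ <= _).
have e2 : count (fun p => (m <= p) && (mate t p < m)) (iota 0 (m + n)) = m.
  rewrite (count_mate H) -[RHS](@count_iota_lt m (m + n)) ?leq_addr //.
  apply: eq_count_iota => p pN; rewrite (mateK H) //.
  by case: (ltnP p m) => [/cl ->|_] //; rewrite andbF.
move: e1; rewrite e2 count_iota_ge; lia.
Qed.

(** The n - m end points of cups are treated by [undotted_mod4], and each dotted edge stores two
    further dots. The defining parity of a half tangle thus becomes an additive condition modulo 4,
    which splicing preserves. *)
Lemma even_mod4 : (forall p, p < m + n -> dots t p <= 1) ->
  (n - m + \sum_(p <- iota 0 (m + n)) dots t p) %% 4 =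
  (2 * (n_dotted_edges m n t + n_undotted_cups m n t)) %% 4.
Proof.
move=> d1; pose P p := (m <= p) && (m <= mate t p).
have clP p : p < m + n -> P (mate t p) = P p.
  by move=> pN; rewrite /P (mateK H) // andbC.
have e1 := undotted_mod4 H clP d1.
have e2 := count_capless.
have e3 : n_undotted_cups m n t =
    count (fun p => [&& P p, p < mate t p & dots t p == 0]) (iota 0 (m + n)).
  apply: eq_count_iota => p pN; rewrite /P -/(mate t p) -/(dots t p); lia.
have e4 : \sum_(p <- iota 0 (m + n) | ~~ P p) dots t p = 2 * n_dotted_edges m n t.
  rewrite sum_count // (count_half H); last by move=> p pN; rewrite clP // (dots_mate H).
  congr muln; apply: eq_count_iota => p pN; rewrite /P -/(mate t p) -/(dots t p).
  by case: (ltnP p m) => pm; [have := cl pm|]; lia.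
rewrite -e3 in e1; rewrite (bigID P) /= e4.
by rewrite -/P in e2; lia.
Qed.
End EvenDotted.

Lemma even_dottedP m n t : even_dotted m n t <->
  [/\ valid_tangle m n t, rl t = [::], (forall p, p < m + n -> dots t p <= 1), capless m t
    & 4 %| n - m + \sum_(p <- iota 0 (m + n)) dots t p].
Proof.
rewrite /even_dotted /reduced_tangle; split.
  case/and4P=> v /andP[/eqP l0 /allP d1] /allP cl ev.
  have {}d1 p : p < m + n -> dots t p <= 1 by move=> pN; apply: d1; rewrite mem_iota.
  have {}cl : capless m t by move=> p pN; apply: cl; rewrite mem_iota.
  split=> //; have := even_mod4 (valid_matching v) cl d1; lia.
case=> v l0 d1 cl ev; apply/and4P; split=> //.
- by rewrite l0 eqxx; apply/allP => p; rewrite mem_iota => /andP[_ pN]; apply: d1.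
- by apply/allP => p; rewrite mem_iota => /andP[_ pN]; apply: cl.
- by have := even_mod4 (valid_matching v) cl d1; lia.
Qed.

Definition edgeless n t := forall p, p < n + n -> (mate t p < n) = (p < n).

Lemma undotted_cups_mod4 n t : matching (n + n) t -> edgeless n t ->
  (forall p, p < n + n -> dots t p <= 1) ->
  (n + \sum_(p <- iota 0 (n + n) | n <= p) dots t p) %% 4 = (2 * n_undotted_cups n n t) %% 4.
Proof.
move=> H el d1; have := @undotted_mod4 _ _ H (fun p => n <= p).
rewrite count_iota_ge ?addKn ?leq_addr // => -> //.
by move=> p pN; rewrite leqNgt el // -leqNgt.
Qed.

Lemma edgeless_even n t : matching (n + n) t -> edgeless n t -> ~~ odd n.
Proof.
move=> H el; have := @count_half _ _ H (fun p => n <= p).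
rewrite count_iota_ge ?addKn ?leq_addr // => -> //; first by rewrite oddM.
by move=> p pN; rewrite leqNgt el // -leqNgt.
Qed.

(** * Edges, seen from the top points which they join to the bottom *)

Definition defects (m n : nat) (t : raw) : seq nat :=
  [seq p <- iota 0 n | mate t (m + p) < m].

Lemma mem_defects m n t p : (p \in defects m n t) = (mate t (m + p) < m) && (p < n).
Proof. by rewrite mem_filter mem_iota. Qed.

Lemma defects_sorted m n t : sorted ltn (defects m n t).
Proof. by apply: sorted_filter; [exact: ltn_trans | exact: iota_ltn_sorted]. Qed.

Lemma defects_uniq m n t : uniq (defects m n t).
Proof. by rewrite filter_uniq ?iota_uniq. Qed.

Lemma nth_defects m n t i : i < size (defects m n t) ->
  mate t (m + nth 0 (defects m n t) i) < m /\ nth 0 (defects m n t) i < n.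
Proof. by move/(mem_nth 0); rewrite mem_defects => /andP. Qed.

Lemma nth_defects_lt m n t i j : i < size (defects m n t) -> j < size (defects m n t) ->
  (nth 0 (defects m n t) i < nth 0 (defects m n t) j) = (i < j).
Proof.
have mono a b : b < size (defects m n t) -> a < b ->
    nth 0 (defects m n t) a < nth 0 (defects m n t) b.
  move=> bs ab; apply: (sorted_ltn_nth ltn_trans) => //; first exact: defects_sorted.
  by rewrite inE; lia.
move=> i1 j1; have [ij|ji|->] := ltngtP i j; [exact: mono | | by rewrite ltnn].
by apply/negbTE; rewrite -leqNgt ltnW // mono.
Qed.

Lemma size_defects m n t :
  size (defects m n t) + count (fun p => m <= mate t (m + p)) (iota 0 n) = n.
Proof.
rewrite size_filter -[RHS](size_iota 0 n) -(count_predC (fun p => mate t (m + p) < m)).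
by congr addn; apply: eq_count => p /=; rewrite leqNgt.
Qed.

Section Edges.
Variables (m n : nat) (t : raw).
Hypothesis v : valid_tangle m n t.
Let H : matching (m + n) t := valid_matching v.

Lemma edges_lt p r : mate t (m + p) < m -> mate t (m + r) < m -> p < n -> r < n -> p < r ->
  mate t (m + p) < mate t (m + r).
Proof.
move=> hp hr pn rn pr; have [_ nc _] := (valid_tangleP m n t).1 v.
have pN : m + p < m + n by lia.
have rN : m + r < m + n by lia.
have := nc (mate t (m + r)) (mate t (m + p)) (mate_lt H rN) (mate_lt H pN).
rewrite !(mateK H) // !(bpos_bot _ hp) !(bpos_bot _ hr) !bpos_top ?leq_addr //.
have [|ne|] := ltngtP (mate t (m + p)) (mate t (m + r)) => //; first by lia.
by move=> e; have := mateK H pN; rewrite e (mateK H); lia.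
Qed.

(** Every edge cuts off whatever lies to its right from the left face, so only the leftmost edge can
    carry dots. *)
Lemma edges_exposed p r : mate t (m + p) < m -> mate t (m + r) < m -> p < n -> r < n -> p < r ->
  dots t (m + r) = 0.
Proof.
move=> hp hr pn rn pr; have [_ _ ex] := (valid_tangleP m n t).1 v.
have pN : m + p < m + n by lia.
have rN : m + r < m + n by lia.
have lt := edges_lt hp hr pn rn pr.
case: (posnP (dots t (m + r))) => // d0.
have := ex (m + r) (mate t (m + p)) rN (mate_lt H pN) d0.
rewrite !(mateK H) // !(bpos_bot _ hp) !(bpos_bot _ hr) !bpos_top ?leq_addr //; lia.
Qed.

(** Edges do not cross, so the bottom ends occur in increasing order, and equality of the sets of
    ends is equality of the lists. *)
Lemma map_mate_defects :
  [seq mate t (m + p) | p <- defects m n t] = [seq j <- iota 0 m | m <= mate t j].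
Proof.
apply: (irr_sorted_eq ltn_trans ltnn).
- apply: (homo_sorted_in (P := [pred p | p \in defects m n t])); last exact: defects_sorted.
    move=> p r; rewrite !inE !mem_defects => /andP[h1 h2] /andP[h3 h4].
    exact: edges_lt.
  by apply/allP => p.
- by apply: sorted_filter; [exact: ltn_trans | exact: iota_ltn_sorted].
move=> j; rewrite mem_filter mem_iota; apply/mapP/andP.
  case=> p; rewrite mem_defects => /andP[h pn] ->; rewrite (mateK H); last by lia.
  by rewrite leq_addr h.
case=> h /andP[_ jm]; have jN : j < m + n by lia.
have := mate_lt H jN; exists (mate t j - m); last by rewrite subnKC // (mateK H).
by rewrite mem_defects subnKC // (mateK H) // jm; lia.
Qed.

Lemma sum_head_defects :
  \sum_(p <- iota 0 n | p \in defects m n t) dots t (m + p) =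
  if defects m n t is x :: _ then dots t (m + x) else 0.
Proof.
have -> : \sum_(p <- iota 0 n | p \in defects m n t) dots t (m + p) =
    \sum_(p <- defects m n t) dots t (m + p).
  rewrite [RHS]big_filter big_seq_cond [RHS]big_seq_cond; apply: eq_bigl => p.
  by rewrite mem_defects mem_iota; lia.
have := defects_sorted m n t; have : {subset defects m n t <= defects m n t} by [].
case: {1 3 4 5}(defects m n t) => [|x s] sub; first by rewrite big_nil.
rewrite /= (path_sortedE ltn_trans) => /andP[/allP xs _].
rewrite big_cons big1_seq ?addn0 // => p /andP[_ ps].
have := sub x (mem_head _ _); have : p \in defects m n t by apply: sub; rewrite inE ps orbT.
rewrite !mem_defects => /andP[h1 h2] /andP[h3 h4].
exact: edges_exposed h3 h1 h4 h2 (xs _ ps).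
Qed.
End Edges.

Section Capless.
Variables (lam n : nat) (al : raw).
Hypothesis v : valid_tangle lam n al.
Hypothesis cl : capless lam al.
Let H : matching (lam + n) al := valid_matching v.

(** Without caps every bottom point ends an edge; by planarity the edges then join bottom points and
    defects in order, so a half tangle is given by its top. *)
Lemma map_defects_capless : [seq mate al (lam + p) | p <- defects lam n al] = iota 0 lam.
Proof.
rewrite map_mate_defects //; apply/all_filterP/allP => j.
by rewrite mem_iota => /andP[_ /cl].
Qed.

Lemma size_defects_capless : size (defects lam n al) = lam.
Proof. by have := congr1 size map_defects_capless; rewrite size_map size_iota. Qed.

Lemma mate_defect p : p \in defects lam n al -> mate al (lam + p) = index p (defects lam n al).
Proof.
move=> pD; have := index_mem p (defects lam n al); rewrite pD => ps.
have : nth 0 [seq mate al (lam + p) | p <- defects lam n al] (index p (defects lam n al)) =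
  index p (defects lam n al).
  by rewrite map_defects_capless nth_iota //; rewrite size_defects_capless in ps.
by rewrite (nth_map 0) // nth_index.
Qed.

Lemma mate_capless j : j < lam -> mate al j = lam + nth 0 (defects lam n al) j.
Proof.
move=> jl; have js : j < size (defects lam n al) by rewrite size_defects_capless.
have [h1 h2] := nth_defects js.
have : mate al (lam + nth 0 (defects lam n al) j) = j.
  by rewrite mate_defect ?mem_nth // index_uniq ?defects_uniq.
move=> {1}<-; rewrite (mateK H) //; lia.
Qed.

Lemma dots_capless j : 0 < j -> j < lam -> dots al j = 0.
Proof.
move=> j0 jl; have js : j < size (defects lam n al) by rewrite size_defects_capless.
have s0 : 0 < size (defects lam n al) by lia.
have jN : j < lam + n by lia.
have [h1 h2] := nth_defects js; have [h3 h4] := nth_defects s0.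
rewrite -(dots_mate H) // mate_capless //.
by apply: (edges_exposed v h3 h1); rewrite // nth_defects_lt.
Qed.

Lemma sum_dots_capless : \sum_(p <- iota 0 (lam + n)) dots al p =
  \sum_(p <- iota 0 n | p \notin defects lam n al) dots al (lam + p) +
  2 * (if 0 < lam then dots al 0 else 0).
Proof.
rewrite iotaD big_cat /= add0n -[in iota lam n](addn0 lam) iotaDl big_map.
rewrite [X in _ + X = _](bigID (mem (defects lam n al))) /= (sum_head_defects v).
have -> : \sum_(i <- iota 0 lam) dots al i = if 0 < lam then dots al 0 else 0.
  case: (posnP lam) => [-> | l0]; first by rewrite big_nil.
  have -> : iota 0 lam = 0 :: iota 1 lam.-1 by rewrite -{1}(prednK l0).
  rewrite big_cons big1_seq ?addn0 // => j.
  by rewrite mem_iota => /andP[_ jl]; apply: dots_capless; lia.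
have := size_defects_capless; have := @mate_capless 0.
case: (defects lam n al) => [|x s] /= mc sz; first by rewrite ifN; lia.
rewrite ifT; last by lia.
have l0 : 0 < lam by lia.
by rewrite -mc // (dots_mate H); lia.
Qed.
End Capless.

(** * Half tangles *)

(* The upper half of t: its cups together with one edge for each top point which t
   joins to the bottom; the dot on the leftmost edge is dictated by evenness. *)
Definition half_bit (m n : nat) (t : raw) : bool :=
  ~~ (4 %| n - size (defects m n t) +
       \sum_(p <- iota 0 n | p \notin defects m n t) odd (dots t (m + p))).

Definition upper_half (m n : nat) (t : raw) : raw :=
  let D := defects m n t in let lam := size D in
  tabulate (lam + n)
    (fun x => if x < lam then lam + nth 0 D x
              else if x - lam \in D then index (x - lam) D
              else lam + (mate t (m + (x - lam)) - m))
    (fun x => if x < lam then (x == 0) * half_bit m n t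
              else if x - lam \in D then (index (x - lam) D == 0) * half_bit m n t
              else odd (dots t (m + (x - lam)))) [::].

(** The cups of an even half tangle determine it: its edges are forced by planarity, only the
    leftmost one can be dotted, and evenness decides whether it is. *)
Lemma half_unique m n lam t al : even_dotted lam n al ->
  (forall p, p < n -> [/\ (mate t (m + p) < m) = (mate al (lam + p) < lam),
     lam <= mate al (lam + p) -> mate t (m + p) - m = mate al (lam + p) - lam &
     lam <= mate al (lam + p) -> odd (dots t (m + p)) = dots al (lam + p) :> nat]) ->
  upper_half m n t = al.
Proof.
move=> /even_dottedP[v l0 d1 cl ev] h.
have H := valid_matching v.
have eD : defects m n t = defects lam n al.
  by apply: eq_in_filter => p; rewrite mem_iota => /andP[_ /h[]].
have sD := size_defects_capless v cl.
(* The factor accounts for the case without edges, in which there is no place for the bit. *)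
have eb : half_bit m n t * (0 < lam) = if 0 < lam then dots al 0 else 0.
  rewrite /half_bit eD sD.
  have -> : \sum_(p <- iota 0 n | p \notin defects lam n al) odd (dots t (m + p)) =
      \sum_(p <- iota 0 n | p \notin defects lam n al) dots al (lam + p).
    rewrite big_seq_cond [RHS]big_seq_cond; apply: eq_bigr => p.
    rewrite mem_iota mem_defects => /andP[/andP[_ pn]]; rewrite pn andbT -leqNgt => hl.
    by have [_ _ ->] := h p pn.
  rewrite (sum_dots_capless v cl) in ev; move: ev.
  case: ifP => l1; rewrite ?muln0 //.
  have := d1 0; rewrite addn_gt0 l1 => /(_ isT); lia.
rewrite /upper_half eD sD.
apply: (@raw_ext (lam + n)); rewrite ?size_map ?size_iota ?(size_rm H) ?(size_rd H) //.
- move=> x xN; rewrite mate_tabulate //; case: (ltnP x lam) => xl.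
    by rewrite (mate_capless v cl).
  have xn : x - lam < n by lia.
  have [h1 h2 _] := h _ xn; rewrite subnKC // in h1 h2.
  case: ifP => xD; first by rewrite -(mate_defect v cl) // subnKC.
  have hl : lam <= mate al x by move: xD; rewrite mem_defects xn subnKC // andbT; lia.
  by rewrite h2 // subnKC.
- move=> x xN; rewrite dots_tabulate //; case: (ltnP x lam) => xl.
    case: eqP => [->|x0]; last by rewrite (dots_capless v cl) //; lia.
    by move: eb; rewrite mul1n (leq_trans _ xl) // muln1.
  have xn : x - lam < n by lia.
  have [h1 h2 h3] := h _ xn; rewrite subnKC // in h1 h2 h3.
  case: ifP => xD; last by apply: h3; move: xD; rewrite mem_defects xn subnKC // andbT; lia.
  have ix : index (x - lam) (defects lam n al) < lam.
    by rewrite -[X in _ < X]sD index_mem.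
  have mx := mate_defect v cl xD; rewrite subnKC // in mx.
  rewrite -(dots_mate H) // mx.
  case: eqP => [i0|x0]; last by rewrite (dots_capless v cl) //; lia.
  by move: eb ix; rewrite i0 mul1n => + l1; rewrite l1 muln1.
Qed.

Section Half.
Variables (m n : nat) (t : raw).
Hypothesis v : valid_tangle m n t.
Let H : matching (m + n) t := valid_matching v.
Local Notation D := (defects m n t).
Local Notation lam := (size D).
Local Notation h := (upper_half m n t).

Lemma mate_half_bot j : j < lam -> mate h j = lam + nth 0 D j.
Proof. by move=> jl; rewrite mate_tabulate ?jl //; lia. Qed.

Lemma mate_half_edge p : p \in D -> mate h (lam + p) = index p D.
Proof.
move=> pD; rewrite mate_tabulate; first by rewrite ltnNge leq_addr /= addKn pD.
by move: pD; rewrite mem_defects; lia.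
Qed.

Lemma mate_half_cup p : p < n -> p \notin D -> mate h (lam + p) = lam + (mate t (m + p) - m).
Proof.
move=> pn pD; rewrite mate_tabulate; last by lia.
by rewrite ltnNge leq_addr /= addKn (negPf pD).
Qed.

Lemma dots_half_bot j : j < lam -> dots h j = (j == 0) * half_bit m n t.
Proof. by move=> jl; rewrite dots_tabulate ?jl //; lia. Qed.

Lemma dots_half_edge p : p \in D -> dots h (lam + p) = (index p D == 0) * half_bit m n t.
Proof.
move=> pD; rewrite dots_tabulate; first by rewrite ltnNge leq_addr /= addKn pD.
by move: pD; rewrite mem_defects; lia.
Qed.

Lemma dots_half_cup p : p < n -> p \notin D -> dots h (lam + p) = odd (dots t (m + p)).
Proof.
move=> pn pD; rewrite dots_tabulate; last by lia.
by rewrite ltnNge leq_addr /= addKn (negPf pD).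
Qed.

Lemma notin_defects p : p < n -> p \notin D ->
  [/\ m <= mate t (m + p), mate t (m + p) - m < n & mate t (m + p) - m \notin D].
Proof.
move=> pn; rewrite !mem_defects pn andbT -leqNgt => h1.
have pN : m + p < m + n by lia.
have h2 := mate_lt H pN; split=> //; first by lia.
by rewrite subnKC // (mateK H) //; lia.
Qed.

Variant half_point (x : nat) : Prop :=
| HalfBot i of i < lam & x = i & mate h x = lam + nth 0 D i
| HalfEdge i of i < lam & x = lam + nth 0 D i & mate h x = i
| HalfCup p of p < n & p \notin D & x = lam + p & mate h x = lam + (mate t (m + p) - m).

Lemma half_pointP x : x < lam + n -> half_point x.
Proof.
move=> xN; case: (ltnP x lam) => xl; first by apply: (HalfBot xl); rewrite ?mate_half_bot.
have ex : x = lam + (x - lam) by lia.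
case: (boolP (x - lam \in D)) => xD.
  have il : index (x - lam) D < lam by rewrite index_mem.
  by apply: (HalfEdge il); rewrite ?nth_index // {1}ex mate_half_edge.
have xn : x - lam < n by lia.
by apply: (HalfCup xn xD) => //; rewrite {1}ex mate_half_cup.
Qed.

Lemma size_defects_le : lam <= n.
Proof. by have := size_defects m n t; lia. Qed.

Lemma matching_half : matching (lam + n) h.
Proof.
split; rewrite ?size_map ?size_iota //.
- move=> x /half_pointP[i il _ ->|i il _ ->|p pn pD _ ->]; try by lia.
    by have [] := nth_defects il; lia.
  by have [] := notin_defects pn pD; lia.
- move=> x /half_pointP[i il -> ->|i il -> ->|p pn pD -> ->]; try by lia.
  by have pN : m + p < m + n; [lia | have := mate_neq H pN; have [] := notin_defects pn pD; lia].
- move=> x /half_pointP[i il -> ->|i il -> ->|p pn pD -> ->].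
  + by rewrite mate_half_edge ?mem_nth // index_uniq // defects_uniq.
  + by rewrite mate_half_bot.
  + have [h1 h2 h3] := notin_defects pn pD.
    by rewrite mate_half_cup // subnKC // (mateK H) ?addKn //; lia.
- move=> x /half_pointP[i il -> ->|i il -> ->|p pn pD -> ->].
  + by rewrite dots_half_edge ?mem_nth // index_uniq // ?defects_uniq // dots_half_bot.
  + by rewrite dots_half_edge ?mem_nth // index_uniq // ?defects_uniq // dots_half_bot.
  + have [h1 h2 h3] := notin_defects pn pD.
    by rewrite !dots_half_cup // subnKC // (dots_mate H) //; lia.
Qed.

Lemma capless_half : capless lam h.
Proof. by move=> j jl; rewrite mate_half_bot // leq_addr. Qed.

(** The cups are those of [t], and the edges reach the bottom in the order of their top ends; two
    crossing arcs, or an arc hiding a dotted cup, would already occur in [t]. *)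
Lemma valid_half : valid_tangle lam n h.
Proof.
have [_ nc ex] := (valid_tangleP m n t).1 v.
apply/valid_tangleP; split; first exact: matching_half.
- { move=> x y xN yN.
  have [i il ex1 ->|i il ex1 ->|p pn pD ex1 ->] := half_pointP xN;
  have [j jl ey ->|j jl ey ->|r rn rD ey ->] := half_pointP yN.
  all: try have [i1 i2] := nth_defects il.
  all: try have [j1 j2] := nth_defects jl.
  all: try have := nth_defects_lt il jl.
  all: try have [p1 p2 p3] := notin_defects pn pD.
  all: try have [r1 r2 r3] := notin_defects rn rD.
  all: subst x y; rewrite ?(bpos_bot _ il) ?(bpos_bot _ jl) ?bpos_top ?leq_addr //; try by [lia].
  + have rN : m + r < m + n by lia.
    have iN : m + nth 0 D i < m + n by lia.
    have := nc (m + r) (m + nth 0 D i) rN iN.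
    have := nc (mate t (m + nth 0 D i)) (m + r) (mate_lt H iN) rN.
    by rewrite !(mateK H) // !(bpos_bot _ i1) !bpos_top ?leq_addr //; lia.
  + have rN : m + r < m + n by lia.
    have pN : m + p < m + n by lia.
    have := nc (m + p) (m + r) pN rN.
    have pM := mate_lt H pN; have rM := mate_lt H rN.
    by rewrite !bpos_lt_top ?leq_addr ?ltn_add2l //; lia. }
- move=> x y xN yN.
  have bit0 i : 0 < (i == 0) * half_bit m n t -> i = 0 by case: i.
  have [i il ex1 emx|i il ex1 emx|p pn pD ex1 emx] := half_pointP xN.
  + rewrite emx ex1 dots_half_bot // => /bit0 i0; subst i.
    by rewrite !(bpos_bot _ il) ?andbF /=; lia.
  + rewrite emx ex1 dots_half_edge ?mem_nth // index_uniq ?defects_uniq // => /bit0 i0; subst i.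
    by rewrite !(bpos_bot _ il) ?andbF /=; lia.
  have [p1 p2 p3] := notin_defects pn pD.
  have pN : m + p < m + n by lia.
  rewrite emx ex1 dots_half_cup // => d0; have {}d0 : 0 < dots t (m + p) by case: (dots t _) d0.
  have [j jl -> ->|j jl -> ->|r rn rD -> ->] := half_pointP yN.
  + have [j1 j2] := nth_defects jl.
    have jN : m + nth 0 D j < m + n by lia.
    have := ex (m + p) (mate t (m + nth 0 D j)) pN (mate_lt H jN) d0.
    rewrite !(mateK H) // !(bpos_bot _ j1) !(bpos_bot _ jl) !bpos_top ?leq_addr //.
    by lia.
  + by rewrite !(bpos_bot _ jl) !bpos_top ?leq_addr //; lia.
  + have [r1 r2 r3] := notin_defects rn rD.
    have rN : m + r < m + n by lia.
    have := ex (m + p) (m + r) pN rN d0.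
    have pM := mate_lt H pN; have rM := mate_lt H rN.
    by rewrite !bpos_lt_top ?leq_addr ?ltn_add2l //; lia.
Qed.

(** Both ends of a cup contribute the same, so the sums are even. One dot on an edge is stored twice
    and shifts the total by 2, which suffices to reach divisibility by 4. *)
Lemma half_sum_even :
  ~~ odd (n - lam) /\ ~~ odd (n - lam + \sum_(p <- iota 0 n | p \notin D) odd (dots t (m + p))).
Proof.
have Hp := matching_parity H.
pose P p := (m <= p) && (m <= mate t p).
have clP p : p < m + n -> P (mate (parity t) p) = P p.
  by move=> pN; rewrite mate_parity /P (mateK H) // andbC.
have h1 := count_half Hp clP.
have h2 := undotted_mod4 Hp clP.
have PD p : p < n -> P (m + p) = (p \notin D).
  by move=> pn; rewrite /P leq_addr mem_defects pn andbT -leqNgt.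
have PF p : p < m -> P p = false by rewrite /P; lia.
have e1 : count P (iota 0 (m + n)) = n - lam.
  rewrite iotaD count_cat add0n -[in iota m n](addn0 m) iotaDl count_map.
  rewrite (@eq_in_count _ _ pred0) ?count_pred0; last by move=> p; rewrite mem_iota => /PF.
  have := size_defects m n t; rewrite add0n.
  have -> : count (fun p => m <= mate t (m + p)) (iota 0 n) = count (preim (addn m) P) (iota 0 n).
    by apply: eq_count => p; rewrite /= /P leq_addr.
  by lia.
have e2 : \sum_(p <- iota 0 (m + n) | P p) dots (parity t) p =
    \sum_(p <- iota 0 n | p \notin D) odd (dots t (m + p)).
  rewrite iotaD big_cat /= add0n -[in iota m n](addn0 m) iotaDl big_map.
  rewrite big_seq_cond big1 ?add0n; last first.
    by move=> p; rewrite mem_iota => /andP[/PF ->].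
  rewrite big_seq_cond [RHS]big_seq_cond; apply: eq_big => [p|p _]; last by rewrite dots_parity.
  by rewrite mem_iota /= add0n; case: (ltnP p n) => //= /PD.
have d1 p : p < m + n -> dots (parity t) p <= 1 by rewrite dots_parity; case: (odd _).
by have := h2 d1; rewrite h1 e2 -h1 e1; move: h1; rewrite e1; lia.
Qed.

(** With an edge present its dot corrects the parity. Without edges nothing can be corrected, and
    the second alternative demands that the cups be even already. *)
Lemma even_half : (0 < lam) || (4 %| n + \sum_(p <- iota 0 n) odd (dots t (m + p))) ->
  even_dotted lam n h.
Proof.
move=> hl; apply/even_dottedP.
have vh := valid_half; have ch := capless_half.
have eD : defects lam n h = D.
  apply: eq_in_filter => p; rewrite mem_iota => /andP[_ pn].
  case: (boolP (p \in D)) => pD; last first.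
    rewrite mate_half_cup // ltnNge leq_addr; symmetry; apply/negbTE.
    by rewrite -leqNgt; case: (notin_defects pn pD).
  by rewrite mate_half_edge // index_mem pD; move: pD; rewrite mem_defects => /andP[-> _].
split=> //.
- by move=> x xN; rewrite dots_tabulate //; do ![case: ifP => _]; rewrite ?mulnb leq_b1.
rewrite (sum_dots_capless vh ch) eD.
have -> : \sum_(p <- iota 0 n | p \notin D) dots h (lam + p) =
    \sum_(p <- iota 0 n | p \notin D) odd (dots t (m + p)).
  rewrite big_seq_cond [RHS]big_seq_cond; apply: eq_bigr => p.
  by rewrite mem_iota => /andP[/andP[_ pn] pD]; rewrite dots_half_cup.
have [h1 h2] := half_sum_even.
case: (posnP lam) hl => [l0|l0] /= hl.
  move: hl; rewrite l0 muln0 addn0 subn0.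
  have -> // : \sum_(p <- iota 0 n) odd (dots t (m + p)) =
     \sum_(p <- iota 0 n | p \notin D) odd (dots t (m + p)).
  by rewrite (size0nil l0).
rewrite dots_half_bot // mul1n /half_bit; move: h2; set s := _ + \sum_(p <- _ | _) _ => h2.
rewrite addnA -/s; clearbody s.
by case: (boolP (4 %| s)) => h3 /=; clear -h2 h3; lia.
Qed.
End Half.

(** * The diagrams C *)

Definition cell (n lam : nat) (al be : raw) : raw := concat n lam n (rstar lam n be) al.

Section Cell.
Variables (n lam : nat) (al be : raw).
Hypotheses (Ha : matching (lam + n) al) (Hb : matching (lam + n) be).
Hypotheses (ca : capless lam al) (cb : capless lam be).

Lemma mate_refl p : p < n -> mate (rstar lam n be) p =
  if mate be (lam + p) < lam then n + mate be (lam + p) else mate be (lam + p) - lam.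
Proof.
move=> pn; rewrite mate_rstar; last by lia.
by rewrite /flip pn.
Qed.

Lemma dots_refl p : p < n -> dots (rstar lam n be) p = dots be (lam + p).
Proof. by move=> pn; rewrite dots_rstar ?/flip ?pn //; lia. Qed.

Lemma mate_refl_top j : j < lam -> mate (rstar lam n be) (n + j) = mate be j - lam.
Proof.
move=> jl; have h := cb jl; rewrite mate_rstar; last by lia.
by rewrite /flip ifN ?addKn ?ifN //; lia.
Qed.

Lemma dots_refl_top j : j < lam -> dots (rstar lam n be) (n + j) = dots be j.
Proof. by move=> jl; rewrite dots_rstar ?/flip ?ifN ?addKn //; lia. Qed.

(** Neither half has arcs returning to the interface, so a path crosses it at most once: an edge of
    one half is continued by a single edge of the other, and no loop arises. This gives a closed
    formula for the concatenation. *)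
Definition cell_mate p :=
  if p < n then
    if mate be (lam + p) < lam then n + (mate al (mate be (lam + p)) - lam)
    else mate be (lam + p) - lam
  else
    if mate al (lam + (p - n)) < lam then mate be (mate al (lam + (p - n))) - lam
    else n + (mate al (lam + (p - n)) - lam).

Definition cell_dots p :=
  if p < n then
    if mate be (lam + p) < lam then dots be (lam + p) + dots al (mate be (lam + p))
    else dots be (lam + p)
  else
    if mate al (lam + (p - n)) < lam then dots al (lam + (p - n)) + dots be (mate al (lam + (p - n)))
    else dots al (lam + (p - n)).

Lemma cstart_cell p : p < n + n ->
  cstart n lam n (rstar lam n be) al p = Some (cell_mate p, cell_dots p).
Proof.
move=> pN; rewrite cstartE /cell_mate /cell_dots.
have -> : (n + lam + n).+1 = (n + lam + n).-2.+3 by lia.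
rewrite /outer_state; case: (ltnP p n) => h; rewrite [_.1]/= [_.2]/=.
  have pl : lam + p < lam + n by lia.
  have mN := mate_lt Hb pl.
  rewrite walk_true mate_refl // dots_refl //.
  case: (ltnP (mate be (lam + p)) lam) => h2; last by rewrite ifT //; lia.
  have h3 := ca h2; rewrite ltnNge leq_addr /= addKn -/(mate _ _) -/(dots _ _).
  by rewrite h3 add0n.
have pl : lam + (p - n) < lam + n by lia.
have mN := mate_lt Ha pl.
rewrite walk_false.
case: (ltnP (mate al (lam + (p - n))) lam) => h2 //.
have h3 := cb h2; rewrite walk_true mate_refl_top // dots_refl_top // add0n ifT //.
by have := mate_lt Hb (ltn_addr n h2); lia.
Qed.

Lemma cellE : cell n lam al be =
  tabulate (n + n) cell_mate cell_dots (sort leq (rl be ++ rl al)).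
Proof.
apply: (@raw_ext (n + n)); rewrite ?size_map ?size_iota //.
- by move=> p pN; rewrite [LHS]mate_tabulate // cstart_cell // mate_tabulate.
- by move=> p pN; rewrite [LHS]dots_tabulate // cstart_cell // dots_tabulate.
rewrite /cell /concat /rl /=; congr (sort leq (_ ++ _)).
have -> : new_loops n lam n (rstar lam n be) al = [::]; last by rewrite cats0.
rewrite /new_loops.
have -> // : [seq j <- iota 0 lam | on_loop n lam n (rstar lam n be) al j &
    all (leq j) (loop_at n lam n (rstar lam n be) al j).1] = [::].
apply/eqP; rewrite -(negbK (_ == _)) -has_filter; apply/hasPn => j.
by rewrite mem_iota => /andP[_ /ca h]; rewrite /on_loop /fuel walk_false h.
Qed.

Lemma mate_cell p : p < n + n -> mate (cell n lam al be) p = cell_mate p.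
Proof. by move=> pN; rewrite cellE mate_tabulate. Qed.

Lemma dots_cell p : p < n + n -> dots (cell n lam al be) p = cell_dots p.
Proof. by move=> pN; rewrite cellE dots_tabulate. Qed.

Lemma rl_cell : rl (cell n lam al be) = sort leq (rl be ++ rl al).
Proof. by rewrite cellE. Qed.

Lemma matching_cell : matching (n + n) (cell n lam al be).
Proof.
have lt p : p < n + n -> cell_mate p < n + n.
  move=> pN; rewrite /cell_mate; case: (ltnP p n) => h.
    have pl : lam + p < lam + n by lia.
    have := mate_lt Hb pl; case: (ltnP (mate be _) lam) => h2; last by lia.
    by have := mate_lt Ha (ltn_addr n h2); lia.
  have pl : lam + (p - n) < lam + n by lia.
  have := mate_lt Ha pl; case: (ltnP (mate al _) lam) => h2; last by lia.
  by have := mate_lt Hb (ltn_addr n h2); lia.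
have inv p : p < n + n -> [/\ cell_mate p <> p, cell_mate (cell_mate p) = p
    & cell_dots (cell_mate p) = cell_dots p].
  move=> pN; rewrite [cell_mate p]/cell_mate [cell_dots p]/cell_dots; case: (ltnP p n) => h.
    have pl : lam + p < lam + n by lia.
    have mN := mate_lt Hb pl; have nb := mate_neq Hb pl.
    have Kb := mateK Hb pl; have Db := dots_mate Hb pl.
    case: (ltnP (mate be _) lam) => h2.
      have ml : mate be (lam + p) < lam + n by lia.
      have h3 := ca h2; have Ka := mateK Ha ml; have Da := dots_mate Ha ml.
      have maN := mate_lt Ha ml.
      have e1 : (n + (mate al (mate be (lam + p)) - lam) < n) = false by lia.
      split; first by lia.
        by rewrite /cell_mate e1 addKn subnKC // Ka h2 Kb; lia.
      by rewrite /cell_dots e1 addKn subnKC // Ka h2 Da Db addnC.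
    have e1 : (mate be (lam + p) - lam < n) by lia.
    have e2 : lam + (mate be (lam + p) - lam) = mate be (lam + p) by lia.
    have e3 : (lam + p < lam) = false by lia.
    by split; rewrite /cell_mate /cell_dots ?e1 ?e2 ?Kb ?e3 ?addKn //; lia.
  have pl : lam + (p - n) < lam + n by lia.
  have mN := mate_lt Ha pl; have na := mate_neq Ha pl.
  have Ka := mateK Ha pl; have Da := dots_mate Ha pl.
  case: (ltnP (mate al _) lam) => h2.
    have ml : mate al (lam + (p - n)) < lam + n by lia.
    have h3 := cb h2; have Kb := mateK Hb ml; have Db := dots_mate Hb ml.
    have mbN := mate_lt Hb ml.
    have e1 : (mate be (mate al (lam + (p - n))) - lam < n) by lia.
    split; first by lia.
      by rewrite /cell_mate e1 subnKC // Kb h2 Ka; lia.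
    by rewrite /cell_dots e1 subnKC // Kb h2 Da Db addnC.
  have e1 : (n + (mate al (lam + (p - n)) - lam) < n) = false by lia.
  have e2 : lam + (n + (mate al (lam + (p - n)) - lam) - n) = mate al (lam + (p - n)) by lia.
  have e3 : (lam + (p - n) < lam) = false by lia.
  by split; rewrite /cell_mate /cell_dots ?e1 ?e2 ?Ka ?e3 ?addKn //; lia.
split; rewrite ?size_map ?size_iota //.
- by move=> p pN; rewrite mate_cell // lt.
- by move=> p pN; rewrite mate_cell //; case: (inv p pN).
- by move=> p pN; rewrite (mate_cell pN) mate_cell ?lt //; case: (inv p pN).
- by move=> p pN; rewrite (mate_cell pN) !dots_cell ?lt //; case: (inv p pN).
- by rewrite rl_cell.
Qed.
End Cell.

Lemma rstar_cell n lam al be : matching (lam + n) al -> matching (lam + n) be ->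
  capless lam al -> capless lam be -> rstar n n (cell n lam al be) = cell n lam be al.
Proof.
move=> Ha Hb ca cb.
have Hc := matching_cell Ha Hb ca cb; have Hd := matching_cell Hb Ha cb ca.
have flE p : p < n + n -> flip n n p = if p < n then n + p else p - n by [].
apply: (@raw_ext (n + n)); rewrite ?size_map ?size_iota ?(size_rm Hd) ?(size_rd Hd) //.
- move=> p pN; rewrite mate_rstar // !mate_cell ?flip_lt // /cell_mate /flip.
  case: (ltnP p n) => h.
    have -> : (n + p < n) = false by lia.
    rewrite addKn; have pl : lam + p < lam + n by lia.
    have := mate_lt Ha pl; case: (ltnP (mate al _) lam) => h2.
      by have := mate_lt Hb (ltn_addr n h2); have := cb _ h2; case: ifP; lia.
    by case: ifP; lia.
  have -> : (p - n < n) by lia.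
  have pl : lam + (p - n) < lam + n by lia.
  have := mate_lt Hb pl; case: (ltnP (mate be _) lam) => h2.
    by have := mate_lt Ha (ltn_addr n h2); have := ca _ h2; case: ifP; lia.
  by case: ifP; lia.
- move=> p pN; rewrite dots_rstar // !dots_cell ?flip_lt // /cell_dots /flip.
  case: (ltnP p n) => h.
    by have -> : (n + p < n) = false by [lia]; rewrite addKn.
  by have -> : (p - n < n) by lia.
- have -> : rl (rstar n n (cell n lam al be)) = rl (cell n lam al be) by [].
  by rewrite !rl_cell //; apply: sort_leq_eq; rewrite perm_catC.
Qed.

Lemma parity_cell n lam al al' be be' : matching (lam + n) al -> matching (lam + n) be ->
  matching (lam + n) al' -> matching (lam + n) be' ->
  capless lam al -> capless lam be -> parity al = parity al' -> parity be = parity be' ->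
  parity (cell n lam al be) = parity (cell n lam al' be').
Proof.
move=> Ha Hb Ha' Hb' ca cb ea eb.
have ma p : mate al p = mate al' p by rewrite -mate_parity ea.
have mb p : mate be p = mate be' p by rewrite -mate_parity eb.
have da p : odd (dots al p) = odd (dots al' p).
  by apply: (can_inj oddb); rewrite -!dots_parity ea.
have db p : odd (dots be p) = odd (dots be' p).
  by apply: (can_inj oddb); rewrite -!dots_parity eb.
have ca' : capless lam al' by move=> j /ca; rewrite ma.
have cb' : capless lam be' by move=> j /cb; rewrite mb.
apply: (@raw_ext (n + n)); rewrite /= ?size_map ?size_iota //.
- by move=> p pN; rewrite !mate_parity !mate_cell // /cell_mate !(ma, mb).
- move=> p pN; rewrite !dots_parity !dots_cell // /cell_dots !(ma, mb).
  by congr nat_of_bool; do ![case: ifP => _]; rewrite ?oddD ?da ?db.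
Qed.

(** * Splitting a reduced diagram into two even half tangles, and its uniqueness *)

Lemma odd_dots_reduced t p : parity t = t -> odd (dots t p) = dots t p :> nat.
Proof. by move=> e; rewrite -dots_parity e. Qed.

Lemma sum_iota_halves n (F : nat -> nat) : \sum_(p <- iota 0 (n + n)) F p =
  \sum_(p <- iota 0 n) F p + \sum_(p <- iota 0 n) F (n + p).
Proof.
have e : iota n n = map (addn n) (iota 0 n) by rewrite -iotaDl addn0.
by rewrite iotaD big_cat /= add0n e big_map.
Qed.

Lemma mate_rstar_top n t p : p < n -> mate (rstar n n t) (n + p) = flip n n (mate t p).
Proof.
move=> pn; rewrite mate_rstar; last by lia.
by rewrite {2}/flip ifN ?addKn //; lia.
Qed.

Lemma dots_rstar_top n t p : p < n -> dots (rstar n n t) (n + p) = dots t p.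
Proof.
move=> pn; rewrite dots_rstar; last by lia.
by rewrite /flip ifN ?addKn //; lia.
Qed.

Section Decomposition.
Variables (n : nat) (t : raw).
Hypotheses (v : valid_tangle n n t) (red : parity t = t).
Hypothesis ev : 4 %| \sum_(p <- iota 0 (n + n)) dots t p.
Let H : matching (n + n) t := valid_matching v.
Let vr : valid_tangle n n (rstar n n t) := valid_rstar v.
Local Notation Dt := (defects n n t).
Local Notation Db := (defects n n (rstar n n t)).
Local Notation lam := (size Dt).

Lemma map_mate_defects_bot : [seq mate t (n + p) | p <- Dt] = Db.
Proof.
rewrite map_mate_defects //; apply: eq_in_filter => p; rewrite mem_iota => /andP[_ pn].
rewrite mate_rstar_top // /flip.
have pN : p < n + n by lia.
by have := mate_lt H pN; case: (ltnP (mate t p) n) => /= h; lia.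
Qed.

Lemma size_defects_bot : size Db = lam.
Proof. by rewrite -map_mate_defects_bot size_map. Qed.

Lemma nth_defects_bot r : r < lam ->
  nth 0 Db r = mate t (n + nth 0 Dt r) /\ mate t (nth 0 Db r) = n + nth 0 Dt r.
Proof.
move=> rl; have e : nth 0 Db r = mate t (n + nth 0 Dt r).
  by rewrite -map_mate_defects_bot (nth_map 0).
by rewrite e (mateK H) //; have [] := nth_defects rl; lia.
Qed.

Lemma odd_dots_id (D : seq nat) (F : nat -> nat) :
  \sum_(p <- iota 0 n | p \notin D) odd (dots t (F p)) = \sum_(p <- iota 0 n | p \notin D) dots t (F p).
Proof. by apply: eq_bigr => p _; rewrite odd_dots_reduced. Qed.

Lemma sum_nodefects_top : \sum_(p <- iota 0 n) dots t (n + p) =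
  (if 0 < lam then dots t (nth 0 Db 0) else 0) + \sum_(p <- iota 0 n | p \notin Dt) odd (dots t (n + p)).
Proof.
rewrite (bigID (mem Dt)) /= (sum_head_defects v) odd_dots_id; congr addn.
case: (posnP lam) => [/size0nil-> //|l0].
have [-> _] := nth_defects_bot l0; have [_ xn] := nth_defects l0.
rewrite (dots_mate H) ?ltn_add2l //; by case: Dt l0.
Qed.

Lemma sum_nodefects_bot : \sum_(p <- iota 0 n) dots t p =
  (if 0 < lam then dots t (nth 0 Db 0) else 0) +
  \sum_(p <- iota 0 n | p \notin Db) odd (dots (rstar n n t) (n + p)).
Proof.
have e (P : pred nat) : \sum_(p <- iota 0 n | P p) dots t p =
    \sum_(p <- iota 0 n | P p) dots (rstar n n t) (n + p).
  rewrite big_seq_cond [RHS]big_seq_cond; apply: eq_bigr => p.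
  by rewrite mem_iota => /andP[/andP[_ pn] _]; rewrite dots_rstar_top.
rewrite (bigID (mem Db)) /= e (sum_head_defects vr) e; congr addn; last first.
  rewrite big_seq_cond [RHS]big_seq_cond; apply: eq_bigr => p.
  by rewrite mem_iota => /andP[/andP[_ pn] _]; rewrite dots_rstar_top // odd_dots_reduced.
rewrite -size_defects_bot; have := @nth_defects n n (rstar n n t) 0.
by case: Db => //= x s /(_ isT)[_ xn]; rewrite dots_rstar_top.
Qed.

Local Notation al := (upper_half n n t).
Local Notation be := (upper_half n n (rstar n n t)).

(** Let a = n - [lam], let x and y be the dot sums over the cups of the two halves and d the dot of
    the leftmost edge. As a is even and 4 divides x + y + 2d, the numbers a + x and a + y add up to
    2d modulo 4; each is even, and equals twice its half bit modulo 4. Hence the two bits add up to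
    d modulo 2. *)
Lemma edge_dots r : r < lam ->
  odd ((r == 0) * half_bit n n (rstar n n t) + (r == 0) * half_bit n n t) =
  dots t (nth 0 Db r) :> nat.
Proof.
move=> rl; have rb : r < size Db by rewrite size_defects_bot.
have [h1 h2] := nth_defects rb.
case: (posnP r) => [r0|r0]; last first.
  have l0 : 0 < size Db by lia.
  have [h3 h4] := nth_defects l0.
  by rewrite -(dots_rstar_top t h2) (edges_exposed vr h3 h1) ?nth_defects_lt.
subst r; rewrite !mul1n /half_bit size_defects_bot.
have := half_sum_even vr; rewrite size_defects_bot; have := half_sum_even v.
have := ev; rewrite sum_iota_halves sum_nodefects_top sum_nodefects_bot rl.
have := odd_dots_reduced (nth 0 Db 0) red.
set a := n - lam; set x := \sum_(p <- _ | _) odd (dots (rstar n n t) _).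
set y := \sum_(p <- _ | _) odd _; set d := dots t _.
clearbody a x y d; move=> dd e4 [e1 e2] [_ e3].
case: (boolP (4 %| a + x)) => e5; case: (boolP (4 %| a + y)) => e6; clear -dd e1 e2 e3 e4 e5 e6.
all: by rewrite -dd; case: (odd d) dd => /= dd; lia.
Qed.

Lemma even_halves : (0 < lam) || (4 %| n + \sum_(p <- iota 0 n) dots t (n + p)) ->
  even_dotted lam n al /\ even_dotted lam n be.
Proof.
move=> hl; split.
  apply: (even_half v); case/orP: hl => [-> //|hl]; apply/orP; right.
  by rewrite (eq_bigr (fun p => dots t (n + p))) // => p _; rewrite odd_dots_reduced.
rewrite -size_defects_bot; apply: (even_half vr); rewrite size_defects_bot.
case: (posnP lam) hl => //= l0 hl.
have -> : \sum_(p <- iota 0 n) odd (dots (rstar n n t) (n + p)) = \sum_(p <- iota 0 n) dots t p.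
  rewrite big_seq [RHS]big_seq; apply: eq_bigr => p.
  by rewrite mem_iota => /andP[_ pn]; rewrite dots_rstar_top // odd_dots_reduced.
(* Without edges [n] is even, and since the total is divisible by 4 the condition on the top half
   passes to the bottom half. *)
have [] := half_sum_even v; rewrite l0 subn0.
by move: ev; rewrite sum_iota_halves; lia.
Qed.

Lemma cell_halves : parity (cell n lam al be) = t.
Proof.
have mb := matching_half vr; rewrite size_defects_bot in mb.
have cb := @capless_half n n (rstar n n t); rewrite size_defects_bot in cb.
have ma := matching_half v; have ca := @capless_half n n t.
have mbc p : p < n -> p \notin Db -> mate be (lam + p) = lam + (mate (rstar n n t) (n + p) - n).
  by move=> pn pD; rewrite -size_defects_bot mate_half_cup.
have mbe p : p \in Db -> mate be (lam + p) = index p Db.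
  by move=> pD; rewrite -size_defects_bot mate_half_edge.
have mbb j : j < lam -> mate be j = lam + nth 0 Db j.
  by rewrite -size_defects_bot; apply: mate_half_bot.
have dbc p : p < n -> p \notin Db -> dots be (lam + p) = dots t p.
  move=> pn pD; rewrite -size_defects_bot dots_half_cup // dots_rstar_top //.
  exact: odd_dots_reduced.
have dbe p : p \in Db -> dots be (lam + p) = (index p Db == 0) * half_bit n n (rstar n n t).
  by move=> pD; rewrite -size_defects_bot dots_half_edge.
have dbb j : j < lam -> dots be j = (j == 0) * half_bit n n (rstar n n t).
  by rewrite -size_defects_bot; apply: dots_half_bot.
apply: (@raw_ext (n + n)); rewrite /= ?size_map ?size_iota ?(size_rm H) ?(size_rd H) //.
- move=> p pN; rewrite mate_parity mate_cell // /cell_mate; case: (ltnP p n) => pn.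
    case: (boolP (p \in Db)) => pD.
      have il : index p Db < lam by rewrite -size_defects_bot index_mem.
      rewrite mbe // il mate_half_bot // addKn.
      by have [_] := nth_defects_bot il; rewrite nth_index.
    rewrite mbc // ltnNge leq_addr addKn.
    rewrite mate_rstar_top //; move: pD; rewrite mem_defects pn andbT mate_rstar_top // /flip.
    by have := mate_lt H pN; case: (ltnP (mate t p) n) => /= *; lia.
  have qn : p - n < n by lia.
  case: (boolP (p - n \in Dt)) => pD.
    have il : index (p - n) Dt < lam by rewrite index_mem.
    rewrite mate_half_edge // il mbb // addKn.
    by have [-> _] := nth_defects_bot il; rewrite nth_index // subnKC.
  have [h1 h2 h3] := notin_defects v qn pD.
  rewrite subnKC // in h1.
  by rewrite mate_half_cup // ltnNge leq_addr addKn /= subnKC // subnKC.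
- move=> p pN; rewrite dots_parity dots_cell // /cell_dots; case: (ltnP p n) => pn.
    case: (boolP (p \in Db)) => pD.
      have il : index p Db < lam by rewrite -size_defects_bot index_mem.
      by rewrite mbe // dbe // il dots_half_bot // edge_dots // nth_index.
    by rewrite mbc // ltnNge leq_addr dbc // odd_dots_reduced.
  have qn : p - n < n by lia.
  case: (boolP (p - n \in Dt)) => pD.
    have il : index (p - n) Dt < lam by rewrite index_mem.
    rewrite mate_half_edge // il dots_half_edge // dbb // addnC edge_dots //.
    by have [-> _] := nth_defects_bot il; rewrite nth_index // subnKC // (dots_mate H).
  rewrite mate_half_cup // ltnNge leq_addr dots_half_cup // subnKC //.
  by rewrite oddb odd_dots_reduced.
- by rewrite -red.
Qed.
End Decomposition.

Section CellHalf.
Variables (n lam : nat) (al be : raw).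
Hypotheses (Ma : even_dotted lam n al) (Mb : even_dotted lam n be).

Lemma even_dotted_matching a : even_dotted lam n a -> matching (lam + n) a /\ capless lam a.
Proof. by case/even_dottedP=> v _ _ cl _; split=> //; exact: valid_matching. Qed.

Lemma defects_cell : defects n n (parity (cell n lam al be)) = defects lam n al.
Proof.
have [Ha ca] := even_dotted_matching Ma; have [Hb cb] := even_dotted_matching Mb.
apply: eq_in_filter => p; rewrite mem_iota => /andP[_ pn].
rewrite mate_parity mate_cell ?ltn_add2l // /cell_mate addKn [n + p < n]ltnNge leq_addr /=.
have pN : lam + p < lam + n by lia.
have := mate_lt Ha pN; case: (ltnP (mate al _) lam) => h; last by lia.
by have := mate_lt Hb (ltn_addr n h); lia.
Qed.

Lemma half_cell : upper_half n n (parity (cell n lam al be)) = al.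
Proof.
have [Ha ca] := even_dotted_matching Ma; have [Hb cb] := even_dotted_matching Mb.
apply: (half_unique Ma) => p pn.
have pN : lam + p < lam + n by lia.
have maN := mate_lt Ha pN.
rewrite mate_parity dots_parity mate_cell ?dots_cell ?ltn_add2l // /cell_mate /cell_dots.
rewrite addKn [n + p < n]ltnNge leq_addr /=.
have [_ _ d1 _ _] := (even_dottedP lam n al).1 Ma.
case: (ltnP (mate al _) lam) => h.
  by have := mate_lt Hb (ltn_addr n h); split; lia.
split; try lia.
by move=> _; have := d1 _ pN; case: (dots al _) => [|[]].
Qed.
End CellHalf.

(** The upper half of the diagram is [al], and the upper half of its reflection is [be]; the number
    of edges is read off from the defects. *)
Lemma cell_inj n lam lam' al be al' be' :
  even_dotted lam n al -> even_dotted lam n be -> even_dotted lam' n al' -> even_dotted lam' n be' ->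
  parity (cell n lam al be) = parity (cell n lam' al' be') -> (lam, al, be) = (lam', al', be').
Proof.
move=> Ma Mb Ma' Mb' e.
have [Ha ca] := even_dotted_matching Ma; have [Hb cb] := even_dotted_matching Mb.
have [Ha' ca'] := even_dotted_matching Ma'; have [Hb' cb'] := even_dotted_matching Mb'.
have sz l a : even_dotted l n a -> size (defects l n a) = l.
  by case/even_dottedP => v _ _ cl _; exact: size_defects_capless.
have el : lam = lam'.
  rewrite -(sz _ _ Ma) -(sz _ _ Ma') -(defects_cell Ma Mb) e.
  by rewrite (defects_cell Ma' Mb').
subst lam'.
have ea : al = al' by rewrite -(half_cell Ma Mb) e half_cell.
have e2 : parity (cell n lam be al) = parity (cell n lam be' al').
  by rewrite -(rstar_cell Ha Hb) // parity_rstar e -parity_rstar rstar_cell.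
have eb : be = be' by rewrite -(half_cell Mb Ma) e2 half_cell.
by rewrite ea eb.
Qed.

(** * The dot sum modulo 4 and the extra subspace for even n *)

Lemma sum_half N t (P : pred nat) (f : nat -> nat) : matching N t ->
  (forall p, p < N -> P (mate t p) = P p) -> (forall p, p < N -> f (mate t p) = f p) ->
  ~~ odd (\sum_(p <- iota 0 N | P p) f p).
Proof.
move=> H cl clf.
have -> : \sum_(p <- iota 0 N | P p) f p = \sum_(p <- iota 0 N | P p && (p < mate t p)) f p +
    \sum_(p <- iota 0 N | P p && (mate t p < p)) f p.
  rewrite (bigID (fun p => p < mate t p)) /=; congr addn.
  rewrite big_seq_cond [RHS]big_seq_cond; apply: eq_bigl => p; rewrite mem_iota add0n /=.
  by case: (ltnP p N) => //= pN; case: (P p) => //=; have := mate_neq H pN; lia.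
have -> : \sum_(p <- iota 0 N | P p && (mate t p < p)) f p =
    \sum_(p <- iota 0 N | P p && (p < mate t p)) f p.
  rewrite -(perm_big _ (perm_map_mate H)) big_map big_seq_cond [RHS]big_seq_cond.
  apply: eq_big => [p|p]; rewrite mem_iota add0n /=.
    by case: (ltnP p N) => //= pN; rewrite cl // (mateK H).
  by case/andP=> pN _; exact: clf.
by rewrite addnn odd_double.
Qed.

(** Reduction modulo 2 removes an even number of dots from each arc, and each removal is seen at
    both ends. *)
Lemma sum_odd_mod4 N t (P : pred nat) : matching N t ->
  (forall p, p < N -> P (mate t p) = P p) ->
  \sum_(p <- iota 0 N | P p) dots t p = \sum_(p <- iota 0 N | P p) odd (dots t p) %[mod 4].
Proof.
move=> H cl; have := @sum_half N t P (fun p => (dots t p)./2) H cl.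
have -> : \sum_(p <- iota 0 N | P p) dots t p =
    \sum_(p <- iota 0 N | P p) odd (dots t p) + 2 * \sum_(p <- iota 0 N | P p) (dots t p)./2.
  by rewrite big_distrr -big_split; apply: eq_bigr => p _; rewrite /= mul2n odd_double_half.
by move/(_ (fun p pN => congr1 half (dots_mate H pN))) => /=; lia.
Qed.

(* Twice the number of dots: those on arcs are stored at both ends. *)
Definition dot_sum (N : nat) (t : raw) : nat :=
  \sum_(p <- iota 0 N) dots t p + 2 * sumn (rl t).

(** The generator e_0 puts one dot on the new cup and one on the fused arc or loop; each counts
    twice, which gives 4. *)
Lemma dot_sum_act m n i t : 1 < n -> i < n -> matching (m + n) t ->
  dot_sum (m + n) (act m n i t) = dot_sum (m + n) t %[mod 4].
Proof.
move=> n2 iN H.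
have -> : dot_sum (m + n) (act m n i t) = dot_sum (m + n) t + 4 * (i == 0).
  by apply: (@sum_dots_splice _ predT) => //; lia.
by lia.
Qed.

Lemma dot_sum_actw m n w t : 1 < n -> all (ltn^~ n) w -> matching (m + n) t ->
  dot_sum (m + n) (actw m n w t) = dot_sum (m + n) t %[mod 4].
Proof.
move=> n2 + H; elim: w => //= i w IH /andP[iN wN].
by rewrite dot_sum_act ?IH //; exact: matching_actw.
Qed.

Lemma dot_sum_parity N t : matching N t -> ~~ has odd (rl t) ->
  dot_sum N (parity t) = dot_sum N t %[mod 4].
Proof.
move=> H hl; rewrite /dot_sum /= muln0 addn0.
have -> : \sum_(p <- iota 0 N) dots (parity t) p = \sum_(p <- iota 0 N) odd (dots t p).
  by apply: eq_bigr => p _; rewrite dots_parity.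
have : \sum_(p <- iota 0 N) dots t p = \sum_(p <- iota 0 N) odd (dots t p) %[mod 4].
  exact: (@sum_odd_mod4 N t predT H).
have : ~~ odd (sumn (rl t)) by elim: (rl t) hl => //= v s IH; rewrite negb_or oddD => /andP[/negPf-> /IH].
by lia.
Qed.

Lemma dot_sum_id n : dot_sum (n + n) (id_raw n) = 0.
Proof. by rewrite /dot_sum big1 // => p _; rewrite dots_id. Qed.

Lemma dot_sum_word n w : 1 < n -> all (ltn^~ n) w -> 4 %| dot_sum (n + n) (word n w).
Proof.
move=> n2 wN; rewrite /dvdn dot_sum_actw //; last exact: matching_id.
by rewrite dot_sum_id.
Qed.

Lemma even_dotted_parity m n t : valid_tangle m n t -> capless m t ->
  ~~ has odd (rl t) -> 4 %| n - m + dot_sum (m + n) t -> even_dotted m n (parity t).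
Proof.
move=> v cl hl ev; apply/even_dottedP; split=> //.
- exact: valid_parity.
- by move=> p _; rewrite dots_parity; case: (odd _).
- by have := dot_sum_parity (valid_matching v) hl; rewrite {1}/dot_sum /= muln0 addn0; lia.
Qed.

(** The extra relation, with the odd number of undotted cups rewritten modulo 4 as in
    [undotted_cups_mod4] and with dots taken modulo 2, so that it also makes sense before reduction.
    Evenness of [n] is implied, because the top points are matched among themselves. *)
Definition killed (n : nat) (t : raw) : bool :=
  all (fun p => (mate t p < n) == (p < n)) (iota 0 (n + n)) &&
  ~~ (4 %| n + \sum_(p <- iota 0 n) odd (dots t (n + p))).

Lemma killed_parity n t : killed n (parity t) = killed n t.
Proof.
congr (_ && ~~ (_ %| _ + _)).
by apply: eq_bigr => p _; rewrite dots_parity oddb.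
Qed.

Lemma edgelessP n t : reflect (edgeless n t) (all (fun p => (mate t p < n) == (p < n)) (iota 0 (n + n))).
Proof.
apply: (iffP allP) => h p.
  by move=> pN; have := h p; rewrite mem_iota => /(_ pN) /eqP.
by rewrite mem_iota => /andP[_ pN]; rewrite (h p pN) eqxx.
Qed.

Lemma sum_tops n (f : nat -> nat) : \sum_(p <- iota 0 (n + n) | n <= p) f p =
  \sum_(p <- iota 0 n) f (n + p).
Proof.
have e : iota n n = map (addn n) (iota 0 n) by rewrite -iotaDl addn0.
rewrite iotaD big_cat /= add0n e big_map /= big_seq_cond big1 ?add0n.
  by apply: eq_bigl => p; rewrite leq_addr.
by move=> p; rewrite mem_iota; lia.
Qed.

Lemma edgeless_closed n t p : edgeless n t -> p < n + n -> (n <= mate t p) = (n <= p).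
Proof. by move=> el pN; rewrite leqNgt el // -leqNgt. Qed.

(** The generator meets only top arcs, and these form a closed set when there are no edges; their
    dot sum, with loops counted twice, changes by a multiple of 4. A loop with an odd number of dots
    could spoil the parity, but then the tangle is zero anyway. *)
Lemma killed_act n i t : 1 < n -> i < n -> matching (n + n) t -> rl t = [::] -> killed n t ->
  ~~ has odd (rl (act n n i t)) -> killed n (act n n i t).
Proof.
move=> n2 iN H l0 /andP[/edgelessP el k] hl.
have xN : n + i.-1 < n + n by lia.
have yN : (n + i.-1).+1 < n + n by lia.
have xy : n + i.-1 <> (n + i.-1).+1 by lia.
have H' := matching_act n2 iN H.
have el' : edgeless n (act n n i t).
  move=> p pN; rewrite mate_splice //.
  have := el _ xN; have := el _ yN; have := el _ pN.
  have Kp := mateK H pN; have mpN := mate_lt H pN.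
  by split_eqs; lia.
have clo u : edgeless n u -> forall p, p < n + n -> (fun p => n <= p) (mate u p) = (n <= p).
  by move=> eu p pN; rewrite edgeless_closed.
apply/andP; split; first exact/edgelessP.
move: k; rewrite -!(sum_tops n (fun p => nat_of_bool (odd (dots _ p)))).
have := sum_odd_mod4 H (clo _ el); have := sum_odd_mod4 H' (clo _ el').
have := @sum_dots_splice _ (fun p => n <= p) _ _ (i == 0) _ H xN yN xy.
rewrite !(edgeless_closed el) // l0 -/(act n n i t).
have : ~~ odd (sumn (rl (act n n i t))).
  by elim: (rl _) hl => //= v s IH; rewrite negb_or oddD => /andP[/negPf-> /IH].
move=> h1 /(_ (leq_addr _ _)) h2; have {}h2 := h2 (ltac:(lia)) (leq_addr _ _) (ltac:(lia)).
move: h1 h2; set a := sumn _; set b := \sum_(p <- _ | _) dots _ _; set c := \sum_(p <- _ | _) dots _ _.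
by rewrite /=; lia.
Qed.

(** The condition looks only at the upper half. For an edgeless diagram [n] is even, so divisibility
    of the total dot sum by 4 makes it equivalent to the condition on the lower half. *)
Lemma killed_rstar n t : matching (n + n) t -> ~~ has odd (rl t) -> 4 %| dot_sum (n + n) t ->
  killed n (rstar n n t) = killed n t.
Proof.
move=> H hl ev.
have fl p : p < n + n -> mate t (flip n n p) < n + n by move=> pN; apply: (mate_lt H); apply: flip_lt.
have ee : edgeless n (rstar n n t) <-> edgeless n t.
  split=> el p pN.
    have := el _ (flip_lt pN); rewrite mate_rstar ?flip_lt // flipK //.
    by have := mate_lt H pN; rewrite /flip; split_ifs; lia.
  by rewrite mate_rstar //; have := el _ (flip_lt pN); have := fl _ pN; rewrite /flip; split_ifs; lia.
rewrite /killed; case: (boolP (all _ (iota 0 (n + n)))) => [/edgelessP el1|nel1];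
  case: (boolP (all (fun p => (mate t p < n) == (p < n)) _)) => [/edgelessP el2|nel2] //=.
- congr (~~ _).
  have -> : \sum_(p <- iota 0 n) odd (dots (rstar n n t) (n + p)) = \sum_(p <- iota 0 n) odd (dots t p).
    rewrite big_seq [RHS]big_seq; apply: eq_bigr => p.
    by rewrite mem_iota => /andP[_ pn]; rewrite dots_rstar_top.
  have := dot_sum_parity H hl; rewrite {1}/dot_sum /= muln0 addn0 sum_iota_halves.
  have -> : \sum_(p <- iota 0 n) dots (parity t) p = \sum_(p <- iota 0 n) odd (dots t p).
    by apply: eq_bigr => p _; rewrite dots_parity.
  have -> : \sum_(p <- iota 0 n) dots (parity t) (n + p) = \sum_(p <- iota 0 n) odd (dots t (n + p)).
    by apply: eq_bigr => p _; rewrite dots_parity.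
  by have := edgeless_even H el2; lia.
- by case/edgelessP: nel2; apply/ee.
- by case/edgelessP: nel1; apply/ee.
Qed.

(** An edgeless diagram of this form has [lam] equal to 0, and then evenness of [al] is the negation
    of the extra relation. *)
Lemma killed_cell n lam al be : even_dotted lam n al -> even_dotted lam n be ->
  killed n (cell n lam al be) = false.
Proof.
move=> Ma Mb; apply/negP => /andP[/edgelessP el].
have [Ha ca] := even_dotted_matching Ma; have [Hb cb] := even_dotted_matching Mb.
have /even_dottedP[v l0 d1 _ ev] := Ma.
have D0 : defects n n (parity (cell n lam al be)) = [::].
  apply/eqP; rewrite -(negbK (_ == _)) -has_filter; apply/hasPn => p.
  rewrite mem_iota => /andP[_ pn]; rewrite mate_parity el; lia.
have lam0 : lam = 0.
  by rewrite -(size_defects_capless v ca) -(defects_cell Ma Mb) D0.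
subst lam; case/negP; move: ev; rewrite subn0 add0n.
congr (4 %| _ + _); rewrite big_seq [RHS]big_seq; apply: eq_bigr => p.
rewrite mem_iota => /andP[_ pn]; rewrite dots_cell ?ltn_add2l // /cell_dots.
rewrite [n + p < n]ltnNge leq_addr /= addKn.
by have := d1 p pn; rewrite add0n; case: (dots al p) => [|[]].
Qed.

Lemma dots_le1_parity N t : matching N t -> rl t = [::] ->
  (forall p, p < N -> dots t p <= 1) -> parity t = t.
Proof.
move=> H l0 d1; apply: (@raw_ext N); rewrite /= ?size_map ?(size_rm H) ?(size_rd H) //.
by move=> p pN; rewrite dots_parity; have := d1 p pN; case: (dots t p) => [|[]].
Qed.

Lemma leq_sum_parity N t : \sum_(p <- iota 0 N) dots (parity t) p <= \sum_(p <- iota 0 N) dots t p.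
Proof. by apply: leq_sum => p _; rewrite dots_parity; case: (dots t p) => [|k] //=; case: odd. Qed.

Lemma ltn_sum_parity N t p r : p < N -> r < N -> p <> r -> 1 < dots t p -> 1 < dots t r ->
  \sum_(p <- iota 0 N) dots (parity t) p + 4 <= \sum_(p <- iota 0 N) dots t p.
Proof.
move=> pN rN pr dp dr.
have e (a : nat) : a < N -> \sum_(k <- iota 0 N) (k == a) * 2 = 2.
  by move=> aN; apply: (@sum_iota_delta N predT).
have -> : 4 = \sum_(k <- iota 0 N) ((k == p) * 2 + (k == r) * 2) by rewrite big_split /= !e.
rewrite -big_split; apply: leq_sum => k _; rewrite dots_parity /=.
have := odd_double_half (dots t k).
case: (k =P p) => [kp|_]; case: (k =P r) => [kr|_]; case: (odd (dots t k)) => /=; try lia.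
- by move: dp; rewrite -kp; lia.
- by move: dp; rewrite -kp; lia.
- by move: dr; rewrite -kr; lia.
- by move: dr; rewrite -kr; lia.
Qed.

(** * Reaching every even half tangle from a canonical one *)

Section Reach.
Variables (n lam : nat).
Hypothesis n2 : 1 < n.
Local Notation M := (even_dotted lam n).
Local Notation N0 := (lam + n).
Implicit Types (al : raw) (i j l p : nat).

Lemma evenM al : M al -> [/\ matching N0 al, capless lam al, parity al = al &
  forall p, p < N0 -> dots al p <= 1].
Proof.
move=> Ma; have [H cl] := even_dotted_matching Ma.
by have /even_dottedP[_ l0 d1 _ _] := Ma; split=> //; exact: dots_le1_parity H l0 d1.
Qed.

(** The assumptions exclude the two bad cases, a cup closed to a loop and two edges joined to a cap;
    otherwise the dot sum modulo 4 is all that matters. *)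
Lemma act_even i al : M al -> i < n -> mate al (lam + i.-1) <> (lam + i.-1).+1 ->
  (lam <= mate al (lam + i.-1)) || (lam <= mate al (lam + i.-1).+1) ->
  M (parity (act lam n i al)).
Proof.
move=> Ma iN ne nb; have /even_dottedP[v l0 d1 cl ev] := Ma.
have H := valid_matching v.
have xN : lam + i.-1 < lam + n by lia.
have yN : (lam + i.-1).+1 < lam + n by lia.
have l0' : rl (act lam n i al) = [::].
  by rewrite /act /splice [LHS]/= (introF eqP ne).
apply: even_dotted_parity.
- exact: valid_act.
- move=> p pl; rewrite mate_splice; last by lia.
  have clp := cl _ pl; have Kp := mateK H (ltn_addr n pl).
  have -> : (p == lam + i.-1) = false by lia.
  have -> : (p == (lam + i.-1).+1) = false by lia.
  case: eqP => [e1|_]; first by move: nb; rewrite -e1 Kp; lia.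
  by case: eqP => [e1|_] //; move: nb; rewrite -e1 Kp; lia.
- by rewrite l0'.
- have := dot_sum_act n2 iN H; move: ev.
  have -> : \sum_(p <- iota 0 (lam + n)) dots al p = dot_sum (lam + n) al.
    by rewrite /dot_sum l0 muln0 addn0.
  by lia.
Qed.

Lemma splice_top_even al q r (e : nat) : M al -> 
  (exists2 i, i < n & (e = (i == 0) /\ ((q = lam + i.-1 /\ r = q.+1) \/ (r = lam + i.-1 /\ q = r.+1)))) ->
  lam <= mate al q -> mate al q <> r ->
  M (parity (splice N0 q r e al)).
Proof.
move=> Ma [i iN [-> h]] hq qr; have [H cl _ _] := evenM Ma.
have xN : lam + i.-1 < lam + n by lia.
have yN : (lam + i.-1).+1 < lam + n by lia.
case: h => -[e1 e2]; subst.
  by apply: act_even => //; rewrite hq.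
rewrite splice_sym //; try lia.
apply: act_even => //; last by rewrite hq orbT.
by move=> E; apply: qr; rewrite -E (mateK H).
Qed.

Variable P : raw -> Prop.
Hypothesis P_act : forall i al, i < n -> M al -> M (act lam n i al) -> P al -> P (act lam n i al).

(** By the zigzag relation [al] is the result of one generator acting on the half tangle in which
    the arc from [p] to [q] has been moved to [q] and [r]. It thus suffices to treat that half
    tangle. *)
Lemma P_zigzag al p q r (e e' : nat) : M al -> mate al p = q ->
  (exists2 i, i < n & (e = (i == 0) /\ ((p = lam + i.-1 /\ q = p.+1) \/ (q = lam + i.-1 /\ p = q.+1)))) ->
  (exists2 i, i < n & (e' = (i == 0) /\ ((q = lam + i.-1 /\ r = q.+1) \/ (r = lam + i.-1 /\ q = r.+1)))) ->
  r <> p -> e = dots al p -> odd (dots al p + dots al r + e') + odd e' + e = dots al r ->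
  M (parity (splice N0 q r e' al)) /\
  (P (parity (splice N0 q r e' al)) -> P al).
Proof.
move=> Ma mp he he' rp ep eqd; have [H cl Pa d1] := evenM Ma.
have pN : p < N0 by case: he => i iN; lia.
have rN : r < N0 by case: he' => i iN; lia.
have qN : q < N0 by case: he => i iN; lia.
have mq : mate al q = p by rewrite -mp (mateK H).
have rq : r <> q by case: he' => i iN; lia.
have M1 : M (parity (splice N0 q r e' al)).
  apply: splice_top_even => //; rewrite mq; last by congruence.
  by case: he => i iN; lia.
split=> // P1.
have := splice_zigzag H Pa pN rN rp; rewrite mp => /(_ e e' rq ep eqd) E.
have [H1 _ _ _] := evenM M1.
case: he => i iN [ei [[e1 e2]|[e1 e2]]].
  have E2 : act lam n i (parity (splice N0 q r e' al)) = al by rewrite -[RHS]E /act -e1 -e2 ei.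
  by rewrite -E2; apply: P_act; rewrite ?E2.
have E2 : act lam n i (parity (splice N0 q r e' al)) = al.
  rewrite -[RHS]E /act splice_sym //; try lia.
  by rewrite -e1 -e2 ei.
by rewrite -E2; apply: P_act; rewrite ?E2.
Qed.
Local Notation T l := (lam + l).
Local Notation sumd al := (\sum_(k <- iota 0 N0) dots al k).

(** The last term is the dot of the leftmost edge: it detects the move which passes this dot to a
    cup without increasing the first sum. The weight 2 makes a loss of dots outweigh a newly dotted
    edge. *)
Definition measure al := 2 * sumd al + (if 0 < lam then dots al 0 else 0).

Lemma sum_dots_splice0 al q r (e : nat) : M al -> q < N0 -> r < N0 -> q <> r ->
  mate al q <> r -> sumd (splice N0 q r e al) = sumd al + 4 * e.
Proof.
move=> Ma qN rN qr ne; have [H _ Pa _] := evenM Ma.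
have l0 : rl al = [::] by rewrite -Pa.
have := @sum_dots_splice _ predT q r e _ H qN rN qr isT isT isT isT.
by rewrite l0 {2}/splice [rl _]/= (introF eqP ne) l0 !muln0 !addn0.
Qed.

Lemma splice_pair al p q r (e : nat) : M al -> mate al p = q -> p < N0 -> r < N0 -> r <> p -> r <> q ->
  [/\ p < N0, q < N0, mate al r <> p, mate al r <> q &
   forall k, k < N0 -> mate (splice N0 q r e al) k =
     if k == q then r else if k == r then q else if k == p then mate al r
     else if k == mate al r then p else mate al k] /\
   forall k, k < N0 -> dots (splice N0 q r e al) k =
     if (k == q) || (k == r) then e else if (k == p) || (k == mate al r)
     then dots al p + dots al r + e else dots al k.
Proof.
move=> Ma mp pN rN rp rq; have [H cl _ _] := evenM Ma.
have qN : q < N0 by rewrite -mp; apply: (mate_lt H).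
have Kp := mateK H pN; have Kr := mateK H rN.
have Dp := dots_mate H pN.
split.
  split=> //; try congruence.
  move=> k kN; have Kk := mateK H kN.
  by rewrite mate_splice //; split_eqs.
move=> k kN; have Kk := mateK H kN; rewrite dots_splice //; rewrite mp in Dp.
by split_eqs.
Qed.

Lemma measure_slide al p q r : M al -> mate al p = q -> dots al p = 0 ->
  lam <= p -> lam <= q -> lam <= r -> p < N0 -> r < N0 -> r <> p -> r <> q ->
  let al1 := parity (splice N0 q r 0 al) in
  [/\ mate al1 q = r, dots al1 q = 0, measure al1 <= measure al &
   forall k, k < N0 -> k <> p -> k <> q -> k <> r -> mate al k <> r ->
     mate al1 k = mate al k /\ dots al1 k = dots al k].
Proof.
move=> Ma mp d0 lp lq lr pN rN rp rq al1; have [H cl _ d1] := evenM Ma.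
have [[_ qN rp' rq' Em] Ed] := splice_pair 0 Ma mp pN rN rp rq.
have od k : k < N0 -> odd (dots al k) = dots al k :> nat.
  by move=> /d1; case: (dots al k) => [|[]].
have qp : mate al q = p by rewrite -mp (mateK H).
split.
- by rewrite mate_parity Em // eqxx.
- by rewrite dots_parity Ed // eqxx.
- rewrite /measure; apply: leq_add.
    rewrite leq_mul2l /=; apply: leq_trans (leq_sum_parity _ _) _.
    by rewrite sum_dots_splice0 ?muln0 ?addn0 //; congruence.
  case: ifP => // l0; have N0' : 0 < N0 by lia.
  rewrite dots_parity Ed //; have -> : (0 == q) || (0 == r) = false by lia.
  case: ifP => [e0|_]; last by rewrite od.
  have -> : dots al 0 = dots al r.
    have /orP[/eqP e1|/eqP e1] := e0; first by lia.
    by rewrite e1 (dots_mate H).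
  by rewrite d0 addn0 od.
- move=> k kN kp kq kr mkr; rewrite mate_parity dots_parity Em // Ed //.
  have Kk := mateK H kN; have Kr := mateK H rN.
  have h4 : k <> mate al r by congruence.
  by rewrite (introF eqP kp) (introF eqP kq) (introF eqP kr) (introF eqP h4) /= od.
Qed.

(** The fused arc from [p] to the old mate of [r] receives two dots, which cancel; this loss is seen
    at both ends, whence 4. *)
Lemma measure_fuse al p q r : M al -> mate al p = q -> dots al p = 1 -> dots al r = 1 ->
  p < N0 -> r < N0 -> r <> p -> r <> q -> M (parity (splice N0 q r 0 al)) ->
  measure (parity (splice N0 q r 0 al)) < measure al.
Proof.
move=> Ma mp dp dr pN rN rp rq M1; have [H cl _ d1] := evenM Ma.
have [[_ qN rp' rq' Em] Ed] := splice_pair 0 Ma mp pN rN rp rq.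
have [_ _ _ d1'] := evenM M1.
have mrN := mate_lt H rN; have nr := mate_neq H rN.
have pq : p <> q by have := mate_neq H pN; congruence.
have s4 : sumd (parity (splice N0 q r 0 al)) + 4 <= sumd al.
  have <- : sumd (splice N0 q r 0 al) = sumd al.
    rewrite sum_dots_splice0 ?muln0 ?addn0 //; first by congruence.
    by rewrite -mp (mateK H) //; congruence.
  apply: (@ltn_sum_parity _ _ p (mate al r)) => //; first by congruence.
    by rewrite Ed // eqxx (introF eqP pq) (introF eqP (nesym rp)) /= dp dr.
  rewrite Ed // eqxx orbT (introF eqP rq') (introF eqP nr) /= dp dr //.
rewrite /measure; case: ifP => l0; last by lia.
by have := d1' 0; rewrite addn_gt0 l0 => /(_ isT); lia.
Qed.

Lemma top_edge_dot al : M al -> mate al (T 0) < lam -> dots al (T 0) = 1 -> 0 < n ->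
  mate al (T 0) = 0.
Proof.
move=> Ma h d n0; have /even_dottedP[v _ _ cl _] := Ma.
have [H _ _ _] := evenM Ma.
case: (posnP (mate al (T 0))) => // m0.
have tN : T 0 < N0 by lia.
by have := dots_capless v cl m0 h; rewrite (dots_mate H tN) d.
Qed.

(* The dot of the leftmost edge moves to the undotted cup next to it. *)
Lemma measure_unedge al : 2 < n -> M al -> mate al (T 2) = T 1 -> dots al (T 2) = 0 ->
  mate al (T 0) < lam -> dots al (T 0) = 1 ->
  measure (parity (splice N0 (T 1) (T 0) 1 al)) < measure al.
Proof.
move=> n3 Ma mp dp h0 d0; have [H cl _ d1] := evenM Ma.
have pN : T 2 < N0 by lia.
have rN : T 0 < N0 by lia.
have rp : T 0 <> T 2 by lia.
have rq : T 0 <> T 1 by lia.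
have [[_ qN rp' rq' Em] Ed] := splice_pair 1 Ma mp pN rN rp rq.
have m0 := top_edge_dot Ma h0 d0 (ltnW (ltnW n3)).
have l0 : 0 < lam by lia.
have ZN : 0 < N0 by lia.
have dz : dots al 0 = 1 by have := dots_mate H rN; rewrite m0 d0.
have s4 : sumd (parity (splice N0 (T 1) (T 0) 1 al)) <= sumd al.
  have : sumd (splice N0 (T 1) (T 0) 1 al) = sumd al + 4.
    rewrite sum_dots_splice0 //; first by lia.
    by rewrite -mp (mateK H) //; lia.
  have := @ltn_sum_parity N0 (splice N0 (T 1) (T 0) 1 al) (T 2) 0 pN ZN.
  have e2 : dots (splice N0 (T 1) (T 0) 1 al) (T 2) = 2.
    rewrite Ed // eqxx dp d0; have -> : (T 2 == T 1) || (T 2 == T 0) = false by lia.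
    by [].
  have e3 : dots (splice N0 (T 1) (T 0) 1 al) 0 = 2.
    rewrite Ed // m0 eqxx orbT dp d0; have -> : (0 == T 1) || (0 == T 0) = false by lia.
    by [].
  rewrite e2 e3 => h e; have := h (ltac:(lia)) isT isT; lia.
rewrite /measure l0 dz dots_parity Ed // m0 eqxx orbT dp d0.
have -> : (0 == T 1) || (0 == T 0) = false by lia.
by rewrite /=; lia.
Qed.

(** From position [N] on, the top is filled with undotted small cups. These are the cups which have
    been slid to the right so far. *)
Definition settled N al := [/\ N <= n, ~~ odd (n - N) &
  forall p, N <= p -> p < n -> ~~ odd (p - N) ->
    mate al (T p) = T p.+1 /\ dots al (T p) = 0].

Lemma settled_above N al p : M al -> settled N al -> N <= p -> p < n ->
  T N <= mate al (T p) /\ (mate al (T p) = T p.+1 \/ T p = (mate al (T p)).+1) /\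
  dots al (T p) = 0.
Proof.
move=> Ma [Nn ev h] Np pn; have [H _ _ _] := evenM Ma.
case: (boolP (odd (p - N))) => op; last by have [e d] := h p Np pn op; rewrite e d; lia.
have [] := h p.-1; try lia.
have -> : p.-1.+1 = p by lia.
move=> e d; have pN : T p.-1 < N0 by lia.
have Kp := mateK H pN; have Dp := dots_mate H pN.
by rewrite e in Kp Dp; rewrite Kp Dp d; lia.
Qed.

Lemma settled_below N al p : M al -> settled N al -> p < N -> mate al (T p) < T N.
Proof.
move=> Ma st pN; have [Nn _ _] := st; have [H _ _ _] := evenM Ma.
have pn : T p < N0 by lia.
have mn := mate_lt H pn; have Kp := mateK H pn.
case: (ltnP (mate al (T p)) (T N)) => // h.
have [] := @settled_above N al (mate al (T p) - lam) Ma st; try lia.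
by rewrite subnKC; [rewrite Kp; lia | lia].
Qed.

Lemma slide_right N al l : M al -> settled N al -> l.+2 < N ->
  mate al (T l) = T l.+1 -> dots al (T l) = 0 ->
  exists al1, [/\ M al1, settled N al1, measure al1 <= measure al,
     mate al1 (T l.+1) = T l.+2 /\ dots al1 (T l.+1) = 0 & P al1 -> P al].
Proof.
move=> Ma st lN ml dl; have [Nn ev hs] := st; have [H _ _ _] := evenM Ma.
have pN : T l < N0 by lia.
have rN : T l.+2 < N0 by lia.
have ne1 : T l.+2 <> T l by lia.
have ne2 : T l.+2 <> T l.+1 by lia.
have [M1 P1] : M (parity (splice N0 (T l.+1) (T l.+2) 0 al)) /\
    (P (parity (splice N0 (T l.+1) (T l.+2) 0 al)) -> P al).
  apply: (P_zigzag (p := T l) (e := 0)) => //.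
  - by exists l.+1; [lia | split=> //; left; lia].
  - by exists l.+2; [lia | split=> //; left; lia].
  - have := even_dottedP lam n al; case=> /(_ Ma)[_ _ d1 _ _] _.
    by rewrite dl; have := d1 _ rN; case: (dots al _) => [|[]].
exists (parity (splice N0 (T l.+1) (T l.+2) 0 al)).
have [] := measure_slide Ma ml dl _ _ _ pN rN ne1 ne2; try lia.
move=> h1 h2 h3 h4; split=> //; split=> // p Np pn op.
have [e d] := hs p Np pn op.
have [||||| -> ->] // := h4 (T p); lia.
Qed.

(** An undotted small cup slides to the right until it touches the settled block, which then begins
    two positions earlier. *)
Lemma P_small_cup N al l (m : nat) : ~~ odd (n - N) -> l.+1 < N ->
  (forall al, M al -> measure al < m -> settled N.-2 al -> P al) ->
  M al -> measure al < m -> settled N al ->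
  mate al (T l) = T l.+1 -> dots al (T l) = 0 -> P al.
Proof.
move=> ev + IHN; have [k] := ubnP (N - l); elim: k => // k IH in al l *.
rewrite ltnS => Nl lN Ma ms st ml dl; have [Nn _ hs] := st.
case: (ltnP l.+2 N) => h.
  have [al1 [M1 st1 ms1 [m1 d1] P1]] := slide_right Ma st h ml dl.
  apply: P1; apply: (IH al1 l.+1) => //; try lia.
apply: IHN => //; split; try lia.
move=> p Np pn op; case: (ltnP p N) => pN.
  by have -> : p = l by lia.
by apply: hs => //; lia.
Qed.

Lemma cup_over_edge al p x p' : M al -> p < x -> x < p' -> p' < n ->
  mate al (T p) = T p' -> mate al (T x) < lam -> False.
Proof.
move=> Ma px xp pn mp mx; have /even_dottedP[v _ _ _ _] := Ma.
have H := valid_matching v; have [_ nc _] := (valid_tangleP _ _ _).1 v.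
have xN : T x < N0 by lia.
have pN : T p < N0 by lia.
have pN' : T p' < N0 by lia.
have := nc (mate al (T x)) (T p') (mate_lt H xN) pN'.
rewrite (mateK H) // -mp (mateK H) // mp !(bpos_lt_top (leq_addr _ _)) ?leq_addr // (bpos_bot _ mx).
by rewrite bpos_top ?leq_addr //; lia.
Qed.

(** By planarity an arc starting under a cup stays under it, and the outer cup separates it from the
    left face. *)
Lemma cup_nested al p x x' p' : M al -> p < x -> x < p' -> p' < n -> x' < n ->
  mate al (T p) = T p' -> mate al (T x) = T x' ->
  [/\ p < x', x' < p' & dots al (T x) = 0].
Proof.
move=> Ma px xp pn xn mp mx; have /even_dottedP[v _ _ _ _] := Ma.
have H := valid_matching v; have [_ nc ex] := (valid_tangleP _ _ _).1 v.
have xN : T x < N0 by lia.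
have xN' : T x' < N0 by lia.
have pN : T p < N0 by lia.
have pN' : T p' < N0 by lia.
have Kp := mateK H pN; have Kx := mateK H xN; rewrite mp in Kp; rewrite mx in Kx.
have B := bpos_lt_top (leq_addr _ _) (leq_addr _ _).
have n1 := nc (T p') (T x) pN' xN; have n2' := nc (T x') (T p') xN' pN'.
have n3 := nc (T x) (T p) xN pN.
have n4 := nc (T p) (T x) pN xN; have n5 := nc (T p') (T x') pN' xN'.
rewrite ?mp ?mx ?Kp ?Kx !(bpos_lt_top (leq_addr _ _)) ?leq_addr // in n1 n2' n3 n4 n5.
have ne1 : x' <> p' by move=> e; rewrite e Kp in Kx; lia.
have ne2 : x' <> p by move=> e; rewrite e mp in Kx; lia.
split; [lia | lia |].
case: (posnP (dots al (T x))) => // d0.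
have := ex (T x) (T p') xN pN' d0.
rewrite mx Kp !(bpos_lt_top (leq_addr _ _)) ?leq_addr //; lia.
Qed.

(** An edge to the left of a cup cuts it off from the left face. *)
Lemma edge_hides al q p p' : M al -> q < p -> q < p' -> p < n -> p' < n ->
  mate al (T q) < lam -> mate al (T p) = T p' -> dots al (T p) = 0.
Proof.
move=> Ma qp qp' pn pn' mq mp; have /even_dottedP[v _ _ _ _] := Ma.
have H := valid_matching v; have [_ _ ex] := (valid_tangleP _ _ _).1 v.
case: (posnP (dots al (T p))) => // d0.
have pN : T p < N0 by lia.
have qN : T q < N0 by lia.
have := ex (T p) (mate al (T q)) pN (mate_lt H qN) d0.
rewrite mp (mateK H) // (bpos_bot _ mq) !bpos_top ?leq_addr //; lia.
Qed.

(** A larger cup would contain an inner one, which by induction is small and dotted; but being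
    covered it cannot be dotted. *)
Lemma cups_small N al : M al -> settled N al ->
  (forall l, l.+1 < N -> mate al (T l) = T l.+1 -> dots al (T l) <> 0) ->
  forall p p', p < p' -> p < N -> mate al (T p) = T p' -> p' = p.+1 /\ dots al (T p) = 1.
Proof.
move=> Ma st small p p'; have [Nn _ _] := st; have [H cl _ d1] := evenM Ma.
have [k] := ubnP (p' - p); elim: k => // k IH in p p' *.
rewrite ltnS => kp pp pN mp; have pN' := settled_below Ma st pN; rewrite mp in pN'.
have pn : T p < N0 by lia.
case: (ltngtP p.+1 p') => h; [|lia|]; last first.
  have := small p; rewrite mp h => /(_ (ltac:(lia)) erefl).
  by have := d1 _ pn; split=> //; lia.
have qn : T p.+1 < N0 by lia.
have mqn := mate_lt H qn.
case: (ltnP (mate al (T p.+1)) lam) => hm.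
  by case: (@cup_over_edge al p p.+1 p') => //; lia.
have em : mate al (T p.+1) = T (mate al (T p.+1) - lam) by lia.
have [||||c1 c2 c3] := cup_nested Ma _ _ _ _ mp em; try lia.
have x1 : p.+1 < mate al (T p.+1) - lam by have := mate_neq H qn; lia.
have [||] // := IH _ _ _ x1 _ em; lia.
Qed.

(** From left to right: [k] dotted small cups with [k] at most 1, then undotted edges, then undotted
    small cups. *)
Definition canonical k N al := [/\ k <= 1, 2 * k <= N, settled N al,
  k = 1 -> mate al (T 0) = T 1 /\ dots al (T 0) = 1 &
  forall p, 2 * k <= p -> p < N -> mate al (T p) < lam /\ dots al (T p) = 0].

Hypothesis P_canonical : forall k N al, M al -> canonical k N al -> P al.

(** The undotted cup is slid to the left until it is adjacent to the dotted leftmost edge; there the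
    zigzag with e_0 takes the dot off the edge, and the measure drops. *)
Lemma P_edge_dotted m l al : (forall al, M al -> measure al < m -> P al) ->
  M al -> measure al <= m -> mate al (T 0) < lam -> dots al (T 0) = 1 ->
  0 < l -> l.+1 < n -> mate al (T l) = T l.+1 -> dots al (T l) = 0 -> P al.
Proof.
move=> IHm; elim: l al => // -[_|l IH] al Ma ms m0 d0 _ ln ml dl; have [H _ _ d1] := evenM Ma.
  have pN : T 1 < N0 by lia.
  have m2 : mate al (T 2) = T 1 by rewrite -ml (mateK H).
  have dd : dots al (T 2) = 0 by rewrite -ml (dots_mate H).
  have [M1 P1] : M (parity (splice N0 (T 1) (T 0) 1 al)) /\
      (P (parity (splice N0 (T 1) (T 0) 1 al)) -> P al).
    have ne : T 0 <> T 2 by lia.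
    apply: (P_zigzag (p := T 2) (e := 0)) => //.
    - by exists 2; [lia | split=> //; right; lia].
    - by exists 0; [lia | split=> //; right; lia].
    - by rewrite dd d0.
  apply/P1/IHm => //; apply: leq_trans ms; exact: measure_unedge.
have pN : T l.+2 < N0 by lia.
have qN : T l.+3 < N0 by lia.
have rN : T l.+1 < N0 by lia.
have m2 : mate al (T l.+3) = T l.+2 by rewrite -ml (mateK H).
have dd : dots al (T l.+3) = 0 by rewrite -ml (dots_mate H).
have ne1 : T l.+1 <> T l.+3 by lia.
have ne2 : T l.+1 <> T l.+2 by lia.
have [M1 P1] : M (parity (splice N0 (T l.+2) (T l.+1) 0 al)) /\
    (P (parity (splice N0 (T l.+2) (T l.+1) 0 al)) -> P al).
  apply: (P_zigzag (p := T l.+3) (e := 0)) => //.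
  - by exists l.+3; [lia | split=> //; right; lia].
  - by exists l.+2; [lia | split=> //; right; lia].
  - by rewrite dd; have := d1 _ rN; case: (dots al _) => [|[]].
apply: P1; have [] := measure_slide Ma m2 dd _ _ _ qN rN ne1 ne2; try lia.
move=> h1 h2 h3 h4; have [H1 _ _ _] := evenM M1.
have [|||||e0 e1] := h4 (T 0); try lia.
apply: IH => //; rewrite ?e0 ?e1 //; try lia.
- by have := mateK H1 pN; rewrite h1.
- by have := dots_mate H1 pN; rewrite h1 h2.
Qed.

(** The zigzag of e_0 with e_2 fuses the dotted cup at the left with the next arc, which may be a
    cup or an edge, and the two dots cancel. *)
Lemma P_fuse m al : (forall al, M al -> measure al < m -> P al) ->
  M al -> measure al <= m -> 2 < n -> mate al (T 0) = T 1 -> dots al (T 0) = 1 ->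
  dots al (T 2) = 1 -> P al.
Proof.
move=> IHm Ma ms n3 mp dp dr.
have pN : T 0 < N0 by lia.
have rN : T 2 < N0 by lia.
have ne1 : T 2 <> T 0 by lia.
have ne2 : T 2 <> T 1 by lia.
have [M1 P1] : M (parity (splice N0 (T 1) (T 2) 0 al)) /\
    (P (parity (splice N0 (T 1) (T 2) 0 al)) -> P al).
  apply: (P_zigzag (p := T 0) (e := 1)) => //.
  - by exists 0; [lia | split=> //; left; lia].
  - by exists 2; [lia | split=> //; left; lia].
  - by rewrite dp dr.
apply/P1/IHm => //; apply: leq_trans ms; exact: (measure_fuse Ma mp dp dr pN rN ne1 ne2 M1).
Qed.

(** If all top points belong to edges there is no cup to take over a dot. Then [n] equals [lam], and
    a single dotted edge contradicts evenness. *)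
Lemma edge_dotted_cups al : M al -> 0 < n -> dots al (T 0) = 1 ->
  (forall p, p < n -> mate al (T p) < lam) -> False.
Proof.
move=> Ma n0 d0 all_edges; have /even_dottedP[v _ _ cl ev] := Ma.
have [H _ _ _] := evenM Ma.
have D p : p < n -> p \in defects lam n al by move=> pn; rewrite mem_defects all_edges // pn.
have nl : n = lam.
  rewrite -(size_defects_capless v cl); have := size_defects lam n al.
  rewrite (@eq_in_count _ _ pred0) ?count_pred0 ?addn0 // => p.
  by rewrite mem_iota => /andP[_ pn]; rewrite /= leqNgt all_edges.
have m0 := top_edge_dot Ma (all_edges 0 n0) d0 n0.
have tN : T 0 < N0 by lia.
move: ev; rewrite (sum_dots_capless v cl) ifT; last by lia.
have -> : dots al 0 = 1 by have := dots_mate H tN; rewrite m0 d0.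
rewrite big_seq_cond big1; first by rewrite nl subnn.
by move=> p; rewrite mem_iota => /andP[/andP[_ pn]]; rewrite D.
Qed.

(** Induction on the measure, and for a given bound on it on [N]. Once no undotted small cup is left
    before [N], this region consists of dotted small cups followed by edges, and its first two arcs
    decide which move applies. *)
Theorem P_even_dotted al : M al -> P al.
Proof.
have [m] := ubnP (measure al); elim: m al => // m IHm al; rewrite ltnS => ms Ma.
have st0 : settled n al by split; [lia | rewrite subnn | lia].
suff gen k N : N < k -> forall al, measure al <= m -> M al -> settled N al -> P al.
  exact: gen (ltnSn n) _ ms Ma st0.
elim: k N => // k IHN N; rewrite ltnS => Nk {ms Ma st0}al ms Ma st.
have [Nn ev hs] := st; have [H cl _ d1] := evenM Ma.
case: (boolP (has (fun l => (mate al (T l) == T l.+1) && (dots al (T l) == 0)) (iota 0 N.-1))).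
  case/hasP=> l; rewrite mem_iota => /andP[_ lN] /andP[/eqP ml /eqP dl].
  apply: (@P_small_cup N al l m.+1) => //; first by lia.
  by move=> al1 M1 ms1 st1; apply: (IHN N.-2) => //; lia.
move=> /hasPn nosmall.
have small l : l.+1 < N -> mate al (T l) = T l.+1 -> dots al (T l) <> 0.
  move=> lN ml dl; have := nosmall l; rewrite mem_iota ml dl !eqxx => /(_ _)/negP; apply=> //; lia.
have cups := cups_small Ma st small.
(* A cup to the right of an edge would be hidden and hence undotted, contrary to [cups]. *)
have edges_after q p : mate al (T q) < lam -> q < p -> p < N -> mate al (T p) < lam.
  move=> mq qp pN; case: (ltnP (mate al (T p)) lam) => // h; exfalso.
  have pn : T p < N0 by lia.
  have qn : T q < N0 by lia.
  have mpn := mate_lt H pn; have Kp := mateK H pn; have np := mate_neq H pn.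
  have mb := settled_below Ma st pN; have Kq := mateK H qn.
  set p' := mate al (T p) - lam; have ep : mate al (T p) = T p' by rewrite /p'; lia.
  have p'q : p' <> q by move=> e; rewrite e in ep; rewrite ep in Kp; lia.
  rewrite ep in Kp mb np.
  have [pp|pp] := ltnP p p'.
    have [_] := cups _ _ pp pN ep.
    by rewrite (@edge_hides al q p p') //; lia.
  have pp2 : p' < p by lia.
  have [e1 d] := cups _ _ pp2 (ltn_trans pp2 pN) Kp.
  have := @edge_hides al q p' p; rewrite d => h2.
  by have := h2 Ma; lia.
have edot q p : mate al (T q) < lam -> q < p -> p < N -> dots al (T p) = 0.
  move=> mq qp pN; have /even_dottedP[v _ _ _ _] := Ma.
  apply: (edges_exposed v mq) => //; try lia.
  exact: edges_after mq qp pN.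
case: (posnP N) => N0'.
  by apply: (@P_canonical 0 N) => //; split=> //; lia.
have tn : T 0 < N0 by lia.
have m0n := mate_lt H tn; have := d1 _ tn.
case: (ltnP (mate al (T 0)) lam) => m0.
  case E: (dots al (T 0)) => [|[|]] // _.
    apply: (@P_canonical 0 N) => //; split=> // p _ pN.
    by case: (posnP p) => [->|p0]; rewrite ?E //; split; [apply: edges_after m0 _ _|apply: edot m0 _ _].
  (* The leftmost edge is dotted; the first settled cup, at [N], is brought to it and takes the dot.
     Evenness guarantees that there is such a cup. *)
  case: (ltnP N n) => Nlt.
    have [e d] := hs N (leqnn _) Nlt (ltac:(by rewrite subnn)).
    by apply: (@P_edge_dotted m N al) => //; [move=> *; exact: IHm | lia].
  exfalso; apply: (@edge_dotted_cups al) => //; first by lia.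
  by move=> p pn; case: (posnP p) => [->|p0] //; apply: edges_after m0 _ _ => //; lia.
have em : mate al (T 0) = T (mate al (T 0) - lam) by lia.
have p0 : 0 < mate al (T 0) - lam by have := mate_neq H tn; lia.
have [e1 dd] := cups _ _ p0 N0' em; rewrite e1 in em => _.
have mb := settled_below Ma st N0'.
(* A dotted cup occupies the positions 0 and 1. The arc at position 2 is an undotted edge, which
   gives the canonical shape, or it is dotted and can be fused with the cup. *)
case: (ltnP 2 N) => N2; last first.
  by apply: (@P_canonical 1 N) => //; split=> //; lia.
have t2 : T 2 < N0 by lia.
have K0 := mateK H tn; have K2 := mateK H t2; have m2n := mate_lt H t2; have n2' := mate_neq H t2.
have := d1 _ t2.
case: (ltnP (mate al (T 2)) lam) => m2.
  case E: (dots al (T 2)) => [|[|]] // _.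
    apply: (@P_canonical 1 N) => //; split=> //; first by lia.
    move=> p p2 pN.
    case: (ltngtP p 2) => [|h|->]; [lia| |by rewrite E].
    by split; [apply: edges_after m2 _ _|apply: edot m2 _ _].
  by apply: (@P_fuse m) => //; [move=> *; exact: IHm | lia].
have em2 : mate al (T 2) = T (mate al (T 2) - lam) by lia.
have p2 : 2 < mate al (T 2) - lam.
  have h0 : mate al (T 2) <> T 0 by move=> e; rewrite e em in K2; lia.
  have h1 : mate al (T 2) <> T 1 by move=> e; rewrite e -em K0 in K2; lia.
  lia.
have [_ d2] := cups _ _ p2 N2 em2 => _.
by apply: (@P_fuse m) => //; [move=> *; exact: IHm | lia].
Qed.
End Reach.

(* The common shape of the diagrams e_0^k e_{N+1} e_{N+3} ... e_{n-1}. *)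
Definition vertical (n k N : nat) (t : raw) : Prop :=
  [/\ matching (n + n) t, rl t = [::],
   forall p, 2 * k <= p -> p < N -> mate t (n + p) = p /\ dots t (n + p) = 0,
   forall p, N <= p -> p < n -> ~~ odd (p - N) ->
     [/\ mate t (n + p) = n + p.+1, dots t (n + p) = 0, mate t p = p.+1 & dots t p = 0] &
   k = 1 -> [/\ mate t n = n.+1, dots t n = 1, mate t 0 = 1 & dots t 0 = 1]].

(** * Words for the diagrams of two canonical halves *)

Section Vertical.
Variables (n : nat).
Hypothesis n2 : 1 < n.
Implicit Types (k N p : nat) (t : raw).

Lemma vertical_mates k N t : k <= 1 -> 2 * k <= N -> N <= n -> ~~ odd (n - N) ->
  vertical n k N t -> forall p, p < n ->
  [/\ mate t p = (if p < 2 * k then 1 - p else if p < N then n + p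
        else if odd (p - N) then p.-1 else p.+1),
      mate t (n + p) = (if p < 2 * k then n + (1 - p) else if p < N then p
        else if odd (p - N) then n + p.-1 else n + p.+1),
      dots t p = (p < 2 * k) & dots t (n + p) = (p < 2 * k)].
Proof.
move=> k1 kN Nn ev [H l0 mid settle cup] p pn.
have pN : n + p < n + n by lia.
have pN' : p < n + n by lia.
case: (ltnP p (2 * k)) => hk.
  have [c1 c2 c3 c4] := cup (ltac:(lia)).
  have N0 : 0 < n + n by lia.
  have Nn1 : n < n + n by lia.
  have K1 := mateK H N0; have K2 := mateK H Nn1; have D1 := dots_mate H N0; have D2 := dots_mate H Nn1.
  rewrite c1 in K2 D2; rewrite c3 in K1 D1.
  case: p hk {pn pN pN'} => [|[|p]] hk; last by lia.
    by rewrite addn0 c1 c2 c3 c4; split; lia.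
  by rewrite addn1 K1 K2 D1 D2 c2 c4; split; lia.
case: (ltnP p N) => hN.
  have [e d] := mid p hk hN.
  have K := mateK H pN; have D := dots_mate H pN; rewrite e in K D.
  by rewrite e d K D d.
case: (boolP (odd (p - N))) => op; last by have [-> -> -> ->] := settle p hN pn op.
have [||| e1 d1 e2 d2] := settle p.-1; try lia.
have pp : p.-1.+1 = p by lia.
have h1 : n + p.-1 < n + n by lia.
have h2 : p.-1 < n + n by lia.
have K1 := mateK H h1; have K2 := mateK H h2; have D1 := dots_mate H h1; have D2 := dots_mate H h2.
rewrite e1 pp in K1 D1; rewrite e2 pp in K2 D2.
by rewrite K1 K2 D1 D2 d1 d2.
Qed.

Lemma vertical_unique k N t t' : k <= 1 -> 2 * k <= N -> N <= n -> ~~ odd (n - N) ->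
  vertical n k N t -> vertical n k N t' -> t = t'.
Proof.
move=> k1 kN Nn ev v v'; have [H l0 _ _ _] := v; have [H' l0' _ _ _] := v'.
have E := vertical_mates k1 kN Nn ev v; have E' := vertical_mates k1 kN Nn ev v'.
apply: (@raw_ext (n + n)); rewrite ?(size_rm H) ?(size_rd H) ?(size_rm H') ?(size_rd H') ?l0 ?l0' //.
- move=> x xN; case: (ltnP x n) => xn; first by have [-> _ _ _] := E x xn; have [-> _ _ _] := E' x xn.
  have -> : x = n + (x - n) by lia.
  have xn' : x - n < n by lia.
  by have [_ -> _ _] := E _ xn'; have [_ -> _ _] := E' _ xn'.
- move=> x xN; case: (ltnP x n) => xn; first by have [_ _ -> _] := E x xn; have [_ _ -> _] := E' x xn.
  have -> : x = n + (x - n) by lia.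
  have xn' : x - n < n by lia.
  by have [_ _ _ ->] := E _ xn'; have [_ _ _ ->] := E' _ xn'.
Qed.

(** The generator with index N - 1 acts on the positions N - 2 and N - 1 counted from 0. There [t]
    still has vertical edges, which turn into a cup and a cap. *)
Lemma vertical_step N t : 2 <= N -> N <= n -> ~~ odd (n - N) -> vertical n 0 N t ->
  vertical n 0 N.-2 (act n n N.-1 t).
Proof.
move=> N2 Nn ev [H l0 mid settle _].
have xN : n + N.-2 < n + n by lia.
have yN : n + N.-1 < n + n by lia.
have ey : (n + N.-1.-1).+1 = n + N.-1 by lia.
have e0 : (N.-1 == 0) = false by lia.
have [||mx dx] := mid N.-2; try lia.
have [||my dy] := mid N.-1; try lia.
have H' : matching (n + n) (act n n N.-1 t) by apply: matching_act => //; lia.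
have Em p : p < n + n -> mate (act n n N.-1 t) p = if p == n + N.-2 then n + N.-1
   else if p == n + N.-1 then n + N.-2 else if mate t p == n + N.-2 then N.-1
   else if mate t p == n + N.-1 then N.-2 else mate t p.
  by move=> pN; rewrite mate_splice // ey mx my.
have Ed p : p < n + n -> dots (act n n N.-1 t) p = if (p == n + N.-2) || (p == n + N.-1) then 0
   else if (mate t p == n + N.-2) || (mate t p == n + N.-1) then 0 else dots t p.
  by move=> pN; rewrite dots_splice // ey dx dy e0.
split=> //.
- by rewrite /act /splice [LHS]/= mx ifN //; lia.
- move=> p _ pN; have [|| e d] := mid p; try lia.
  by rewrite Em ?Ed ?e ?d; try lia; split; split_ifs; lia.
- move=> p pN pn op; case: (ltnP p N) => hp.
    have pe : p = N.-2 by lia.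
    have K1 := mateK H xN; have K2 := mateK H yN; rewrite mx in K1; rewrite my in K2.
    rewrite !Em ?Ed; try lia.
    by rewrite pe K1; split; split_ifs; lia.
  have [||| e1 d1 e2 d2] := settle p; try lia.
  by rewrite !Em ?Ed ?e1 ?d1 ?e2 ?d2; try lia; split; split_ifs; lia.
Qed.

Lemma vertical_dotted N t : 2 <= N -> N <= n -> ~~ odd (n - N) -> vertical n 0 N t ->
  vertical n 1 N (act n n 0 t).
Proof.
move=> N2 Nn ev [H l0 mid settle _].
have xN : n + 0 < n + n by lia.
have yN : n + 1 < n + n by lia.
have ey : (n + 0.-1).+1 = n + 1 by lia.
have [||mx dx] := mid 0; try lia.
have [||my dy] := mid 1; try lia.
have H' : matching (n + n) (act n n 0 t) by apply: matching_act => //; lia.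
have Em p : p < n + n -> mate (act n n 0 t) p = if p == n + 0 then n + 1
   else if p == n + 1 then n + 0 else if mate t p == n + 0 then 1
   else if mate t p == n + 1 then 0 else mate t p.
  by move=> pN; rewrite mate_splice // ey mx my.
have Ed p : p < n + n -> dots (act n n 0 t) p = if (p == n + 0) || (p == n + 1) then 1
   else if (mate t p == n + 0) || (mate t p == n + 1) then 1 else dots t p.
  by move=> pN; rewrite dots_splice // ey dx dy.
split=> //.
- by rewrite /act /splice [LHS]/= mx /= l0.
- move=> p p2 pN; have [|| e d] := mid p; try lia.
  by rewrite Em ?Ed ?e ?d; try lia; split; split_ifs; lia.
- move=> p pN pn op; have [||| e1 d1 e2 d2] := settle p; try lia.
  by rewrite !Em ?Ed ?e1 ?d1 ?e2 ?d2; try lia; split; split_ifs; lia.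
- move=> _; have K1 := mateK H xN; have K2 := mateK H yN; rewrite mx in K1; rewrite my in K2.
  rewrite !Em ?Ed; try lia.
  by rewrite K1; split; split_ifs; lia.
Qed.

Lemma vertical_id : vertical n 0 n (id_raw n).
Proof.
split=> //; first exact: matching_id.
- by move=> p _ pn; rewrite mate_id ?dots_id ?ifN ?addKn //; lia.
- by move=> p; lia.
Qed.

Lemma vertical_word0 N : N <= n -> ~~ odd (n - N) ->
  exists2 w, all (ltn^~ n) w & vertical n 0 N (word n w).
Proof.
move=> Nn ev; have [d ed] : exists d, n - N = 2 * d by exists (n - N)./2; lia.
elim: d N Nn ev ed => [|d IH] N Nn ev ed.
  by exists [::] => //; have -> : N = n by [lia]; exact: vertical_id.
have [||| w wN v] := IH N.+2; try lia.
exists (N.+1 :: w); first by rewrite /= wN andbT; lia.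
by apply: (@vertical_step N.+2) => //; lia.
Qed.

Lemma vertical_word k N : k <= 1 -> 2 * k <= N -> N <= n -> ~~ odd (n - N) ->
  exists2 w, all (ltn^~ n) w & vertical n k N (word n w).
Proof.
move=> k1 kN Nn ev; have [w wN v] := vertical_word0 Nn ev.
case: k k1 kN => [|[|//]] _ kN; first by exists w.
by exists (0 :: w); [rewrite /= wN andbT; lia | apply: vertical_dotted].
Qed.
End Vertical.

(** * Every diagram of two even half tangles is a word *)

Section CellWord.
Variables (n lam : nat).
Hypothesis n2 : 1 < n.
Local Notation M := (even_dotted lam n).
Local Notation T l := (lam + l).
Implicit Types (al be c : raw) (k N p : nat).

Lemma canonical_tops k N c p : M c -> canonical n lam k N c -> p < n ->
  mate c (T p) = (if p < 2 * k then T (1 - p) else if p < N then mate c (T p)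
       else if odd (p - N) then T p.-1 else T p.+1) /\
  (mate c (T p) < lam) = ((2 * k <= p) && (p < N)) /\ dots c (T p) = (p < 2 * k).
Proof.
move=> Mc [k1 kN [Nn ev settle] cup mid] pn; have [H cl _ _] := evenM Mc.
have pN : T p < lam + n by lia.
case: (ltnP p (2 * k)) => hk.
  have [c1 c2] := cup (ltac:(lia)).
  have tN : T 0 < lam + n by lia.
  have K1 := mateK H tN; have D1 := dots_mate H tN; rewrite c1 in K1 D1.
  by case: p hk {pn pN} => [|[|p]] hk; rewrite ?c1 ?c2 ?K1 ?D1 ?c2; lia.
case: (ltnP p N) => hN /=; first by have [h d] := mid p hk hN; rewrite h d.
case: (boolP (odd (p - N))) => op; last by have [-> ->] := settle p hN pn op; lia.
have [||| e d] := settle p.-1; try lia.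
have pp : p.-1.+1 = p by lia.
have h1 : T p.-1 < lam + n by lia.
have K := mateK H h1; have D := dots_mate H h1; rewrite e pp in K D.
by rewrite K D d; lia.
Qed.

(** Counting the edges gives [N]; evenness then determines [k], which is 0 or 1, from the residue of
    n - [lam] modulo 4. *)
Lemma canonical_size k N c : M c -> canonical n lam k N c ->
  N = lam + 2 * k /\ 4 %| n - lam + 2 * k.
Proof.
move=> Mc can; have [k1 kN [Nn ev _] _ mid] := can.
have /even_dottedP[v _ _ cl evs] := Mc; have H := valid_matching v.
have tops := fun p => @canonical_tops k N c p Mc can.
have e1 : N = lam + 2 * k.
  have := size_defects lam n c; rewrite (size_defects_capless v cl).
  rewrite (@count_split _ _ (fun p => p < 2 * k) (fun p => N <= p)).
    by rewrite count_iota_lt ?count_iota_ge; lia.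
  by move=> p /tops[_ [h _]]; rewrite leqNgt h; lia.
split=> //; move: evs; rewrite (sum_dots_capless v cl).
have -> : \sum_(p <- iota 0 n | p \notin defects lam n c) dots c (T p) = 2 * k.
  rewrite -[RHS](@count_iota_lt (2 * k) n); last by lia.
  rewrite countE big_mkcond; apply: eq_big_seq => p; rewrite mem_iota => /andP[_ pn].
  by have [_ [h ->]] := tops p pn; rewrite mem_defects h pn andbT; case: ifP; lia.
case: ifP => [l0|_]; last by rewrite muln0 addn0.
have zN : 0 < lam + n by lia.
have mz := mate_lt H zN; have cz := cl _ l0; have Kz := mateK H zN.
have ez : mate c 0 = T (mate c 0 - lam) by lia.
have zn : mate c 0 - lam < n by lia.
have [_ [h d]] := tops _ zn; rewrite -ez Kz l0 in h.
by rewrite -(dots_mate H zN) ez d; lia.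
Qed.

(** Both parameters are determined by [lam], and the resulting pattern of cups determines the half
    tangle by [half_unique]. *)
Lemma canonical_unique k N k' N' c c' : M c -> M c' ->
  canonical n lam k N c -> canonical n lam k' N' c' -> c = c'.
Proof.
move=> Mc Mc' can can'.
have [e1 d1] := canonical_size Mc can; have [e2 d2] := canonical_size Mc' can'.
have [k1 _ _ _ _] := can; have [k2 _ _ _ _] := can'.
have ek : k = k' by lia.
subst k' N N'.
have [H _ P _] := evenM Mc; have [H' _ P' _] := evenM Mc'.
have U al be : M al -> M be -> canonical n lam k (lam + 2 * k) al ->
    canonical n lam k (lam + 2 * k) be -> upper_half lam n be = al.
  move=> Ma Mb ca cb; apply: (half_unique Ma) => p pn.
  have [m1 [h1 t1]] := canonical_tops Ma ca pn; have [m2 [h2 t2]] := canonical_tops Mb cb pn.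
  split; first by rewrite h1 h2.
    move=> hl; have nh : (2 * k <= p) && (p < lam + 2 * k) = false by rewrite -h1; lia.
    rewrite m1 m2; case: (ltnP p (2 * k)) nh => //= hk hN; rewrite hN.
    by [].
  by move=> _; rewrite t1 t2 oddb.
by rewrite -(U c c') // (U c' c').
Qed.

Lemma cell_vertical k N c : M c -> canonical n lam k N c -> vertical n k N (cell n lam c c).
Proof.
move=> Mc can; have [k1 kN [Nn ev settle] cup mid] := can.
have [H cl P d1] := evenM Mc.
have l0 : rl c = [::] by rewrite -P.
have [Em Ed] := (mate_cell H H cl cl, dots_cell H H cl cl).
split; first exact: matching_cell.
- by rewrite rl_cell // l0.
- move=> p pk pN; have [h d] := mid p pk pN.
  have tN : T p < lam + n by lia.
  rewrite Em ?Ed; try lia.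
  rewrite /cell_mate /cell_dots [n + p < n]ltnNge leq_addr addKn /= h (mateK H) // (dots_mate H) // d.
  by lia.
- move=> p Np pn op; have [e d] := settle p Np pn op.
  rewrite !Em ?Ed; try lia.
  rewrite /cell_mate /cell_dots [n + p < n]ltnNge leq_addr addKn /= pn e d.
  by have -> : (T p.+1 < lam) = false by [lia]; split; lia.
- move=> k1'; have [e d] := cup k1'.
  rewrite !Em ?Ed; try lia.
  have nn : 0 < n by lia.
  rewrite /cell_mate /cell_dots ltnn subnn nn e d.
  have -> : (T 1 < lam) = false by lia.
  by split; lia.
Qed.

(** [P_even_dotted] is applied to each half in turn, to the second one after reflection. It ends
    with two canonical halves, which coincide by uniqueness, and their diagram is one of the
    vertical words. *)
Theorem cell_word al be : M al -> M be ->
  exists2 w, all (ltn^~ n) w & cell n lam al be = word n w.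
Proof.
pose Q t := exists2 w, all (ltn^~ n) w & t = word n w.
have Qact i t : i < n -> Q t -> Q (act n n i t).
  by move=> iN [w wN ->]; exists (i :: w); rewrite //= iN.
have Qstar t : Q t -> Q (rstar n n t).
  by move=> [w wN ->]; exists (rev w); rewrite ?all_rev // rstar_word.
have step i a b : i < n -> M a -> M (act lam n i a) -> M b -> Q (cell n lam a b) ->
    Q (cell n lam (act lam n i a) b).
  move=> iN Ma Ma' Mb; have [Ha ca _ _] := evenM Ma; have [Hb cb _ _] := evenM Mb.
  move=> /(Qact i _ iN); rewrite /cell concat_act //; first exact: matching_rstar.
    have /even_dottedP[v _ _ _ _] := Ma.
    by have := size_defects_le lam n a; rewrite size_defects_capless //; lia.
  exact: matching_cell.
have star a b : M a -> M b -> Q (cell n lam a b) -> Q (cell n lam b a).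
  move=> Ma Mb; have [Ha ca _ _] := evenM Ma; have [Hb cb _ _] := evenM Mb.
  by move=> /Qstar; rewrite rstar_cell.
have base k N k' N' a b : M a -> M b -> canonical n lam k N a -> canonical n lam k' N' b ->
    Q (cell n lam a b).
  move=> Ma Mb ca cb; rewrite -(canonical_unique Ma Mb ca cb).
  have [k1 kN [Nn ev _] _ _] := ca.
  have [w wN v] := vertical_word n2 k1 kN Nn ev.
  by exists w => //; apply: (vertical_unique n2 k1 kN Nn ev) v; apply: cell_vertical.
have half k N a b : M a -> M b -> canonical n lam k N b -> Q (cell n lam a b).
  move=> Ma Mb cb; move: a Ma; apply: (P_even_dotted n2) => [i a iN Ma Ma' Qa|k' N' a Ma ca].
    exact: step.
  exact: base ca cb.
move=> Ma Mb; move: be Mb; apply: (P_even_dotted n2) => [i b iN Mb Mb' Qb|k N b Mb cb].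
  by apply: (star) => //; apply: step => //; apply: star.
exact: half cb.
Qed.
End CellWord.

Import GRing.Theory.
Local Open Scope ring_scope.

(** * Normal forms modulo the relations *)

Section Span.
Variables (R : nzRingType) (V : lmodType R) (S : V -> Prop).

Lemma span_gen x : S x -> span_of S x.
Proof.
move=> Sx; exists [:: (1, x)]; rewrite big_seq1 scale1r; split=> // p.
by rewrite inE => /eqP->.
Qed.

Lemma span0 : span_of S 0.
Proof. by exists [::]; rewrite big_nil. Qed.

Lemma spanD x y : span_of S x -> span_of S y -> span_of S (x + y).
Proof.
move=> [s [hs ->]] [s' [hs' ->]]; exists (s ++ s'); rewrite big_cat; split=> // p.
by rewrite mem_cat => /orP[/hs|/hs'].
Qed.

Lemma spanZ a x : span_of S x -> span_of S (a *: x).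
Proof.
move=> [s [hs ->]]; exists [seq (a * p.1, p.2) | p <- s]; split=> [p /mapP[p' /hs ? ->] //|].
by rewrite big_map scaler_sumr; apply: eq_bigr => p _; rewrite scalerA.
Qed.

Lemma spanN x : span_of S x -> span_of S (- x).
Proof. by rewrite -scaleN1r; apply: spanZ. Qed.

Lemma spanB x y : span_of S x -> span_of S y -> span_of S (x - y).
Proof. by move=> Sx Sy; apply/spanD/spanN. Qed.

Lemma span_sum (I : eqType) (s : seq I) (F : I -> V) :
  (forall i, i \in s -> span_of S (F i)) -> span_of S (\sum_(i <- s) F i).
Proof.
move=> h; rewrite big_seq; elim/big_ind: _ => //; [exact: span0 | exact: spanD].
Qed.

Lemma span_span x : span_of (span_of S) x -> span_of S x.
Proof. by move=> [s [hs ->]]; apply: span_sum => p /hs /spanZ; apply. Qed.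
End Span.

(** Product, reflection and normal form are all treated as linear extensions of maps on diagrams. *)
Definition linext (V : lmodType L) (f : raw -> V) (x : Tn) : V :=
  \sum_(u <- msupp x) x@_u *: f u.

Section Linext.
Variables (V : lmodType L) (f : raw -> V).
Implicit Types (x y : Tn).

Lemma linext_supp (d : {fset raw}) x : (msupp x `<=` d)%fset ->
  linext f x = \sum_(u <- d) x@_u *: f u.
Proof.
move=> h; rewrite /linext (big_fset_incl _ h) // => u _ /mcoeff_outdom ->.
by rewrite scale0r.
Qed.

Lemma linextP a x y : linext f (a *: x + y) = a *: linext f x + linext f y.
Proof.
pose d := (msupp x `|` msupp y `|` msupp (a *: x + y))%fset.
have hx : (msupp x `<=` d)%fset by rewrite /d -fsetUA fsubsetUl.
have hy : (msupp y `<=` d)%fset by rewrite /d [(msupp x `|` _)%fset]fsetUC -fsetUA fsubsetUl.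
have hz : (msupp (a *: x + y) `<=` d)%fset by rewrite /d fsubsetUr.
rewrite (linext_supp hx) (linext_supp hy) (linext_supp hz) scaler_sumr -big_split.
by apply: eq_bigr => u _; rewrite mcoeffD mcoeffZ scalerDl scalerA.
Qed.

Lemma linext0 : linext f 0 = 0.
Proof. by rewrite /linext msupp0 big_nil. Qed.

Lemma linextD x y : linext f (x + y) = linext f x + linext f y.
Proof. by rewrite -[x]scale1r linextP !scale1r. Qed.

Lemma linextZ a x : linext f (a *: x) = a *: linext f x.
Proof. by rewrite -[a *: x]addr0 linextP linext0 addr0. Qed.

Lemma linext_sum (I : Type) (s : seq I) (F : I -> Tn) :
  linext f (\sum_(i <- s) F i) = \sum_(i <- s) linext f (F i).
Proof. by apply: (big_morph (linext f) linextD linext0). Qed.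

Lemma linext_tb t : linext f (tb t) = f t.
Proof.
rewrite (@linext_supp [fset t]%fset) ?msuppU_le // big_seq_fset1.
by rewrite mcoeffUU scale1r.
Qed.

Lemma linext_comb (I : Type) (s : seq I) (c : I -> L) (t : I -> raw) :
  linext f (\sum_(i <- s) c i *: tb (t i)) = \sum_(i <- s) c i *: f (t i).
Proof. by rewrite linext_sum; apply: eq_bigr => i _; rewrite linextZ linext_tb. Qed.
End Linext.

Lemma tb_inj t t' : tb t = tb t' -> t = t'.
Proof.
move=> e; have : (tb t)@_t = (tb t')@_t by rewrite e.
rewrite mcoeffUU mcoeffU.
by case: eqP => [-> //|_] /eqP; rewrite mulr0n oner_eq0.
Qed.

Lemma tmul_linext n x y : tmul n x y = linext (fun u => linext (fun v => tb (concat n n n v u)) y) x.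
Proof.
rewrite /tmul /linext; apply: eq_bigr => u _; rewrite scaler_sumr.
by apply: eq_bigr => v _; rewrite scalerA.
Qed.

Lemma tmul_tb n t t' : tmul n (tb t) (tb t') = tb (concat n n n t' t).
Proof. by rewrite tmul_linext !linext_tb. Qed.

Lemma tmul_comb n (I J : Type) (s : seq I) (s' : seq J) c d t t' :
  tmul n (\sum_(i <- s) c i *: tb (t i)) (\sum_(j <- s') d j *: tb (t' j)) =
  \sum_(i <- s) \sum_(j <- s') (c i * d j) *: tb (concat n n n (t' j) (t i)).
Proof.
rewrite tmul_linext linext_comb; apply: eq_bigr => i _; rewrite linext_comb scaler_sumr.
by apply: eq_bigr => j _; rewrite scalerA.
Qed.

Section NormalForm.
Variables (n : nat).
Implicit Types (t : raw) (x : Tn).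

Definition loop_weight t : L := \prod_(v <- rl t) (if odd v then 0 else delta).

Definition normal_form t : Tn :=
  if killed n t then 0 else loop_weight t *: tb (parity t).

Lemma loop_weight_odd t : has odd (rl t) -> loop_weight t = 0.
Proof.
rewrite /loop_weight; elim: (rl t) => //= v s IH; rewrite big_cons.
by case: (odd v) => /= [|/IH->]; rewrite ?mul0r ?mulr0.
Qed.

Lemma loop_weight0 t : rl t = [::] -> loop_weight t = 1.
Proof. by rewrite /loop_weight => ->; rewrite big_nil. Qed.

Lemma normal_form_eq t t' : parity t = parity t' -> loop_weight t = loop_weight t' ->
  normal_form t = normal_form t'.
Proof. by move=> e w; rewrite /normal_form -killed_parity e killed_parity w. Qed.

Lemma normal_form_scale t t' a : parity t = parity t' -> loop_weight t = a * loop_weight t' ->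
  normal_form t = a *: normal_form t'.
Proof.
move=> e w; rewrite /normal_form -killed_parity e killed_parity w.
case: (killed n t') => /=; first by rewrite scaler0.
by rewrite scalerA.
Qed.

Lemma normal_form_loop0 t : 0%N \in rl t ->
  normal_form t = delta *: normal_form (rm t, rd t, rem 0%N (rl t)).
Proof.
move=> h; apply: normal_form_scale => //.
by rewrite /loop_weight (perm_big _ (perm_to_rem h)) big_cons.
Qed.

Lemma normal_form_loop1 t : 1%N \in rl t -> normal_form t = 0.
Proof.
move=> h; rewrite /normal_form loop_weight_odd ?scale0r ?if_same //.
by apply/hasP; exists 1%N.
Qed.

Lemma normal_form_loop2 t v : v \in rl t -> (2 <= v)%N ->
  normal_form t = normal_form (rm t, rd t, sort leq ((v - 2)%N :: rem v (rl t))).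
Proof.
move=> h v2; apply: normal_form_eq => //.
rewrite /loop_weight (perm_big _ (perm_to_rem h)) [RHS](perm_big ((v - 2)%N :: rem v (rl t))).
  by rewrite !big_cons oddB // addbF.
by rewrite /rl /= perm_sort.
Qed.

Section SetDots.
Variables (t : raw) (p : nat).
Hypotheses (H : matching (n + n) t) (pN : (p < n + n)%N) (d2 : (2 <= dots t p)%N).
Local Notation t' := (set_dots t p (dots t p - 2)).

Lemma dots_set_dots r : dots t' r =
  if (r == mate t p) || (r == p) then (dots t p - 2)%N else dots t r.
Proof. 
rewrite /dots /set_dots /= !nth_set_nth /= -/(mate t p) nth_set_nth /=.
by case: (r =P mate t p); case: (r =P p).
Qed.

Lemma size_set_dots : size (rd t') = (n + n)%N.
Proof.
have := mate_lt H pN.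
by rewrite /set_dots /= !size_set_nth -/(mate t p) (size_rd H); lia.
Qed.

Lemma valid_set_dots : valid_tangle n n t -> valid_tangle n n t'.
Proof.
move=> v; have [_ nc ex] := (valid_tangleP n n t).1 v.
apply/valid_tangleP; split=> //.
- split; rewrite ?size_set_dots //; try by case: H.
  move=> r rN; rewrite !dots_set_dots.
  have Kr := mateK H rN; have Kp := mateK H pN; have Dr := dots_mate H rN.
  have -> : mate t' r = mate t r by [].
  by split_eqs.
- move=> r u rN uN; rewrite dots_set_dots; case: ifP => [/orP[/eqP->|/eqP->]|_] d0.
  + by apply: (ex (mate t p) u) => //; [exact: mate_lt H _ pN | rewrite (dots_mate H) //; lia].
  + by apply: (ex p u) => //; lia.
  + exact: (ex r u).
Qed.

Lemma normal_form_set_dots : normal_form t = normal_form t'.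
Proof.
apply: normal_form_eq => //; apply: (@raw_ext (n + n)%N).
all: rewrite /= ?size_map ?(size_rm H) ?(size_rd H) ?size_set_dots //.
move=> r rN; rewrite !dots_parity dots_set_dots.
have e : odd (dots t p - 2) = odd (dots t p) by rewrite oddB // addbF.
by case: ifP => // /orP[/eqP->|/eqP->]; rewrite e ?(dots_mate H).
Qed.
End SetDots.

Lemma killed_even_rel t : valid_tangle n n t -> reduced_tangle n n t ->
  killed n t = all (fun p => ~~ is_edge_at n t p) (iota 0 (n + n)) && odd (n_undotted_cups n n t).
Proof.
move=> v /andP[_ /allP d1].
have {}d1 p : (p < n + n)%N -> (dots t p <= 1)%N by move=> pN; apply: d1; rewrite mem_iota.
have H := valid_matching v.
have e1 : all (fun p => ~~ is_edge_at n t p) (iota 0 (n + n)) =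
    all (fun p => (mate t p < n)%N == (p < n)%N) (iota 0 (n + n)).
  by apply: eq_all => p; rewrite /is_edge_at -/(mate t p) negbK eq_sym.
rewrite e1 /killed; case: edgelessP => //= el.
have := undotted_cups_mod4 H el d1; rewrite sum_tops.
have -> : (\sum_(p <- iota 0 n) odd (dots t (n + p)) = \sum_(p <- iota 0 n) dots t (n + p))%N.
  rewrite big_seq [RHS]big_seq; apply: eq_bigr => p; rewrite mem_iota => /andP[_ pn].
  by have := d1 (n + p)%N; rewrite ltn_add2l => /(_ pn); case: (dots _ _) => [|[]].
by lia.
Qed.

Lemma linext_rel x : TLrel n x -> linext normal_form x = 0.
Proof.
move=> [s [hs ->]]; rewrite linext_sum big_seq big1 // => p /hs h; rewrite linextZ.
suff -> : linext normal_form p.2 = 0 by rewrite scaler0.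
have B u w : linext normal_form (tb u - tb w) = normal_form u - normal_form w.
  by rewrite -scaleN1r addrC linextP !linext_tb scaleN1r addrC.
case: h => [[t [v [[h ->]|[q [qN q2 ->]]|[k [kl k2 ->]]|[h ->]]]]|[t [_ v r [el od] ->]]].
- rewrite -scaleNr addrC linextP !linext_tb (normal_form_loop0 h).
  by rewrite scaleNr addNr.
- by rewrite B -normal_form_set_dots ?subrr //; exact: valid_matching.
- by rewrite B -normal_form_loop2 ?subrr.
- by rewrite linext_tb normal_form_loop1.
- by rewrite linext_tb /normal_form killed_even_rel // el od.
Qed.

Lemma valid_loops t l : valid_tangle n n t -> sorted leq l -> valid_tangle n n (rm t, rd t, l).
Proof. by rewrite /valid_tangle => /and5P[-> -> -> -> _] /= ->. Qed.

Lemma rel_normal_form t : valid_tangle n n t -> TLrel n (tb t - normal_form t).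
Proof.
(* Each loop counts one more than its dots, so that the removal of an undotted loop also decreases
   the quantity. *)
have [m] := ubnP (sumn (rd t) + sumn (map S (rl t))); elim: m t => // m IH t.
rewrite ltnS => tm v; have H := valid_matching v.
have gen y : loc_rel_gen n y -> TLrel n y by move=> h; apply: span_gen; left.
have mono t' a : tb t - normal_form t = (tb t - a *: tb t') + a *: (tb t' - normal_form t') ->
    (sumn (rd t') + sumn (map S (rl t')) < sumn (rd t) + sumn (map S (rl t)))%N ->
    valid_tangle n n t' -> loc_rel_gen n (tb t - a *: tb t') -> TLrel n (tb t - normal_form t).
  move=> -> lt v' /gen g; apply: spanD => //; apply: spanZ; apply: IH => //.
  exact: leq_trans lt tm.
have alg t' a : normal_form t = a *: normal_form t' ->
   tb t - normal_form t = (tb t - a *: tb t') + a *: (tb t' - normal_form t').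
  by move=> ->; rewrite scalerBr addrA subrK.
case: (boolP (0%N \in rl t)) => h0.
  apply: (mono (rm t, rd t, rem 0%N (rl t)) delta).
  - exact/alg/normal_form_loop0.
  - by rewrite /= ltn_add2l (perm_sumn (perm_map S (perm_to_rem h0))) /=; lia.
  - apply: valid_loops => //; apply: (subseq_sorted leq_trans) (rem_subseq _ _) _.
    exact: sorted_rl H.
  - by exists t; split=> //; apply: Or41.
case: (boolP (1%N \in rl t)) => h1.
  by rewrite normal_form_loop1 // subr0; apply: gen; exists t; split=> //; apply: Or44.
case: (boolP (has (leq 2) (rl t))) => [/hasP[k kl k2]|nh].
  apply: (mono (rm t, rd t, sort leq ((k - 2)%N :: rem k (rl t))) 1).
  - by apply: alg; rewrite scale1r; apply: normal_form_loop2.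
  - rewrite /rl /= ltn_add2l (perm_sumn (perm_map S (perm_to_rem kl))).
    rewrite (perm_sumn (perm_map S (permEl (perm_sort _ _)))) /= -/(rl t) ltn_add2r ltnS.
    by rewrite ltn_subrL (ltnW k2).
  - exact: valid_loops.
  - by rewrite scale1r; exists t; split=> //; apply: Or43; exists k.
have l0 : rl t = [::].
  by case: (rl t) h0 h1 nh => [|[|[|k]] s] //; rewrite !inE /= !negb_or.
case: (boolP (has (fun p => 2 <= dots t p)%N (iota 0 (n + n)))) => [/hasP[p]|nd].
  rewrite mem_iota => /andP[_ pN] p2.
  apply: (mono (set_dots t p (dots t p - 2)) 1).
  - by apply: alg; rewrite scale1r; apply: normal_form_set_dots.
  - rewrite /= ltn_add2r.
    have E u : size (rd u) = (n + n)%N -> sumn (rd u) = (\sum_(k <- iota 0 (n + n)) dots u k)%N.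
      move=> su; rewrite sumnE -[in LHS](mkseq_nth 0%N (rd u)) big_map su.
      by [].
    have := E _ (size_set_dots H pN p2); have := E _ (size_rd H); rewrite /= => -> ->.
    rewrite (bigD1_seq p) ?iota_uniq ?mem_iota //= [X in (_ < X)%N](bigD1_seq p) ?iota_uniq ?mem_iota //=.
    rewrite -addSn leq_add //; first by rewrite dots_set_dots eqxx orbT; lia.
    apply: leq_sum => k _; rewrite dots_set_dots; case: ifP => // /orP[/eqP->|/eqP->].
      by rewrite (dots_mate H) //; lia.
    by lia.
  - exact: valid_set_dots.
  - by rewrite scale1r; exists t; split=> //; apply: Or42; exists p.
have d1 p : (p < n + n)%N -> (dots t p <= 1)%N.
  by move=> pN; move/hasPn: nd => /(_ p); rewrite mem_iota => /(_ pN); lia.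
have P := dots_le1_parity H l0 d1.
have red : reduced_tangle n n t.
  by rewrite /reduced_tangle l0 eqxx; apply/allP => p; rewrite mem_iota => /andP[_ /d1].
rewrite /normal_form; case: ifP => [k|_]; last first.
  by rewrite loop_weight0 // scale1r P subrr; apply: span0.
rewrite subr0; apply: span_gen; right; exists t; split=> //.
- by apply: edgeless_even H _; case/andP: k => /edgelessP.
- by move: k; rewrite killed_even_rel // => /andP.
Qed.
End NormalForm.

(** The multiplication axiom asks for coefficients indexed by distinct half tangles, while an
    expansion term by term may repeat them. The choice of the merged list is the same for all [f],
    hence for all lower halves. *)
Lemma merge_terms (R : nzRingType) (V : lmodType R) (K : choiceType) (r : seq (R * K)) :
  exists r' : seq (R * K), [/\ uniq (map snd r'),
    {subset map snd r' <= map snd r} &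
    forall f : K -> V, \sum_(p <- r') p.1 *: f p.2 = \sum_(p <- r) p.1 *: f p.2].
Proof.
exists [seq (\sum_(p <- r | p.2 == k) p.1, k) | k <- undup (map snd r)].
have e : map snd [seq (\sum_(p <- r | p.2 == k) p.1, k) | k <- undup (map snd r)] = undup (map snd r).
  by rewrite -map_comp map_id.
rewrite e; split; [exact: undup_uniq | by move=> k; rewrite mem_undup |].
move=> f; rewrite big_map /=.
under eq_bigr => k _ do rewrite scaler_suml big_mkcond.
rewrite exchange_big /= !big_seq; apply: eq_bigr => p pr.
rewrite (bigD1_seq p.2) ?undup_uniq ?mem_undup ?map_f //= eqxx big1 ?addr0 // => k /negPf kp.
by rewrite eq_sym kp.
Qed.

Lemma uniq_map_eq (T T' : eqType) (f : T -> T') (s : seq T) : uniq (map f s) ->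
  {in s &, injective f}.
Proof.
elim: s => //= a s IH /andP[na us] x y; rewrite !inE => /predU1P[->|xs] /predU1P[->|ys] // e.
- by case/negP: na; rewrite e map_f.
- by case/negP: na; rewrite -e map_f.
- exact: IH.
Qed.

Fixpoint lists (k m : nat) : seq (seq nat) :=
  if k is k'.+1 then [seq x :: l | x <- iota 0 m, l <- lists k' m] else [:: [::]].

Lemma mem_lists k m l : (l \in lists k m) = (size l == k) && all (ltn^~ m) l.
Proof.
elim: k l => [|k IH] [|x l] //.
  by apply/negbTE/allpairsP => -[[]] y l' [].
rewrite /= eqSS andbCA -IH; apply/allpairsP/andP => [[[y l'] /= [+ h]] [-> ->]|[xm h]].
  by rewrite mem_iota => /andP[_ ym].
by exists (x, l); rewrite mem_iota.
Qed.

(** There are no loops, and both lists have fixed length and bounded entries. *)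
Lemma even_dotted_finite lam n : exists s : seq raw, forall a, even_dotted lam n a <-> a \in s.
Proof.
exists [seq t <- [seq (p.1, p.2, [::]) | p <- [seq (a, b) | a <- lists (lam + n) (lam + n),
   b <- lists (lam + n) 2]] | even_dotted lam n t] => a.
rewrite mem_filter; split=> [Ma|/andP[] //]; rewrite Ma /=.
have [H _ _ d1] := evenM Ma; have /even_dottedP[_ l0 _ _ _] := Ma.
apply/mapP; exists (rm a, rd a); last by rewrite -l0; case: a {Ma H d1 l0} => -[].
apply/allpairsP; exists (rm a, rd a); rewrite !mem_lists (size_rm H) (size_rd H) eqxx; split=> //=.
- apply/(all_nthP 0%N) => p; rewrite (size_rm H); exact: mate_lt H p.
- by apply/(all_nthP 0%N) => p; rewrite (size_rd H) ltnS; apply: d1.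
Qed.

Lemma sum_scale_cat (R : nzRingType) (V : lmodType R) (K : Type) (a : R) (r s : seq (R * K))
    (f : K -> V) : \sum_(p <- [seq (a * p.1, p.2) | p <- r] ++ s) p.1 *: f p.2 =
  a *: (\sum_(p <- r) p.1 *: f p.2) + \sum_(p <- s) p.1 *: f p.2.
Proof.
rewrite big_cat big_map scaler_sumr /=; congr (_ + _).
by apply: eq_bigr => p _; rewrite scalerA.
Qed.

Lemma sub_sum (V : zmodType) (a b c e f y : V) :
  a - b - c + (e - f - y) = a + e - (b + f) - (c + y).
Proof. by rewrite addrACA (addrACA a) -!opprD. Qed.

Lemma word_cat n w u : actw n n w (word n u) = word n (w ++ u).
Proof. by rewrite /word /actw foldr_cat. Qed.

(** * The algebra of words, the ideal of relations and the cell structure *)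

Section Main.
Variable n : nat.
Hypothesis n2 : (1 < n)%N.
Local Notation word := (word n).
Local Notation nf := (normal_form n).
Local Notation is_word := (all (ltn^~ n)).
Implicit Types (x y z : Tn) (t : raw) (w u : seq nat).

Lemma concat_e i t : (i < n)%N -> matching (n + n) t -> concat n n n t (e_raw n i) = act n n i t.
Proof.
move=> iN H; rewrite -act_id // concat_act ?concat_id //; [exact: matching_id | exact: leq_addr].
Qed.

Lemma foldr_word (w : seq 'I_n) :
  foldr (tmul n) (tone n) [seq egen i | i <- w] = tb (word (map val w)).
Proof.
elim: w => //= i w ->; rewrite tmul_tb concat_e //.
by apply: matching_word => //; apply/allP => _ /mapP[j _ ->]; exact: ltn_ord.
Qed.

Lemma DT_word w : is_word w -> DT n (tb (word w)).
Proof.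
move=> wN; have [w' e] : exists w' : seq 'I_n, map val w' = w.
  elim: w wN => [_|i w IH /andP[iN /IH[w' <-]]]; first by exists [::].
  by exists (Ordinal iN :: w').
by apply: span_gen; exists w'; rewrite foldr_word e.
Qed.

Lemma DTP x : DT n x <-> exists s : seq (L * seq nat),
  (forall p, p \in s -> is_word p.2) /\ x = \sum_(p <- s) p.1 *: tb (word p.2).
Proof.
split=> [[s [hs ->]]|[s [hs ->]]]; last first.
  by apply: span_sum => p /hs wN; apply: spanZ; exact: DT_word.
elim: s hs => [|p s IH] hs; first by exists [::]; rewrite !big_nil.
have [s' [hs' e]] := IH (fun q qs => hs q (mem_behead (s := p :: s) qs)).
have [w ew] := hs p (mem_head _ _).
exists ((p.1, map val w) :: s'); rewrite !big_cons -e ew foldr_word; split=> //.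
move=> q; rewrite inE => /orP[/eqP->|/hs' //] /=.
by apply/allP => _ /mapP[j _ ->]; exact: ltn_ord.
Qed.

Lemma DT_mul x y : DT n x -> DT n y -> DT n (tmul n x y).
Proof.
move=> /DTP[s [hs ->]] /DTP[s' [hs' ->]]; rewrite tmul_comb.
apply: span_sum => p /hs pN; apply: span_sum => q /hs' qN; apply: spanZ.
by rewrite (concat_words n2 qN pN); apply: DT_word; rewrite all_cat pN qN.
Qed.

Lemma tstar_linext x : tstar n x = linext (fun t => tb (rstar n n t)) x.
Proof. by []. Qed.

Lemma DT_star x : DT n x -> DT n (tstar n x).
Proof.
move=> /DTP[s [hs ->]]; rewrite tstar_linext linext_comb.
apply: span_sum => p /hs pN; apply: spanZ; rewrite rstar_word //.
by apply: DT_word; rewrite all_rev.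
Qed.

Lemma tstar_mul x y : DT n x -> DT n y -> tstar n (tmul n x y) = tmul n (tstar n y) (tstar n x).
Proof.
move=> /DTP[s [hs ->]] /DTP[s' [hs' ->]]; rewrite tmul_comb !tstar_linext !linext_comb tmul_comb.
rewrite linext_sum; under eq_bigr => p _ do rewrite linext_comb.
rewrite [LHS]exchange_big; apply: eq_big_seq => q /hs' qN.
apply: eq_big_seq => p /hs pN.
have [pN' qN' pqN] : [/\ is_word (rev p.2), is_word (rev q.2) & is_word (p.2 ++ q.2)].
  by rewrite !all_rev all_cat pN qN.
rewrite (concat_words n2 qN pN) (rstar_word n2 pN) (rstar_word n2 qN) (rstar_word n2 pqN).
by rewrite (concat_words n2 pN' qN') rev_cat mulrC.
Qed.

Lemma tstarK x : DT n x -> tstar n (tstar n x) = x.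
Proof.
move=> /DTP[s [hs ->]]; rewrite !tstar_linext !linext_comb.
by apply: eq_big_seq => p /hs pN; rewrite (rstarK (matching_word n2 pN)).
Qed.

Lemma rel_comb (I : eqType) (s : seq I) (c : I -> L) (t : I -> raw) :
  (forall i, i \in s -> valid_tangle n n (t i)) ->
  \sum_(i <- s) c i *: nf (t i) = 0 -> TLrel n (\sum_(i <- s) c i *: tb (t i)).
Proof.
move=> v e; rewrite -[X in TLrel n X]subr0 -[X in _ - X]e -sumrB; apply: span_sum => i /v vi.
by rewrite -scalerBr; apply: spanZ; exact: rel_normal_form.
Qed.

Lemma rel_scale t t' a : valid_tangle n n t -> valid_tangle n n t' ->
  nf t = a *: nf t' -> TLrel n (tb t - a *: tb t').
Proof.
move=> v v' e; have -> : tb t - a *: tb t' = (tb t - nf t) - a *: (tb t' - nf t').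
  by rewrite scalerBr -e opprB addrA subrK.
by apply: spanB; [|apply: spanZ]; exact: rel_normal_form.
Qed.

(** The converse of [linext_rel] on the algebra: a combination of valid diagrams differs from its
    normal form by relations. Membership in the span of the relations can thus be tested by a linear
    map. *)
Lemma DT_rel x : DT n x -> linext nf x = 0 -> TLrel n x.
Proof.
move=> /DTP[s [hs ->]]; rewrite linext_comb; apply: rel_comb => p /hs; exact: valid_word.
Qed.

Lemma loop_weight_act i t : (i < n)%N -> matching (n + n) t ->
  loop_weight (act n n i t) = loop_weight t * loop_weight (act n n i (parity t)).
Proof.
move=> iN H; rewrite /loop_weight /act /splice /rl /= mate_parity -/(rl t).
case: (mate t _ == _); last by rewrite big_nil mulr1.
rewrite (perm_big (dots t (n + i.-1) + (i == 0) :: rl t)%N) ?perm_sort //.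
rewrite big_cons mulrC; congr (_ * _).
by rewrite [RHS]big_seq1 dots_parity !oddD !oddb.
Qed.

(** The generator acts on normal forms by a linear map, so it preserves the vanishing of the normal
    form. Two facts enter: loop weights are multiplicative, and a killed tangle remains killed or
    acquires an odd loop. *)
Lemma normal_form_act i t : (i < n)%N -> matching (n + n) t ->
  nf (act n n i t) = linext (fun r => nf (act n n i r)) (nf t).
Proof.
move=> iN H.
have xN : (n + i.-1 < n + n)%N by lia.
have yN : ((n + i.-1).+1 < n + n)%N by lia.
have E : nf (act n n i t) = loop_weight t *: nf (act n n i (parity t)).
  apply: normal_form_scale; last exact: loop_weight_act.
  by rewrite -[LHS]parity_splice_parity.
rewrite E [nf t]/normal_form; case: (boolP (killed n t)) => k; last by rewrite linextZ linext_tb.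
rewrite linext0 /normal_form; case: (boolP (has odd (rl (act n n i (parity t))))) => h.
  by rewrite (loop_weight_odd h) scale0r if_same scaler0.
rewrite killed_act ?scaler0 //; first exact: matching_parity.
by rewrite killed_parity.
Qed.

Lemma normal_form_rstar t : matching (n + n) t -> (4 %| dot_sum (n + n) t)%N ->
  nf (rstar n n t) = linext (fun r => tb (rstar n n r)) (nf t).
Proof.
move=> H ev; rewrite /normal_form.
have -> : loop_weight (rstar n n t) = loop_weight t by [].
case: (boolP (has odd (rl t))) => h.
  by rewrite (loop_weight_odd h) !scale0r !if_same linext0.
by rewrite killed_rstar //; case: (killed n t); rewrite ?linext0 // linextZ linext_tb parity_rstar.
Qed.

(** Instead of multiplying each generating relation, the vanishing of the normal form is carried
    through the letters of [w] by the linear maps of [normal_form_act]. *)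
Lemma rel_word_mul w y : is_word w -> DT n y -> TLrel n y -> TLrel n (tmul n (tb (word w)) y).
Proof.
move=> wN /DTP[s [hs ->]] /linext_rel; rewrite linext_comb => e0.
rewrite tmul_linext linext_tb linext_comb.
have -> : \sum_(p <- s) p.1 *: tb (concat n n n (word p.2) (word w)) =
   \sum_(p <- s) p.1 *: tb (word (w ++ p.2)).
  by apply: eq_big_seq => p /hs pN; rewrite (concat_words n2 pN wN).
apply: rel_comb => [p /hs pN|]; first by apply: valid_word; rewrite ?all_cat ?wN.
elim: w wN => [_|i w IH /andP[iN wN]]; first exact: e0.
transitivity (linext (fun r => nf (act n n i r)) (\sum_(p <- s) p.1 *: nf (word (w ++ p.2)))).
  rewrite linext_sum; apply: eq_big_seq => p /hs pN; rewrite linextZ; congr (_ *: _).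
  have wpN : is_word (w ++ p.2) by rewrite all_cat pN andbT; exact: wN.
  exact: normal_form_act iN (matching_word n2 wpN).
by rewrite (IH wN) linext0.
Qed.

Lemma rel_star x : DT n x -> TLrel n x -> TLrel n (tstar n x).
Proof.
move=> Dx /linext_rel e; apply: DT_rel; first exact: DT_star.
transitivity (linext (fun r => tb (rstar n n r)) (linext nf x)); last by rewrite e linext0.
have [s [hs ex]] := (DTP x).1 Dx.
have e1 : tstar n x = \sum_(p <- s) p.1 *: tb (rstar n n (word p.2)).
  rewrite tstar_linext ex; exact: linext_comb.
have e2 : linext nf x = \sum_(p <- s) p.1 *: nf (word p.2).
  rewrite ex; exact: linext_comb.
rewrite e1 e2 [RHS]linext_sum [LHS]linext_comb.
apply: eq_big_seq => p /hs pN; rewrite linextZ; congr (_ *: _); apply: normal_form_rstar; first exact: (matching_word n2 pN).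
exact: (dot_sum_word n2 pN).
Qed.

Lemma rel_mul x y : DT n x -> DT n y -> TLrel n y -> TLrel n (tmul n x y).
Proof.
move=> /DTP[s [hs ->]] Dy Ry; rewrite tmul_linext linext_comb.
apply: span_sum => p /hs pN; apply: spanZ.
by have := rel_word_mul pN Dy Ry; rewrite tmul_linext linext_tb.
Qed.

(** Reflection preserves the relations and turns right multiplication into left multiplication. *)
Lemma rel_mul_r x y : DT n x -> DT n y -> TLrel n y -> TLrel n (tmul n y x).
Proof.
move=> Dx Dy Ry; rewrite -[tmul n y x]tstarK; last exact: DT_mul.
apply: rel_star; first by apply: DT_star; apply: DT_mul.
by rewrite tstar_mul //; apply: rel_mul; [exact: DT_star | exact: DT_star | exact: rel_star].
Qed.

Section Cells.
Variables (lam : nat) (a b : raw).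
Hypotheses (Ma : even_dotted lam n a) (Mb : even_dotted lam n b).

Lemma valid_cell : valid_tangle n n (cell n lam a b).
Proof. by have [w wN ->] := cell_word n2 Ma Mb; apply: valid_word. Qed.

Lemma DT_cell : DT n (tb (cell n lam a b)).
Proof. by have [w wN ->] := cell_word n2 Ma Mb; apply: DT_word. Qed.

Lemma normal_form_cell : nf (cell n lam a b) = tb (parity (cell n lam a b)).
Proof.
have [Ha ca Pa _] := evenM Ma; have [Hb cb Pb _] := evenM Mb.
rewrite /normal_form (killed_cell Ma Mb) loop_weight0 ?scale1r //.
by rewrite rl_cell // -Pa -Pb.
Qed.
End Cells.

(** A nonzero normal form means that there is no odd loop and that the tangle is not killed. The
    latter is what the splitting requires when there are no edges. *)
Lemma decomposition t : valid_tangle n n t -> (4 %| dot_sum (n + n) t)%N -> nf t <> 0 ->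
  exists a b, [/\ even_dotted (size (defects n n t)) n a, even_dotted (size (defects n n t)) n b &
    nf t = loop_weight t *: nf (cell n (size (defects n n t)) a b)].
Proof.
move=> v ev nz; have H := valid_matching v.
have nk : killed n t = false by apply/negP => k; apply: nz; rewrite /normal_form k.
have no : ~~ has odd (rl t).
  by apply/negP => h; apply: nz; rewrite /normal_form (loop_weight_odd h) scale0r if_same.
have v0 := valid_parity v; have red : parity (parity t) = parity t.
  by apply: dots_le1_parity (valid_matching v0) _ _ => // p _; rewrite dots_parity; case: (odd _).
have ev0 : (4 %| \sum_(p <- iota 0 (n + n)) dots (parity t) p)%N.
  by have := dot_sum_parity H no; rewrite {1}/dot_sum /= muln0 addn0; lia.
have eD : defects n n (parity t) = defects n n t by [].
have c0 : (0 < size (defects n n (parity t)))%N ||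
    (4 %| n + \sum_(p <- iota 0 n) dots (parity t) (n + p))%N.
  case: posnP => //= /size0nil D0; rewrite eD in D0.
  move: nk; rewrite /killed; case: edgelessP => /= [el|nel] h.
    move/negbFE: h; congr (4 %| _ + _)%N; apply: eq_bigr => p _; exact: esym (dots_parity _ _).
  case: nel => p pN.
  have top q : (q < n)%N -> (n <= mate t (n + q))%N.
    move=> qn; rewrite leqNgt; apply/negP => h1.
    by have := mem_defects n n t q; rewrite D0 h1 qn.
  case: (ltnP p n) => pn; last first.
    have pe : p = (n + (p - n))%N by lia.
    by apply/negbTE; rewrite -leqNgt pe top //; lia.
  have mN := mate_lt H pN; case: (ltnP (mate t p) n) => // h1.
  have := top (mate t p - n)%N; rewrite subnKC // (mateK H) //; lia.
have [Ma Mb] := even_halves v0 red ev0 c0.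
exists (upper_half n n (parity t)), (upper_half n n (rstar n n (parity t))).
rewrite -eD; split=> //.
by rewrite normal_form_cell // (cell_halves v0 red ev0) /normal_form nk.
Qed.

Local Notation lower mu := (fun z => exists i, [/\ cidx n (Mset n) i, (i.1.1 < mu)%N
   & z = Cof (Cbasis n) i]).

Lemma cidxP lam a b : even_dotted lam n a -> even_dotted lam n b -> cidx n (Mset n) (lam, a, b).
Proof.
move=> Ma Mb; split=> //=; have /even_dottedP[v _ _ cl _] := Ma.
by have := size_defects_le lam n a; rewrite (size_defects_capless v cl).
Qed.

(** The word acts on the upper half alone and yields a tangle [T] independent of [d], so the
    coefficients are independent of [d] as well. If [T] has no cap it reduces to a multiple of an
    even half tangle, or to zero in the presence of an odd loop; if it has a cap, edges have been
    lost. *)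
Lemma word_mul_cell w mu g : is_word w -> even_dotted mu n g ->
  exists r : seq (L * raw), (forall p, p \in r -> even_dotted mu n p.2) /\
    forall d, even_dotted mu n d -> exists y, span_of (lower mu) y /\
      TLrel n (tb (actw n n w (cell n mu g d)) - \sum_(p <- r) p.1 *: tb (cell n mu p.2 d) - y).
Proof.
move=> wN Mg; have /even_dottedP[vg l0 _ cg evg] := Mg; have Hg := valid_matching vg.
pose T := actw mu n w g.
have vT : valid_tangle mu n T by apply: valid_actw.
have HT := valid_matching vT.
have mun : (mu <= n)%N by have := size_defects_le mu n g; rewrite (size_defects_capless vg cg).
have vC d (Md : even_dotted mu n d) : valid_tangle n n (actw n n w (cell n mu g d)).
  by apply: valid_actw => //; exact: valid_cell.
have EC d (Md : even_dotted mu n d) : actw n n w (cell n mu g d) = cell n mu T d.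
  have [Hd cd _ _] := evenM Md.
  rewrite /cell concat_actw //; [exact: matching_rstar | by lia | exact: matching_cell].
have evC d (Md : even_dotted mu n d) : (4 %| dot_sum (n + n) (actw n n w (cell n mu g d)))%N.
  have [u uN ->] := cell_word n2 Mg Md.
  have -> : actw n n w (word u) = word (w ++ u) by exact: word_cat.
  by apply: dot_sum_word => //; rewrite all_cat wN uN.
have small (t : raw) : valid_tangle n n t -> nf t = 0 -> TLrel n (tb t).
  by move=> v e; rewrite -[tb t]subr0 -e; exact: rel_normal_form.
case: (boolP (all (fun j => mu <= mate T j)%N (iota 0 mu))) => [/allP cT|ncT].
  have {}cT : capless mu T by move=> j jm; apply: cT; rewrite mem_iota.
  case: (boolP (has odd (rl T))) => hT.
    exists [::]; split=> // d Md; exists 0; split; first exact: span0.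
    rewrite big_nil !subr0; apply: small; first exact: vC.
    have [Hd cd Pd _] := evenM Md.
    rewrite /normal_form EC // loop_weight_odd ?scale0r ?if_same //.
    by rewrite rl_cell // (perm_has _ (permEl (perm_sort _ _))) has_cat hT orbT.
  have MT : even_dotted mu n (parity T).
    apply: even_dotted_parity => //.
    have := dot_sum_actw n2 wN Hg; rewrite -/T; move: evg; rewrite {2}/dot_sum l0 muln0 addn0.
    by lia.
  exists [:: (loop_weight T, parity T)]; split=> [p|d Md]; first by rewrite inE => /eqP->.
  exists 0; split; first exact: span0.
  rewrite big_seq1 subr0; apply: rel_scale; [exact: vC | exact: valid_cell |].
  have [Hd cd Pd _] := evenM Md; have [HpT _ PT _] := evenM MT.
  rewrite EC //; apply: normal_form_scale; first by apply: parity_cell.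
  rewrite /loop_weight !rl_cell //.
  rewrite !(perm_big _ (permEl (perm_sort _ _))) /= cats0 big_cat /=.
  have -> : rl d = [::] by rewrite -Pd.
  by rewrite !big_nil mul1r mulr1.
exists [::]; split=> // d Md; rewrite big_nil subr0.
have [Hd cd _ _] := evenM Md.
(* Every edge of the product runs through an edge of [T]; since [T] has a cap, fewer than [mu] of
   its bottom points belong to edges. *)
have sz : (size (defects n n (actw n n w (cell n mu g d))) < mu)%N.
  apply: (@leq_ltn_trans (size (defects mu n T))).
    apply: uniq_leq_size => [|p]; first by rewrite filter_uniq ?iota_uniq.
    rewrite !mem_defects EC // => /andP[h pn]; rewrite pn andbT ltnNge; apply/negP => h2.
    move: h; rewrite /cell mate_tabulate ?ltn_add2l // cstartE /outer_state [(n + p < n)%N]ltnNge leq_addr.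
    by rewrite addKn walk_false h2 /=; lia.
  have := congr1 size (map_mate_defects vT); rewrite size_map => ->.
  move: ncT; rewrite all_count size_iota size_filter ltn_neqAle => -> /=.
  by rewrite -[X in (_ <= X)%N](size_iota 0 mu) count_size.
case: (eqVneq (nf (actw n n w (cell n mu g d))) 0) => [e|/eqP nz].
  by exists 0; split; [exact: span0 | rewrite subr0; apply: small => //; exact: vC].
have [a [b [Ma Mb e]]] := decomposition (vC d Md) (evC d Md) nz.
exists (loop_weight (actw n n w (cell n mu g d)) *:
   tb (cell n (size (defects n n (actw n n w (cell n mu g d)))) a b)); split.
  apply/spanZ/span_gen; exists (size (defects n n (actw n n w (cell n mu g d))), a, b).
  by split=> //; exact: cidxP.
by apply: rel_scale => //; [exact: vC | exact: valid_cell].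
Qed.

Lemma DT_mul_cell x mu g : DT n x -> even_dotted mu n g ->
  exists r : seq (L * raw), (forall p, p \in r -> even_dotted mu n p.2) /\
    forall d, even_dotted mu n d -> exists y, span_of (lower mu) y /\
      TLrel n (tmul n x (tb (cell n mu g d)) - \sum_(p <- r) p.1 *: tb (cell n mu p.2 d) - y).
Proof.
move=> /DTP[s [hs ->]] Mg.
have E d : even_dotted mu n d -> tmul n (\sum_(p <- s) p.1 *: tb (word p.2)) (tb (cell n mu g d)) =
    \sum_(p <- s) p.1 *: tb (actw n n p.2 (cell n mu g d)).
  move=> Md; have [Hg cg _ _] := evenM Mg; have [Hd cd _ _] := evenM Md.
  rewrite tmul_linext linext_comb; apply: eq_big_seq => p /hs pN.
  by rewrite linext_tb (concat_word n2 pN (matching_cell Hg Hd cg cd)).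
suff [r [hr R]] : exists r : seq (L * raw), (forall p, p \in r -> even_dotted mu n p.2) /\
    forall d, even_dotted mu n d -> exists y, span_of (lower mu) y /\
      TLrel n (\sum_(p <- s) p.1 *: tb (actw n n p.2 (cell n mu g d))
               - \sum_(p <- r) p.1 *: tb (cell n mu p.2 d) - y).
  by exists r; split=> // d Md; rewrite E //; exact: R.
elim: s hs {E} => [|p s IH] hs.
  exists [::]; split=> // d Md; exists 0; rewrite !big_nil !subr0.
  by split; exact: span0.
have [r [hr R]] := IH (fun q qs => hs q (mem_behead (s := p :: s) qs)).
have [r' [hr' R']] := word_mul_cell (hs p (mem_head _ _)) Mg.
exists ([seq (p.1 * c.1, c.2) | c <- r'] ++ r); split.
  by move=> c; rewrite mem_cat => /orP[/mapP[v /hr' ? ->] //|/hr].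
move=> d Md; have [y [ly Ry]] := R d Md; have [y' [ly' Ry']] := R' d Md.
exists (p.1 *: y' + y); split; first by apply: spanD => //; exact: spanZ.
have := spanD (spanZ p.1 Ry') Ry; congr (span_of _ _).
rewrite (sum_scale_cat _ _ _ (fun b => tb (cell n mu b d))) big_cons !scalerBr; exact: sub_sum.
Qed.
End Main.

(* hat{TL}(W) = DT_n / (DT_n n TLrel n) is cellular with cell datum
   Lambda = {0..n}, M(lambda) = even dotted (lambda,n)-tangles,
   C^lambda_{alpha,beta} = alpha on top of beta^*, and * = reflection. *)
Theorem theorem4p21 (n : nat) : (4 <= n)%N ->
  is_cellular (DT n) (TLrel n) (tmul n) (tone n) (tstar n)
              n (Mset n) (Cbasis n).
Proof.
move=> n4; have n2 : (1 < n)%N by lia.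
split.
- by move=> x; exact: span_span.
- exact: (DT_word n2 (w := [::])).
- by move=> x y; apply: DT_mul.
- by move=> x; exact: span_span.
- by move=> x y Dx Dy Ry; split; [exact: rel_mul | exact: rel_mul_r].
- by move=> lam _; exact: even_dotted_finite.
- by move=> [[lam a] b] [/= _ Ma Mb]; exact: DT_cell.
- move=> [[lam a] b] [[lam' a'] b'] [/= _ Ma Mb] [/= _ Ma' Mb'] /linext_rel.
  rewrite /Cof /= -scaleN1r addrC linextP !linext_tb scaleN1r addrC => /eqP; rewrite subr_eq0 => /eqP.
  rewrite !normal_form_cell // => /tb_inj; exact: cell_inj.
- move=> x /(DTP n2)[s [hs ->]].
  elim: s hs => [|p s IH] hs.
    by exists [::]; rewrite !big_nil subrr; split=> //; exact: span0.
  have [s' [hs' Rs]] := IH (fun q qs => hs q (mem_behead (s := p :: s) qs)).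
  have pN := hs p (mem_head _ _); have v := valid_word n2 pN.
  have ev := dot_sum_word n2 pN.
  rewrite big_cons; case: (eqVneq (normal_form n (word n p.2)) 0) => [e|/eqP nz].
    exists s'; split=> //; rewrite -addrA; apply: spanD => //; apply: spanZ.
    by rewrite -[tb _]subr0 -e; exact: rel_normal_form.
  have [a [b [Ma Mb e]]] := decomposition n2 v ev nz.
  set lam := size _ in Ma Mb e.
  exists ((p.1 * loop_weight (word n p.2), (lam, a, b)) :: s'); split.
    by move=> q; rewrite inE => /orP[/eqP->|/hs' //]; exact: cidxP.
  rewrite big_cons opprD addrACA; apply: spanD => //.
  rewrite -scalerA -scalerBr; apply: spanZ; apply: rel_scale => //.
  exact: valid_cell.
- move=> s us hs /linext_rel; rewrite linext_sum => e p ps.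
  have [/= _ Ma Mb] := hs p ps.
  (* Linear independence: the coefficient at [c] of the normal form is that of [p] alone, because
     different indices have different reduced diagrams by [cell_inj]. *)
  pose c := parity (cell n p.2.1.1 p.2.1.2 p.2.2).
  have := congr1 (fun z : Tn => z@_c) e; rewrite mcoeff0 raddf_sum /= => <-.
  have us' := map_uniq us.
  rewrite (bigD1_seq p) //= big1_seq ?addr0; last first.
    move=> q /andP[qp qs]; have [/= _ Mqa Mqb] := hs q qs.
    rewrite linextZ linext_tb normal_form_cell // mcoeffZ mcoeffU.
    case: eqP => [E|_]; last by rewrite mulr0n mulr0.
    have := cell_inj Mqa Mqb Ma Mb E; move=> E2.
    have e2 : q.2 = p.2 by case: (q.2) (p.2) E2 => [[? ?] ?] [[? ?] ?].
    by rewrite (uniq_map_eq us qs ps e2) eqxx in qp.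
  by rewrite linextZ linext_tb normal_form_cell // mcoeffZ mcoeffUU mulr1.
- by move=> a x y; rewrite !tstar_linext linextP.
- by move=> x; apply: DT_star.
- by move=> x; apply: rel_star.
- by move=> x y Dx Dy; rewrite tstar_mul // subrr; exact: span0.
- by move=> x Dx; rewrite tstarK // subrr; exact: span0.
- move=> lam a b [/= _ Ma Mb].
  have [Ha ca _ _] := evenM Ma; have [Hb cb _ _] := evenM Mb.
  rewrite tstar_linext linext_tb -/(cell n lam a b) rstar_cell // subrr; exact: span0.
- move=> x mu g Dx _ Mg; have [r [hr R]] := DT_mul_cell n2 Dx Mg.
  have [r' [ur' sr' e]] := @merge_terms L Tn raw r.
  exists r'; split; last split=> // d Md.
    by move=> p pr; have /sr'/mapP[p' /hr ? ->] := map_f snd pr.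
  have [y [ly Ry]] := R d Md; exists y; split=> //.
  by rewrite (e (fun a => tb (cell n mu a d))).
Qed.
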